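(* Let $A$ be a finitely generated connected graded algebra over a field $k$, of Gelfand–Kirillov dimension one. Suppose that $A$ satisfies at least one of the following properties: (i) $A$ is two-sided Noetherian or right Noetherian; (ii) $A$ is prime or semiprime; (iii) $A$ is coherent; (iv) $A$ is finitely presented and the field $k$ is finite; (v) $A$ is Koszul; (vi) $A$ has finite Backelin's rate. Then the Hilbert function $n\mapsto\dim_k A_n$ of $A$ is periodic.
   Context: A connected graded algebra over $k$ is an associative algebra $A=\bigoplus_{i\ge 0}A_i$ with $A_0=k$. ''Two-sided Noetherian'' means weakly Noetherian, i.e. satisfying the ascending chain condition for two-sided ideals. $A$ is (right graded) coherent if every finitely generated homogeneous right ideal of $A$ is finitely presented; equivalently, the kernel of any homogeneous map between finitely generated free right modules is finitely generated. $A$ is Koszul iff $m_i(A)\le i$ for all $i\ge0$, where $m_i(A)=\sup\{j\mid \mathrm{Tor}_i^A(k,k)_j\ne0\}$ (and $m_i(A)=0$ if $\mathrm{Tor}_i^A(k,k)=0$). $A$ has finite Backelin's rate if there is a number $r$ such that for every $i$ the space $\mathrm{Tor}_i^A(k,k)$ is concentrated in degrees at most $ri$. ''Periodic'' means eventually periodic: there are positive integers $d,N$ with $\dim_k A_n=\dim_k A_{n+d}$ for all $n\ge N$. *)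

(* Defs.v *)
From HB Require Import structures.
From mathcomp Require Import all_boot all_order all_algebra.
From mathcomp Require Import finmap.
From mathcomp Require Import all_classical all_reals.
From mathcomp Require Import ereal normedtype sequences exp.
(* The notations of monalg clash with those of MathComp-Analysis. *)
From mathcomp Require Import -(notations) monalg.

Set Implicit Arguments.
Unset Strict Implicit.
Unset Printing Implicit Defensive.

Import Order.TTheory GRing.Theory Num.Theory.

Local Open Scope classical_set_scope.
Local Open Scope ring_scope.

Section LinearAlgebra.
Context {k : fieldType} {M : lmodType k}.

Definition subspace (V : set M) : Prop :=
  V 0 /\ forall (c : k) (x y : M), V x -> V y -> V (c *: x + y).

Definition lspan (S : set M) : set M :=
  [set x | exists (n : nat) (c : 'I_n -> k) (e : 'I_n -> M),
     (forall i, S (e i)) /\ x = \sum_(i < n) c i *: e i].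

Definition has_dim (V : set M) (n : nat) : Prop :=
  exists e : 'I_n -> M,
    [/\ forall i, V (e i),
        forall x, V x -> exists c : 'I_n -> k, x = \sum_(i < n) c i *: e i
      & forall c : 'I_n -> k,
          \sum_(i < n) c i *: e i = 0 -> forall i, c i = 0].

(* Only meaningful on finite-dimensional subspaces; its value is 0 on the
   infinite-dimensional ones. *)
Definition dimk (V : set M) : nat := xget 0%N [set n | has_dim V n].

End LinearAlgebra.

Section RingTheory.
Context {A : nzRingType}.

Definition right_ideal (I : set A) : Prop :=
  [/\ I 0, forall x y, I x -> I y -> I (x - y)
    & forall x a, I x -> I (x * a)].

Definition two_sided_ideal (I : set A) : Prop :=
  right_ideal I /\ forall x a, I x -> I (a * x).

Definition ideal_generated (S : set A) : set A :=
  [set x | forall I, two_sided_ideal I -> S `<=` I -> I x].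

Definition acc (P : set A -> Prop) : Prop :=
  forall I : nat -> set A,
    (forall n, P (I n)) -> (forall n, I n `<=` I n.+1) ->
    exists N : nat, forall n, (N <= n)%N -> I n = I N.

(* The right ideal I is isomorphic to the cokernel of a matrix
   S : A^p -> A^m acting on column vectors by left multiplication, which is
   right A-linear. *)
Definition finitely_presented_right_ideal (I : set A) : Prop :=
  exists (m p : nat) (a : 'rV[A]_m) (S : 'M[A]_(m, p)),
    I = [set (a *m x) 0 0 | x in [set: 'cV[A]_m]] /\
    forall x : 'cV[A]_m, a *m x = 0 <-> exists y : 'cV[A]_p, x = S *m y.

Definition finitely_generated_right_ideal (I : set A) : Prop :=
  exists (m : nat) (a : 'rV[A]_m),
    I = [set (a *m x) 0 0 | x in [set: 'cV[A]_m]].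

End RingTheory.

Definition right_noetherian (A : nzRingType) : Prop := acc (@right_ideal A).

Definition two_sided_noetherian (A : nzRingType) : Prop :=
  acc (@two_sided_ideal A).

Definition prime_ring (A : nzRingType) : Prop :=
  forall I J : set A, two_sided_ideal I -> two_sided_ideal J ->
    (forall x y, I x -> J y -> x * y = 0) -> I = [set 0] \/ J = [set 0].

Definition semiprime_ring (A : nzRingType) : Prop :=
  forall I : set A, two_sided_ideal I ->
    (forall x y, I x -> I y -> x * y = 0) -> I = [set 0].

(** The free associative algebra k<X_0, ..., X_(n-1)>. *)
Notation free_algebra k n := (malg (fmonom 'I_n) k).

Definition nceval {k : fieldType} {A : algType k} {n : nat} (x : 'I_n -> A)
    (f : free_algebra k n) : A :=
  mmap (fun c : k => c%:A) (fun w : fmonom 'I_n => \prod_(i <- w) x i) f.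

Definition finitely_generated {k : fieldType} (A : algType k) : Prop :=
  exists (n : nat) (x : 'I_n -> A), forall a : A, exists f, nceval x f = a.

Definition finitely_presented {k : fieldType} (A : algType k) : Prop :=
  exists (n : nat) (x : 'I_n -> A) (r : seq (free_algebra k n)),
    (forall a : A, exists f, nceval x f = a) /\
    [set f | nceval x f = 0] = ideal_generated [set f | f \in r].

(** For a finite family v spanning V, the space V^0 + V^1 + ... + V^n. *)
Definition power_span {k : fieldType} {A : algType k} (v : seq A) (n : nat) :
    set A :=
  lspan [set \prod_(a <- w) a
        | w in [set w : seq A | (size w <= n)%N /\ {subset w <= v}]].

(** The supremum, over the finite-dimensional subspaces V of A, of
    limsup_n log_n dim (V^0 + ... + V^n). *)
Definition GKdim (R : realType) {k : fieldType} (A : algType k) : \bar R :=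
  ereal_sup [set limn_esup (fun n : nat =>
               (ln (dimk (power_span v n))%:R / ln n%:R : R)%:E)
            | v in [set: seq A]].

Section Graded.
Context {k : fieldType} {A : algType k}.

Record connected_graded (G : nat -> set A) : Prop := {
  graded_subspace : forall i, subspace (G i);
  graded_mul : forall i j x y, G i x -> G j y -> G (i + j)%N (x * y);
  graded_decomp : forall a : A, exists (n : nat) (f : nat -> A),
    (forall i, G i (f i)) /\ a = \sum_(i < n) f i;
  graded_indep : forall (n : nat) (f : nat -> A),
    (forall i, G i (f i)) -> \sum_(i < n) f i = 0 ->
    forall i, (i < n)%N -> f i = 0;
  graded_connected : G 0%N = range (fun c : k => c%:A : A) }.

Variable G : nat -> set A.

Definition homogeneous (I : set A) : Prop :=
  forall (n : nat) (f : nat -> A), (forall i, G i (f i)) ->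
    I (\sum_(i < n) f i) -> forall i, (i < n)%N -> I (f i).

Definition coherent : Prop :=
  forall I : set A, right_ideal I -> homogeneous I ->
    finitely_generated_right_ideal I -> finitely_presented_right_ideal I.

(** Tor^A(k, k) is the homology of k (x)_A B, where B is the normalized bar
    resolution of k.  Its degree-j part in homological degree i is the degree-j
    part of the i-fold tensor power of A_+, with differential
      [a_1 | ... | a_i] |-> sum_p (-1)^p [a_1 | ... | a_p a_(p+1) | ... | a_i].
    A tensor power is encoded as the quotient of the free vector space on the
    words [a_1 | ... | a_i] of homogeneous elements of positive degree
    (bar_chain) by the relations of multilinearity (tensor_rel). *)
Notation bar_space := (malg (seq A) k).

Definition word (w : seq A) : bar_space := mkmalgU w 1.

(* The letters of w lie in A_+ and have the degrees listed in e. *)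
Fixpoint bar_word (e : seq nat) (w : seq A) : Prop :=
  match e, w with
  | [::], [::] => True
  | d :: e', a :: w' => [/\ (0 < d)%N, G d a & bar_word e' w']
  | _, _ => False
  end.

Definition bar_chain (i j : nat) : set bar_space :=
  lspan [set x | exists (e : seq nat) (w : seq A),
    [/\ size e = i, sumn e = j, bar_word e w & x = word w]].

Definition tensor_rel (i j : nat) : set bar_space :=
  lspan [set x | exists (e : seq nat) (u v : seq A) (a b : A) (c : k),
    [/\ size e = i /\ sumn e = j,
        bar_word e (u ++ a :: v), bar_word e (u ++ b :: v)
      & x = word (u ++ (c *: a + b) :: v)
            - c *: word (u ++ a :: v) - word (u ++ b :: v)]].

Definition bar_diff_word (w : seq A) : bar_space :=
  \sum_(p < (size w).-1)
     (-1) ^+ p *: word (take p w ++ (w`_p * w`_p.+1) :: drop p.+2 w).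

Definition bar_diff (x : bar_space) : bar_space :=
  \sum_(w <- msupp x) mcoeff w x *: bar_diff_word w.

(* For i = 0 the differential vanishes, so that the value of i.-1 is
   irrelevant. *)
Definition bar_cycles (i j : nat) : set bar_space :=
  [set x | bar_chain i j x /\ tensor_rel i.-1 j (bar_diff x)].

Definition bar_boundaries (i j : nat) : set bar_space :=
  [set x | exists y z : bar_space,
     [/\ bar_chain i.+1 j y, tensor_rel i j z & x = bar_diff y + z]].

(* Tor_i^A(k, k)_j <> 0 *)
Definition Tor_neq0 (i j : nat) : Prop :=
  ~ (bar_cycles i j `<=` bar_boundaries i j).

(* As all degrees are nonnegative, adjoining 0 to the set only matters when
   Tor_i^A(k, k) = 0, in which case it gives the convention m_i(A) = 0. *)
Definition Tor_maxdeg (R : realType) (i : nat) : \bar R :=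
  ereal_sup (0%:E |` [set (j%:R : R)%:E | j in [set j | Tor_neq0 i j]]).

Definition Koszul (R : realType) : Prop :=
  forall i : nat, (Tor_maxdeg R i <= (i%:R : R)%:E)%E.

Definition finite_rate (R : realType) : Prop :=
  exists r : R, forall i j : nat, Tor_neq0 i j -> j%:R <= r * i%:R.

End Graded.

Definition eventually_periodic (h : nat -> nat) : Prop :=
  exists d N : nat, [/\ (0 < d)%N, (0 < N)%N
    & forall n, (N <= n)%N -> h n = h (n + d)%N].

(* Main.v *)
(* By the GK-dimension hypothesis the number of normal words of some length
   n >= 1 is at most n, so (Bergman) all normal words have the form u p^e v with
   u, p, v in a finite set, and the Hilbert function is bounded.

   If A is semiprime, there is a homogeneous left regular element z of positive
   degree d, so dim A_n <= dim A_(n+d), and a bounded function with this property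
   is periodic.  If A is Noetherian for two-sided ideals, the same applied modulo
   the largest homogeneous nilpotent ideal shows that A is spanned by finitely
   many families z^a w_j z^b; ordering these and comparing leading terms in the
   degrees n and n + d gives dim A_(n+d) <= dim A_n for large n.

   In the other cases Ext^2_A(k, k), and Ext^3_A(k, k) unless k is finite, vanish
   in large degrees.  It follows that the modules M_n = A_n + A_(n+1) + ...,
   suitably shifted, have presentations determined by the multiplication A_(n+i) x
   A_j -> A_(n+i+j) in a window i + j <= D, with D independent of n.  There are
   finitely many possible dimensions of the graded pieces in a window, so the
   windows are points of finitely many affine spaces of structure constants.  Over
   a finite field two windows coincide, so dim A_(n+m) = dim A_(n'+m) for all m.
   In general take an infinite set of windows that is irreducible in the Zariski
   topology.  In each degree m, by exactness of P_2 -> P_1 -> P_0 -> M_n -> 0 the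
   ranks of the two differentials add up to dim P_1, which is constant along
   the family; as both ranks are lower semicontinuous, they are constant, and so
   is dim A_(n+m). *)
From HB Require Import structures.
From mathcomp Require Import all_boot all_order all_algebra.
From mathcomp Require Import finmap.
From mathcomp Require Import all_classical all_reals.
From mathcomp Require Import ereal normedtype sequences exp.
From mathcomp Require Import -(notations) monalg.
From mathcomp Require Import zify ring.
Require Import Defs.

Set Implicit Arguments.
Unset Strict Implicit.
Unset Printing Implicit Defensive.

Import Order.TTheory GRing.Theory Num.Theory.

Local Open Scope classical_set_scope.
Local Open Scope ring_scope.

(** * Subspaces and dimensions *)

Section Spans.
Context {k : fieldType} {M : lmodType k}.
Implicit Types (V W U : set M) (x y : M).

(** A semiprime algebra comes with no chain condition on annihilators. A count replaces it: by
    finite generation every element of degree at least n factors through D consecutive degrees, so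
    right annihilators of homogeneous elements can be compared by their total dimension in a window
    of D degrees. This number is bounded, and it jumps in all late windows at once when an
    annihilator grows. The argument runs modulo an ideal N, so that the Noetherian case can reuse
    it. The Ext groups are encoded by multilinear cochains, a form reached alike from Tor, from
    syzygies and from relations. The sequences 0 -> M_(n+1) -> M_n -> A_n -> 0 carry the vanishing
    from A_+ to every M_n, in degrees counted from n; this makes D independent of n. The
    presentations use whole tensor products of graded pieces instead of minimal generators, so their
    format depends only on the dimensions in the window and on those of A. Exactness is proved
    dually, by extending cochains from the window one degree at a time. Zariski topology enters only
    through evaluations of a polynomial ring along the sequence of windows. *)

Lemma subspace0 V : subspace V -> V 0. Proof. by move=> []. Qed.

Lemma subspaceD V x y : subspace V -> V x -> V y -> V (x + y).
Proof. by move=> [_ h] Vx Vy; rewrite -[x]scale1r; apply: h. Qed.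

Lemma subspaceZ V (c : k) x : subspace V -> V x -> V (c *: x).
Proof. by move=> [V0 h] Vx; rewrite -[_ *: _]addr0; apply: h. Qed.

Lemma subspaceN V x : subspace V -> V x -> V (- x).
Proof. by move=> sV Vx; rewrite -scaleN1r; apply: subspaceZ. Qed.

Lemma subspaceB V x y : subspace V -> V x -> V y -> V (x - y).
Proof. by move=> sV Vx Vy; apply: subspaceD => //; apply: subspaceN. Qed.

Lemma subspace_sum V (I : Type) (r : seq I) (P : pred I) (F : I -> M) :
  subspace V -> (forall i, P i -> V (F i)) -> V (\sum_(i <- r | P i) F i).
Proof.
move=> sV h; elim/big_ind: _ => //; first exact: subspace0.
by move=> x y; apply: subspaceD.
Qed.

Lemma subspace_set0 : subspace [set (0 : M)].
Proof. by split=> // c x y -> ->; rewrite scaler0 addr0. Qed.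

Lemma lspan_sub (S : set M) V : subspace V -> S `<=` V -> lspan S `<=` V.
Proof.
move=> sV SV x [n [c [e [he ->]]]]; apply: subspace_sum => // i _.
by apply: subspaceZ => //; apply/SV/he.
Qed.

Lemma sub_lspan (S : set M) : S `<=` lspan S.
Proof.
move=> x Sx; exists 1%N, (fun=> 1), (fun=> x); split=> //.
by rewrite big_ord1 scale1r.
Qed.

Lemma subspace_lspan (S : set M) : subspace (lspan S).
Proof.
split.
  by exists 0%N, (fun=> 0), (fun=> 0); split=> [[]//|]; rewrite big_ord0.
move=> a x y [n [c [e [he ->]]]] [m [d [f [hf ->]]]].
exists (n + m)%N, (fun i => match fintype.split i with inl j => a * c j | inr j => d j end),
  (fun i => match fintype.split i with inl j => e j | inr j => f j end); split.
  by move=> i; case: (fintype.split i).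
rewrite big_split_ord /= scaler_sumr; congr (_ + _); apply: eq_bigr => i _.
  by rewrite (unsplitK (inl i)) scalerA.
by rewrite (unsplitK (inr i)).
Qed.

Lemma lspanS (S T : set M) : S `<=` T -> lspan S `<=` lspan T.
Proof.
move=> ST; apply: lspan_sub; first exact: subspace_lspan.
by move=> x /ST; apply: sub_lspan.
Qed.

Lemma lspan_comb (S : set M) n (c : 'I_n -> k) (e : 'I_n -> M) :
  (forall i, S (e i)) -> lspan S (\sum_(i < n) c i *: e i).
Proof. by move=> he; exists n, c, e. Qed.

Lemma lspan0 : lspan (set0 : set M) = [set 0].
Proof.
apply/seteqP; split=> [x|x ->]; last exact: (subspace0 (subspace_lspan _)).
exact: (lspan_sub subspace_set0 (@sub0set _ _)).
Qed.

(** Independence and spanning modulo a subspace: [U = [set 0]] gives ordinary bases, and an ideal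
    [U = N] gives dimensions of [A / N] without forming a quotient space. *)
Definition freemod U n (e : 'I_n -> M) : Prop :=
  forall c : 'I_n -> k, U (\sum_(i < n) c i *: e i) -> forall i, c i = 0.

Definition spanmod U n (e : 'I_n -> M) x : Prop :=
  exists c : 'I_n -> k, U (x - \sum_(i < n) c i *: e i).

Lemma freemod_le U n m (e : 'I_n -> M) (f : 'I_m -> M) : subspace U ->
  freemod U e -> (forall i, spanmod U f (e i)) -> (n <= m)%N.
Proof.
move=> sU fe /boolp.choice[c hc].
pose C : 'M[k]_(n, m) := \matrix_(i, j) c i j.
rewrite leqNgt; apply/negP => ltmn.
have : kermx C != 0.
  by rewrite kermx_eq0 -row_leq_rank -ltnNge (leq_ltn_trans (rank_leq_col C)).
move=> /rowV0Pn[v /sub_kermxP vC /eqP[]]; apply/rowP => i; rewrite mxE.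
apply: (fe (fun i => v 0 i)).
have -> : \sum_(i < n) v 0 i *: e i =
    \sum_(i < n) v 0 i *: (e i - \sum_(j < m) c i j *: f j).
  under [RHS]eq_bigr do rewrite scalerBr.
  rewrite sumrB [X in _ - X](_ : _ = 0) ?subr0 //.
  under eq_bigr do rewrite scaler_sumr.
  rewrite exchange_big /= big1 // => j _.
  under eq_bigr do rewrite scalerA.
  rewrite -scaler_suml; have /rowP/(_ j) := vC; rewrite !mxE => h.
  by under eq_bigr do rewrite -[c _ _](mxE matrix_key (fun i j => c i j)); rewrite h scale0r.
by apply: subspace_sum => // i0 _; apply: subspaceZ.
Qed.

Definition snoc n (e : 'I_n -> M) x : 'I_n.+1 -> M :=
  fun i => if unlift ord_max i is Some j then e j else x.

Lemma sum_snoc n (e : 'I_n -> M) x (c : 'I_n.+1 -> k) :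
  \sum_(i < n.+1) c i *: snoc e x i =
  \sum_(i < n) c (lift ord_max i) *: e i + c ord_max *: x.
Proof.
rewrite big_ord_recr /= /snoc unlift_none; congr (_ + _); apply: eq_bigr => i _.
have -> : widen_ord (leqnSn n) i = lift ord_max i.
  by apply: val_inj => /=; rewrite /bump leqNgt ltn_ord.
by rewrite liftK.
Qed.

Lemma snoc_free U n (e : 'I_n -> M) x : subspace U ->
  freemod U e -> ~ spanmod U e x -> freemod U (snoc e x).
Proof.
move=> sU fe nx c; rewrite sum_snoc => Uc.
have c0 : c ord_max = 0.
  apply: contrapT => /eqP c0; apply: nx.
  exists (fun i => - (c ord_max)^-1 * c (lift ord_max i)).
  have := subspaceZ (c ord_max)^-1 sU Uc.
  rewrite scalerDr scalerA mulVf // scale1r addrC; congr (U (_ + _)).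
  rewrite -sumrN scaler_sumr; apply: eq_bigr => i _.
  by rewrite mulNr scaleNr opprK scalerA.
move: Uc; rewrite c0 scale0r addr0 => /fe h i.
by case: (unliftP ord_max i) => [j ->|->].
Qed.

Lemma freemodS U U' n (e : 'I_n -> M) : U `<=` U' -> freemod U' e -> freemod U e.
Proof. by move=> UU fe c /UU /fe. Qed.

Lemma max_freemod U V B : subspace U ->
  (forall n (e : 'I_n -> M), (forall i, V (e i)) -> freemod U e -> (n <= B)%N) ->
  exists n (e : 'I_n -> M), [/\ forall i, V (e i), freemod U e &
    forall x, V x -> spanmod U e x].
Proof.
move=> sU hB; apply: contrapT => H.
suff h n : exists e : 'I_n -> M, (forall i, V (e i)) /\ freemod U e.
  by have [e [Ve fe]] := h B.+1; have := hB _ _ Ve fe; rewrite ltnn.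
elim: n => [|n [e [Ve fe]]].
  by exists (fun=> 0); split=> [[]//|c _ []//].
have : ~ forall x, V x -> spanmod U e x by move=> h; apply: H; exists n, e.
move=> /existsNP[x /not_implyP[Vx nx]]; exists (snoc e x); split.
  by move=> i; rewrite /snoc; case: (unlift _ _).
exact: snoc_free.
Qed.

Lemma spanmod0 n (e : 'I_n -> M) x :
  spanmod [set 0] e x <-> exists c : 'I_n -> k, x = \sum_(i < n) c i *: e i.
Proof.
split=> -[c]; first by move=> /= /eqP; rewrite subr_eq0 => /eqP; exists c.
by move=> ->; exists c => /=; rewrite subrr.
Qed.

Lemma subspace_spanmod U n (e : 'I_n -> M) : subspace U -> subspace (spanmod U e).
Proof.
move=> sU; split.
  exists (fun=> 0); rewrite sub0r; apply: subspaceN => //.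
  by apply: subspace_sum => // i _; rewrite scale0r; apply: subspace0.
move=> a y z [cy hy] [cz hz]; exists (fun i => a * cy i + cz i).
have -> : a *: y + z - \sum_(i < n) (a * cy i + cz i) *: e i =
    a *: (y - \sum_(i < n) cy i *: e i) + (z - \sum_(i < n) cz i *: e i).
  under eq_bigr do rewrite scalerDl -scalerA.
  by rewrite big_split /= -scaler_sumr scalerBr opprD addrACA.
by case: sU => _; apply.
Qed.

Lemma spanmod_fam U n (e : 'I_n -> M) i : subspace U -> spanmod U e (e i).
Proof.
move=> sU; exists (fun j => (j == i)%:R).
rewrite (bigD1 i) //= eqxx scale1r big1 ?addr0 ?subrr; first exact: subspace0.
by move=> j /negPf->; rewrite scale0r.
Qed.

Lemma lspan_spanmod U n (e : 'I_n -> M) (S : set M) : subspace U ->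
  (forall x, S x -> spanmod U e x) -> lspan S `<=` spanmod U e.
Proof. by move=> sU h; apply: lspan_sub => //; apply: subspace_spanmod. Qed.

Lemma has_dimP V n : has_dim V n <-> exists e : 'I_n -> M,
  [/\ forall i, V (e i), freemod [set 0] e & forall x, V x -> spanmod [set 0] e x].
Proof.
split=> -[e].
  move=> [h1 h2 h3]; exists e; split=> //.
  by move=> x /h2 hx; apply/spanmod0.
by move=> [h1 h2 h3]; exists e; split=> // x /h3 /spanmod0.
Qed.

Lemma has_dim_free V n m (e : 'I_m -> M) : has_dim V n ->
  (forall i, V (e i)) -> freemod [set 0] e -> (m <= n)%N.
Proof.
move=> /has_dimP[f [Vf ff sf]] Ve fe; apply: (freemod_le subspace_set0 fe).
by move=> i; apply: sf.
Qed.

Lemma has_dim_uniq V n m : has_dim V n -> has_dim V m -> n = m.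
Proof.
move=> Vn Vm; apply/eqP; rewrite eqn_leq.
have /has_dimP[e [Ve fe _]] := Vn; have /has_dimP[f [Vf ff _]] := Vm.
by rewrite (has_dim_free Vm Ve fe) (has_dim_free Vn Vf ff).
Qed.

Lemma dimkE V n : has_dim V n -> dimk V = n.
Proof. by move=> h; apply: xget_unique => // m hm; apply: has_dim_uniq hm h. Qed.

Lemma has_dim_le V W n m : V `<=` W -> has_dim V n -> has_dim W m -> (n <= m)%N.
Proof.
move=> VW /has_dimP[e [Ve fe _]] hW; apply: (has_dim_free hW _ fe).
by move=> i; apply: VW.
Qed.

Lemma has_dim_lt V W n m : subspace V -> V `<=` W -> has_dim V n -> has_dim W m ->
  ~ W `<=` V -> (n < m)%N.
Proof.
move=> sV VW /has_dimP[e [Ve fe se]] hW /existsNP[x /not_implyP[Wx nVx]].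
apply: (has_dim_free hW (e := snoc e x)).
  by move=> i; rewrite /snoc; case: (unlift _ _) => // j; apply: VW.
apply: snoc_free => //; first exact: subspace_set0.
move=> /spanmod0[c xE]; apply: nVx; rewrite xE.
by apply: subspace_sum => // i _; apply: subspaceZ.
Qed.

Lemma ex_has_dim V B : (forall n (e : 'I_n -> M), (forall i, V (e i)) ->
  freemod [set 0] e -> (n <= B)%N) -> has_dim V (dimk V) /\ (dimk V <= B)%N.
Proof.
move=> hB; have [n [e [Ve fe se]]] := max_freemod subspace_set0 hB.
have h : has_dim V n by apply/has_dimP; exists e.
by rewrite (dimkE h); split=> //; apply: hB fe.
Qed.

Lemma ex_has_dim_sub V W m : V `<=` W -> has_dim W m ->
  has_dim V (dimk V) /\ (dimk V <= m)%N.
Proof.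
move=> VW hW; apply: ex_has_dim => n e Ve fe.
by apply: (has_dim_free hW _ fe) => i; apply: VW.
Qed.

Lemma ex_has_dim_span V m (f : 'I_m -> M) :
  (forall x, V x -> exists c : 'I_m -> k, x = \sum_(i < m) c i *: f i) ->
  has_dim V (dimk V) /\ (dimk V <= m)%N.
Proof.
move=> h; apply: ex_has_dim => n e Ve fe.
by apply: (freemod_le subspace_set0 fe) => i; apply/spanmod0/h.
Qed.

Lemma lspan_seq (s : seq M) :
  lspan [set` s] `<=` spanmod [set 0] (fun i : 'I_(size s) => s`_i).
Proof.
apply: lspan_spanmod; first exact: subspace_set0.
move=> x /= xs; have lt := xs; rewrite -index_mem in lt.
have := spanmod_fam (fun i : 'I_(size s) => s`_i) (Ordinal lt) subspace_set0.
by rewrite /= nth_index.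
Qed.

Lemma has_dim_lspan (S : set M) (s : seq M) : S `<=` [set` s] ->
  has_dim (lspan S) (dimk (lspan S)).
Proof.
move=> Ss; apply: (ex_has_dim_span (m := size s) (f := fun i => s`_i) _).1.
by move=> x /(lspanS Ss)/lspan_seq/spanmod0.
Qed.

(** The vectors outside the span of their predecessors form a basis, as in Gaussian elimination.
    Normal words and the leading terms of the families z^a w_j z^b are both counted this way. *)
Lemma pivot_dim (I : eqType) (r : rel I) (phi : I -> M) (s : seq I) :
  irreflexive r -> transitive r -> sorted r s ->
  has_dim (lspan [set phi w | w in [set` s]])
    (count (fun w => `[< ~ lspan [set phi w' | w' in [set w' | w' \in s /\ r w' w]] (phi w) >]) s).
Proof.
move=> ri rt; elim/last_ind: s => [|s x IH] srt.
  rewrite /=; apply/has_dimP; exists (fun=> 0); split=> [[]//|c _ []//|y].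
  rewrite (_ : [set phi w | w in _] = set0) ?lspan0; last first.
    by apply/seteqP; split=> // y' [].
  by move=> ->; exists (fun=> 0); rewrite big_ord0 subrr.
have ss : sorted r s by apply: subseq_sorted srt => //; apply: subseq_rcons.
have rx w : w \in s -> r w x.
  move=> ws; move: srt; rewrite sorted_pairwise // -cats1 pairwise_cat /=.
  by rewrite andbT allrel1r => /andP[/allP/(_ _ ws)].
have nxw w : w \in s -> ~~ r x w.
  move=> ws; apply/negP => rxw; have := rt _ _ _ (rx _ ws) rxw.
  by rewrite ri.
rewrite -cats1 count_cat /= addn0.
have -> : count (fun w => `[< ~ lspan [set phi w' | w' in
     [set w' | w' \in s ++ [:: x] /\ r w' w]] (phi w) >]) s =
  count (fun w => `[< ~ lspan [set phi w' | w' in [set w' | w' \in s /\ r w' w]] (phi w) >]) s.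
  apply: eq_in_count => w ws; congr (`[< ~ lspan [set _ | _ in _] _ >]).
  apply/seteqP; split=> w' /= [w's rw]; split=> //.
    move: w's; rewrite mem_cat inE => /orP[//|/eqP w'x].
    by move: rw; rewrite w'x (negPf (nxw _ ws)).
  by rewrite mem_cat w's.
have -> : [set phi w' | w' in [set w' | w' \in s ++ [:: x] /\ r w' x]] =
   [set phi w' | w' in [set` s]].
  congr ([set _ | _ in _]); apply/seteqP; split=> w' /=.
    rewrite mem_cat inE => -[/orP[//|/eqP->]]; by rewrite ri.
  by move=> w's; rewrite mem_cat w's; split=> //; apply: rx.
have {IH} := IH ss; set c := count _ _; clearbody c => Hs.
have sub : lspan [set phi w | w in [set` s]] `<=`
    lspan [set phi w | w in [set` s ++ [:: x]]].
  by apply: lspanS => _ [w ws <-]; exists w => //=; rewrite mem_cat ws.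
have sW := subspace_lspan [set phi w | w in [set` s]].
case: asboolP => nx /=; last first.
  rewrite addn0.
  suff -> : lspan [set phi w | w in [set` s ++ [:: x]]] =
      lspan [set phi w | w in [set` s]] by [].
  apply/seteqP; split=> //; apply: lspan_sub => // _ [w /= ws <-].
  move: ws; rewrite mem_cat inE => /orP[ws|/eqP->]; last exact: contrapT.
  by apply: sub_lspan; exists w.
rewrite addn1; have /has_dimP[e [Ve fe se]] := Hs.
apply/has_dimP; exists (snoc e (phi x)); split.
- move=> i; rewrite /snoc; case: (unlift _ _) => [j|]; first exact: sub.
  by apply: sub_lspan; exists x => //=; rewrite mem_cat mem_head orbT.
- apply: snoc_free => //; first exact: subspace_set0.
  move=> /spanmod0[d xE]; apply: nx; rewrite xE.
  by apply: subspace_sum => // i _; apply: subspaceZ.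
- apply: lspan_spanmod; first exact: subspace_set0.
  move=> _ [w /= ws <-]; apply/spanmod0.
  move: ws; rewrite mem_cat inE => /orP[ws|/eqP->].
    have /se/spanmod0[d ->] : lspan [set phi w | w in [set` s]] (phi w).
      by apply: sub_lspan; exists w.
    exists (fun i => if unlift ord_max i is Some j then d j else 0).
    rewrite sum_snoc unlift_none scale0r addr0; apply: eq_bigr => i _.
    by rewrite liftK.
  exists (fun i => if unlift ord_max i is Some j then 0 else 1).
  rewrite sum_snoc unlift_none scale1r big1 ?add0r // => i _.
  by rewrite liftK scale0r.
Qed.

End Spans.

(** * Extension of linear functionals *)

Section Extension.
Context {k : fieldType} {M : lmodType k}.

(* A maximal subspace of M * k that contains the given relation and avoids
   (0, 1) is the graph of a functional. *)
Lemma lin_ext (U : set (M * k^o)) : subspace U -> (forall c, U (0, c) -> c = 0) ->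
  exists f : {linear M -> k^o}, forall m c, U (m, c) -> f m = c.
Proof.
move=> sU U0.
(* The union with [U] makes the empty chain admissible in Zorn's lemma. *)
pose P (X : set (M * k^o)) := subspace (U `|` X) /\ forall c, (U `|` X) (0, c) -> c = 0.
have [F FP totF|X [[sX X0] maxX]] := @Zorn_bigcup _ P.
  have dir x y : (U `|` \bigcup_(X in F) X) x -> (U `|` \bigcup_(X in F) X) y ->
      exists X, [/\ P X, (U `|` X) `<=` (U `|` \bigcup_(X in F) X),
        (U `|` X) x & (U `|` X) y].
    have sub X : F X -> (U `|` X) `<=` (U `|` \bigcup_(X in F) X).
      by move=> FX z [?|?]; [left|right; exists X].
    move=> [Ux|[X FX Xx]] [Uy|[Y FY Yy]].
    - exists set0; split; try (by left); first by rewrite /P setU0.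
      by rewrite setU0; left.
    - by exists Y; split; [exact: FP|exact: sub|left|right].
    - by exists X; split; [exact: FP|exact: sub|right|left].
    - have [XY|YX] := totF _ _ FX FY.
        by exists Y; split; [exact: FP|exact: sub|right; apply: XY|right].
      by exists X; split; [exact: FP|exact: sub|right|right; apply: YX].
  split; first split.
  - by left; case: sU.
  - move=> c x y /dir h /h [X [[sX _] sub Xx Xy]].
    by apply: sub; case: sX => _; apply.
  - by move=> c h; have [X [[_ X0] _ Xx _]] := dir _ _ h h; apply: X0.
pose G := U `|` X.
have tot m : exists c : k^o, G (m, c).
  apply: contrapT => /forallNP nm.
  (* If no pair [(m, c)] lies in [G], adjoining [(m, 0)] gives a larger admissible subspace. *)
  pose Y := [set z | exists (a : k) (g : M * k^o), G g /\ z = a *: (m, 0) + g].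
  have XY : X `<=` Y.
    by move=> x Xx; exists 0, x; split; [right|rewrite scale0r add0r].
  have UY : U `<=` Y.
    by move=> x Ux; exists 0, x; split; [left|rewrite scale0r add0r].
  apply: (maxX Y).
    split=> // YX; apply: (nm 0); right; apply: YX.
    by exists 1, 0; split; [exact: (subspace0 sX)|rewrite scale1r addr0].
  rewrite /P; have -> : U `|` Y = Y by apply/seteqP; split=> [z [/UY|]|z ?] //; right.
  split; first split.
  - by exists 0, 0; split; [exact: (subspace0 sX)|rewrite scale0r addr0].
  - move=> c x y [a [g [Gg ->]]] [b [h [Gh ->]]].
    exists (c * a + b), (c *: g + h); split; first by case: sX => _; apply.
    by rewrite scalerDr scalerDl scalerA addrACA.
  - move=> c [a [[g1 g2] [Gg]]].
    have [->|a0] := eqVneq a 0.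
      by rewrite scale0r add0r => -[h1 h2]; apply: X0; rewrite h1 h2.
    case=> h1 _; exfalso; apply: (nm (- a^-1 *: g2)).
    have := subspaceZ (- a^-1) sX Gg; congr (G (_ , _)) => /=.
    have -> : g1 = - (a *: m) by apply/eqP; rewrite -addr_eq0 addrC -h1.
    by rewrite scaleNr scalerN opprK scalerA mulVf // scale1r.
have uniq m c d : G (m, c) -> G (m, d) -> c = d.
  move=> Gc Gd; apply/eqP; rewrite -subr_eq0; apply/eqP/X0.
  by have := subspaceB sX Gc Gd; congr (G (_, _)) => /=; rewrite subrr.
have [f hf] := boolp.choice tot.
have lf : linear f.
  move=> a x y; apply: (uniq (a *: x + y)); first exact: hf.
  have := subspaceD sX (subspaceZ a sX (hf x)) (hf y); exact.
pose L := GRing.isLinear.Build _ _ _ _ f lf.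
pose fL : {linear M -> k^o} := HB.pack f L.
exists fL => m c Uc; apply: (uniq m); first exact: hf.
by left.
Qed.

End Extension.

(** * Linear maps given on a basis *)

Section LinearExtension.
Context {k : fieldType} {K : choiceType} {M : lmodType k}.
Variable h : K -> M.

Definition linext (x : malg K k) : M := \sum_(w <- msupp x) mcoeff w x *: h w.

Lemma linextEw (d : {fset K}) (x : malg K k) : (msupp x `<=` d)%fset ->
  linext x = \sum_(w <- d) mcoeff w x *: h w.
Proof.
move=> le; rewrite /linext (big_fset_incl _ le) //= => w _ /mcoeff_outdom ->.
by rewrite scale0r.
Qed.

Lemma linextU w : linext (mkmalgU w 1) = h w.
Proof.
rewrite (@linextEw [fset w]%fset) ?msuppU_le // big_seq_fset1.
by rewrite mcoeffUU scale1r.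
Qed.

Lemma linext_is_linear : linear linext.
Proof.
move=> a x y; pose d := (msupp x `|` msupp y)%fset.
have hx : (msupp x `<=` d)%fset by apply: fsubsetUl.
have hy : (msupp y `<=` d)%fset by apply: fsubsetUr.
have hxy : (msupp (a *: x + y) `<=` d)%fset.
  apply: fsubset_trans (msuppD_le _ _) _; rewrite fsubUset hy andbT.
  exact: fsubset_trans (msuppZ_le _ _) _.
rewrite (linextEw hx) (linextEw hy) (linextEw hxy) scaler_sumr -big_split /=.
apply: eq_bigr => w _; rewrite mcoeffD mcoeffZ scalerDl scalerA //.
Qed.

HB.instance Definition _ := GRing.isLinear.Build k (malg K k) M _ linext
  linext_is_linear.

End LinearExtension.

(** * Homogeneous components *)

Lemma lspan_mul {k : fieldType} {A : algType k} (S T V : set A) x y : subspace V ->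
  (forall a b, S a -> T b -> V (a * b)) -> lspan S x -> lspan T y -> V (x * y).
Proof.
move=> sV h Sx Ty.
have sub1 b : subspace [set a | V (a * b)].
  split=> /= [|c u v Vu Vv]; first by rewrite mul0r; apply: subspace0.
  by rewrite mulrDl -scalerAl; case: sV => _; apply.
have sub2 a : subspace [set b | V (a * b)].
  split=> /= [|c u v Vu Vv]; first by rewrite mulr0; apply: subspace0.
  by rewrite mulrDr -scalerAr; case: sV => _; apply.
apply: (lspan_sub (sub1 y) _ Sx) => a Sa /=.
by apply: (lspan_sub (sub2 a) _ Ty) => b Tb; apply: h.
Qed.

Section Grading.
Context {k : fieldType} {A : algType k} {G : nat -> set A}.
Hypothesis hG : connected_graded G.

Lemma gr_sub s : subspace (G s). Proof. exact: (graded_subspace hG). Qed.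
Lemma gr0 s : G s 0. Proof. exact: (subspace0 (gr_sub s)). Qed.
Lemma grD s a b : G s a -> G s b -> G s (a + b).
Proof. exact: (subspaceD (gr_sub s)). Qed.
Lemma grB s a b : G s a -> G s b -> G s (a - b).
Proof. exact: (subspaceB (gr_sub s)). Qed.
Lemma grZ s (c : k) a : G s a -> G s (c *: a).
Proof. exact: (subspaceZ c (gr_sub s)). Qed.
Lemma gr1 : G 0%N 1.
Proof. by rewrite (graded_connected hG); exists 1 => //; rewrite scale1r. Qed.
Lemma grM s t u a b : G s a -> G t b -> (s + t)%N = u -> G u (a * b).
Proof. by move=> ha hb <-; apply: (graded_mul hG). Qed.

Lemma grX s a n : G s a -> G (s * n)%N (a ^+ n).
Proof.
move=> ha; elim: n => [|n IH]; first by rewrite muln0 expr0; apply: gr1.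
by rewrite exprS; apply: grM ha IH _; rewrite mulnS.
Qed.

Lemma gr_prod (I : Type) (y : I -> A) (d : I -> nat) (w : seq I) :
  (forall i, G (d i) (y i)) -> G (sumn (map d w)) (\prod_(i <- w) y i).
Proof.
move=> hy; elim: w => [|i w IH]; first by rewrite big_nil; apply: gr1.
by rewrite big_cons; apply: grM (hy i) IH _.
Qed.

(** Decompositions of one element may have different lengths; padding with 0 makes them comparable
    degree by degree. *)
Let cutoff (n : nat) (f : nat -> A) s := if (s < n)%N then f s else 0.

Lemma sum_cutoff n m (f : nat -> A) : (n <= m)%N ->
  \sum_(i < m) cutoff n f i = \sum_(i < n) f i.
Proof.
move=> nm; rewrite -(subnKC nm) big_split_ord /=.
rewrite [X in _ + X]big1 ?addr0; last by move=> i _; rewrite /cutoff ltnNge leq_addr.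
by apply: eq_bigr => i _; rewrite /cutoff ltn_ord.
Qed.

Lemma gr_uniq n m (f g : nat -> A) : (forall s, G s (f s)) -> (forall s, G s (g s)) ->
  \sum_(i < n) f i = \sum_(i < m) g i -> cutoff n f =1 cutoff m g.
Proof.
move=> hf hg e s.
have gc p h : (forall s, G s (h s)) -> forall s, G s (cutoff p h s).
  by move=> hh t; rewrite /cutoff; case: ifP => _; [apply: hh|apply: gr0].
pose p := (maxn (maxn n m) s.+1).
have := graded_indep hG (n := p) (f := fun s => cutoff n f s - cutoff m g s) _ _ (i := s) _.
move=> h; apply/eqP; rewrite -subr_eq0; apply/eqP; apply: h.
- by move=> t; apply: grB; apply: gc.
- by rewrite sumrB !sum_cutoff ?e ?subrr // /p; lia.
- by rewrite /p; lia.
Qed.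

Lemma ex_proj : exists pi : nat -> {linear A -> A}, [/\ forall s a, G s (pi s a),
  forall s a, G s a -> pi s a = a, forall s t a, s <> t -> G t a -> pi s a = 0 &
  forall a, exists n, forall m, (n <= m)%N -> a = \sum_(i < m) pi i a].
Proof.
have /boolp.choice[nf hnf] : forall a, exists nf : nat * (nat -> A),
    (forall i, G i (nf.2 i)) /\ a = \sum_(i < nf.1) nf.2 i.
  by move=> a; have [n [f h]] := graded_decomp hG a; exists (n, f).
pose pr s a := cutoff (nf a).1 (nf a).2 s.
have prG s a : G s (pr s a).
  by rewrite /pr /cutoff; case: ifP => _; [apply: (hnf a).1|apply: gr0].
have prE a m (f : nat -> A) : (forall s, G s (f s)) -> a = \sum_(i < m) f i ->
    forall s, pr s a = cutoff m f s.
  move=> hf e; apply: gr_uniq => //; first exact: (hnf a).1.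
  by rewrite -(hnf a).2.
have prsum a m : ((nf a).1 <= m)%N -> a = \sum_(i < m) pr i a.
  by move=> h; rewrite sum_cutoff // -(hnf a).2.
have lpr s : linear (pr s).
  move=> c a b; pose m := maxn s.+1 (maxn (nf a).1 (nf b).1).
  rewrite (prE _ m (fun s => c *: pr s a + pr s b)).
  - by rewrite /cutoff ifT // /m; lia.
  - by move=> t; apply: grD => //; apply: grZ.
  - rewrite big_split /= -scaler_sumr -!prsum // /m; lia.
pose pi s : {linear A -> A} := HB.pack (pr s) (GRing.isLinear.Build _ _ _ _ (pr s) (lpr s)).
have one t a : G t a -> forall s, pr s a = if s == t then a else 0.
  move=> ha s; rewrite (prE _ t.+1 (fun s => if s == t then a else 0)).
  - by rewrite /cutoff; case: eqP => [->|//]; rewrite ?ltnSn //; case: ifP.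
  - by move=> u; case: eqP => [->|_] //; apply: gr0.
  - rewrite big_ord_recr /= eqxx big1 ?add0r // => i _.
    by rewrite ifF //; apply/negP => /eqP e; have := ltn_ord i; rewrite e ltnn.
exists pi; split=> [s a|s a ha|s t a st ha|a] /=.
- exact: prG.
- by rewrite (one _ _ ha) eqxx.
- by rewrite (one _ _ ha); case: eqP.
- by exists (nf a).1; apply: prsum.
Qed.

Definition gproj : nat -> {linear A -> A} := sval (boolp.cid ex_proj).

Lemma gprojG s a : G s (gproj s a).
Proof. by rewrite /gproj; case: boolp.cid => /= ? []. Qed.
Lemma gproj_id s a : G s a -> gproj s a = a.
Proof. by rewrite /gproj; case: boolp.cid => /= ? [_ h _ _]; apply: h. Qed.
Lemma gproj0 s t a : s <> t -> G t a -> gproj s a = 0.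
Proof. by rewrite /gproj; case: boolp.cid => /= ? [_ _ h _]; apply: h. Qed.
Lemma gproj_sum a : exists n, forall m, (n <= m)%N -> a = \sum_(i < m) gproj i a.
Proof. by rewrite /gproj; case: boolp.cid => /= ? []. Qed.

Lemma gproj_bound (I : finType) (x : I -> A) :
  exists n, forall i m, (n <= m)%N -> x i = \sum_(j < m) gproj j (x i).
Proof.
have [n hn] := boolp.choice (fun i => gproj_sum (x i)).
exists (\max_i n i)%N => i m h; apply: hn; apply: leq_trans h.
exact: leq_bigmax.
Qed.

Lemma gr_ind (V : set A) : subspace V -> (forall s a, G s a -> V a) -> forall a, V a.
Proof.
move=> sV h a; have [n /(_ n (leqnn n)) ->] := gproj_sum a.
by apply: subspace_sum => // i _; apply/h/gprojG.
Qed.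

Lemma gproj_mulr s t x y : G t y -> gproj (s + t) (x * y) = gproj s x * y.
Proof.
move=> yt; apply: (@gr_ind [set x | gproj (s + t) (x * y) = gproj s x * y]).
  split=> /= [|c u v hu hv]; first by rewrite mul0r !linear0 mul0r.
  by rewrite mulrDl -scalerAl !linearP hu hv mulrDl scalerAl.
move=> u z zu /=; have [us|/eqP us] := eqVneq u s.
  by rewrite us in zu; rewrite !gproj_id //; apply: grM zu yt _.
rewrite (gproj0 (nesym us) zu) mul0r; apply: (gproj0 _ (grM zu yt erefl)).
by move/addIn/esym.
Qed.

Lemma gproj_mull s t x y : G t y -> gproj (t + s) (y * x) = y * gproj s x.
Proof.
move=> yt; apply: (@gr_ind [set x | gproj (t + s) (y * x) = y * gproj s x]).
  split=> /= [|c u v hu hv]; first by rewrite mulr0 !linear0 mulr0.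
  by rewrite mulrDr -scalerAr !linearP hu hv mulrDr scalerAr.
move=> u z zu /=; have [us|/eqP us] := eqVneq u s.
  by rewrite us in zu; rewrite !gproj_id //; apply: grM yt zu _.
rewrite (gproj0 (nesym us) zu) mulr0; apply: (gproj0 _ (grM yt zu erefl)).
by move/addnI/esym.
Qed.

(** The new generators are the components of positive degree of the given ones; [j] in ['I_B] stands
    for degree [j.+1], because components of degree 0 are scalars. Projecting to degree [s] removes
    all words of another weight. *)
Lemma ex_hgen : finitely_generated A -> exists (g : nat) (y : 'I_g -> A) (d : 'I_g -> nat),
  [/\ forall i, (0 < d i)%N, forall i, G (d i) (y i) &
  forall s a, G s a -> lspan [set \prod_(i <- w) y i | w in
      [set w : seq 'I_g | sumn (map d w) = s]] a].
Proof.
move=> [n0 [x hx]]; have [B hB] := gproj_bound x.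
pose T := ('I_n0 * 'I_B)%type.
pose y (t : 'I_#|{: T}|) := gproj (enum_val t).2.+1 (x (enum_val t).1).
pose d (t : 'I_#|{: T}|) := (enum_val t).2.+1.
have hy t : G (d t) (y t) by apply: gprojG.
exists #|{: T}|, y, d; split=> // s a ha.
pose V := lspan (range (fun w : seq 'I_#|{: T}| => \prod_(i <- w) y i)).
have sV : subspace V by apply: subspace_lspan.
have V1 : V 1 by apply: sub_lspan; exists [::] => //; rewrite big_nil.
have VM u v : V u -> V v -> V (u * v).
  move=> Vu Vv; apply: (lspan_mul _ _ Vu Vv) => // _ _ [w _ <-] [w' _ <-].
  by apply: sub_lspan; exists (w ++ w') => //; rewrite big_cat.
have Vx i : V (x i).
  rewrite (hB i B.+1) //; apply: subspace_sum => // -[[|j] lj] _ /=.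
    have : G 0%N (gproj 0 (x i)) by apply: gprojG.
    by rewrite (graded_connected hG) => -[c _ <-]; apply: subspaceZ.
  apply: sub_lspan; exists [:: enum_rank (i, Ordinal (lj : (j < B)%N))] => //.
  by rewrite big_seq1 /y enum_rankK.
have Va : V a.
  have [f <-] := hx a; apply: subspace_sum => // w _.
  rewrite mulr_algl; apply: subspaceZ => //.
  by elim/big_ind: _ => //.
rewrite -(gproj_id ha).
have sW : subspace [set b | lspan [set \prod_(i <- w) y i | w in
      [set w | sumn (map d w) = s]] (gproj s b)].
  split=> /= [|c u v hu hv].
    by rewrite linear0; apply: (subspace0 (subspace_lspan _)).
  by rewrite linearP; case: (subspace_lspan [set \prod_(i <- w) y i | w in
      [set w | sumn (map d w) = s]]) => _; apply.
apply: (lspan_sub sW _ Va) => _ [w _ <-] /=.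
have hw := gr_prod w hy; have [e|/eqP ne] := eqVneq (sumn (map d w)) s.
  by rewrite gproj_id -?e //; apply: sub_lspan; exists w.
by rewrite (gproj0 (nesym ne) hw); apply: (subspace0 (subspace_lspan _)).
Qed.

(** In a word of weight at least [n], the shortest prefix of weight at least [n] exceeds [n] by at
    most the largest degree of a generator. *)
Lemma ex_window : finitely_generated A -> exists D, (0 < D)%N /\
  forall n m a, (n <= m)%N -> G m a -> lspan [set x | exists i u v,
    [/\ (i < D)%N, (n + i <= m)%N, G (n + i)%N u, G (m - (n + i))%N v & x = u * v]] a.
Proof.
move=> /ex_hgen[g [y [d [d0 hy hspan]]]]; exists (\max_i d i).+1; split=> // n m a nm ha.
apply: lspanS (hspan _ _ ha) => _ [w wm <-].
suff [u [v [wE nu un]]] : exists u v, [/\ w = u ++ v, (n <= sumn (map d u))%N &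
    (sumn (map d u) < n + (\max_i d i).+1)%N].
  exists (sumn (map d u) - n)%N, (\prod_(i <- u) y i), (\prod_(i <- v) y i).
  move: wm; rewrite wE /= map_cat sumn_cat => wm; rewrite subnKC //; split.
  - by rewrite -(ltn_add2l n) subnKC.
  - by rewrite -wm leq_addr.
  - exact: gr_prod.
  - by rewrite -wm addKn; apply: gr_prod.
  - by rewrite big_cat.
rewrite -wm /= in nm; move: nm; clear -d0; elim: w n => [|i w IH] n /=.
  by rewrite leqn0 => /eqP ->; exists [::], [::].
have [n0|n0] := posnP n; first by exists [::], (i :: w); rewrite n0.
have di : (d i <= \max_i d i)%N by apply: leq_bigmax.
have [ni _|ni nw] := leqP n (d i).
  by exists [:: i], w; rewrite /= addn0; split=> //; rewrite addnS ltnS (leq_trans di) // leq_addl.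
have [|u [v [-> h1 h2]]] := IH (n - d i)%N; first by rewrite leq_subLR.
exists (i :: u), v; split=> //=; first by rewrite -leq_subLR.
by move: ni h2; move: (sumn _) (bigop _ _ _) => a b; clear; lia.
Qed.

End Grading.

(** * Words of low complexity *)

Section DistinctCount.
Context {T : eqType}.

Lemma size_undup_rcons (s : seq T) a :
  size (undup (rcons s a)) = (size (undup s) + (a \notin s))%N.
Proof.
elim: s => [|b s IH] //=; rewrite mem_rcons !inE !(fun_if size) /= IH (eq_sym b).
by have [->|ne] := eqVneq a b; case: (b \in s); case: (a \in s) => /=; lia.
Qed.

Lemma size_undup_map (T' : eqType) (f : T -> T') (s : seq T) :
  (size (undup (map f s)) <= size (undup s))%N.
Proof.
rewrite -(size_map f); apply: uniq_leq_size (undup_uniq _) _ => y.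
by rewrite mem_undup => /mapP[x xs ->]; rewrite map_f // mem_undup.
Qed.

End DistinctCount.

Lemma mem_mkseq (T : eqType) (f : nat -> T) n y :
  reflect (exists2 i, (i < n)%N & y = f i) (y \in mkseq f n).
Proof.
apply: (iffP mapP) => -[i hi ->]; exists i => //; first by rewrite mem_iota in hi.
by rewrite mem_iota.
Qed.

Section Walk.
Context {V : eqType} (x : nat -> V).

Let pr i := (x i, x i.+1).
Let nv t := size (undup (mkseq x t)).
Let np t := size (undup (mkseq pr t)).

(** A chord is a new edge leading to an old vertex. Every other new edge brings a new vertex, so
    [count_chords] is Euler's relation for the graph traced by the walk. *)
Let chord t := (pr t \notin mkseq pr t) && (x t.+1 \in mkseq x t.+1).

Lemma count_chords t : (np t + 1 = nv t.+1 + \sum_(i < t) chord i)%N.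
Proof.
elim: t => [|t IH]; first by rewrite big_ord0.
rewrite big_ord_recr /=; rewrite /np /nv mkseqS size_undup_rcons (mkseqS _ t.+1) size_undup_rcons.
rewrite -/(np t) -/(nv t.+1); move: (\sum_(i < t) chord i)%N IH => S IH; rewrite /chord.
have h : x t.+1 \notin mkseq x t.+1 -> pr t \notin mkseq pr t.
  apply: contra => /mem_mkseq[i it [_ ->]]; apply/mem_mkseq.
  by exists i.+1.
move: h; case: (pr t \in _); case: (x t.+1 \in _) => //= h; try lia.
Qed.

Lemma vertices_le_edges t : (nv t.+1 <= np t + 1)%N.
Proof. by rewrite count_chords leq_addr. Qed.

Lemma nv_uniq t : uniq (mkseq x t) -> nv t = t.
Proof. by move=> u; rewrite /nv undup_id // size_mkseq. Qed.

Lemma nv_mono s t : (s <= t)%N -> (nv s <= nv t)%N.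
Proof.
move=> /subnKC <-; elim: (t - s)%N => [|n IH]; first by rewrite addn0.
by rewrite addnS /nv mkseqS size_undup_rcons; apply: leq_trans IH (leq_addr _ _).
Qed.

(* A walk with at most as many edges as vertices has at most one chord: it is
   a simple path, then winds around one cycle, then leaves it for good. *)
Lemma walk_shape M : (np M <= nv M.+1)%N ->
  exists j l q, [/\ (0 < l <= j)%N, (j <= q <= M.+1)%N, (j <= nv M.+1)%N,
    (M.+1 - q <= nv M.+1)%N & forall t, (j <= t < q)%N -> x t = x (t - l)%N].
Proof.
move=> hM; have [u|] := boolP (uniq (mkseq x M.+1)).
  have e := nv_uniq u; exists M.+1, 1%N, M.+1; rewrite e; split; try lia.
move=> nu.
(* [j] is the first time at which a vertex repeats, [l] the length of the cycle closed at that time,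
   and [q] the time at which the walk stops following this cycle. *)
have ex : exists j, (j <= M)%N && (x j \in mkseq x j).
  apply: contrapT => h; move/negP: nu; apply.
  suff h' t : (t <= M.+1)%N -> uniq (mkseq x t) by apply: h'.
  elim: t => [//|t IH] tM.
  rewrite mkseqS rcons_uniq IH ?(ltnW tM) // andbT.
  apply/negP => xt; apply: h; exists t; rewrite xt andbT; lia.
case: (ex_minnP ex) => j /andP[jM xj] minj {ex}.
have uj : uniq (mkseq x j).
  suff h' t : (t <= j)%N -> uniq (mkseq x t) by apply: h'.
  elim: t => [//|t IH] tj.
  rewrite mkseqS rcons_uniq IH ?(ltnW tj) // andbT.
  apply/negP => xt; have := minj t; rewrite xt andbT => /(_ _).
  by move=> /(_ (leq_trans (ltnW tj) jM)); lia.
have inj a b : (a < j)%N -> (b < j)%N -> x a = x b -> a = b.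
  move=> aj bj e; apply/eqP; rewrite -(nth_uniq (x 0%N) _ _ uj) ?size_mkseq //.
  by rewrite !nth_mkseq // e.
have [i ij xji] := mem_mkseq _ _ _ xj.
have jnv : (j <= nv M.+1)%N by rewrite -{1}(nv_uniq uj); apply: nv_mono; lia.
have j0 : (0 < j)%N by lia.
have chj : chord j.-1.
  rewrite /chord prednK // xj andbT; apply/mem_mkseq => -[r rj [e _]].
  have := inj _ _ _ _ e; lia.
(* The step into [x j] is a chord, and there is room for only one. *)
have noch t : (j <= t < M)%N -> x t.+1 \in mkseq x t.+1 -> pr t \in mkseq pr t.
  move=> /andP[jt tM] xt; apply: contraT => npr.
  have cht : chord t by rewrite /chord npr xt.
  have lt1 : (j.-1 < M)%N by lia.
  have := count_chords M; rewrite (bigD1 (Ordinal lt1)) //= chj.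
  rewrite (bigD1 (Ordinal tM)) /= ?cht; last by rewrite -val_eqE /=; lia.
  lia.
pose l := (j - i)%N.
have exq : exists q, (j <= q)%N && ((q == M.+1) || (x q != x (q - l)%N)).
  by exists M.+1; rewrite eqxx /=; lia.
case: (ex_minnP exq) => q /andP[jq xq] minq {exq}.
have qM : (q <= M.+1)%N by apply: minq; rewrite eqxx /=; lia.
have per t : (j <= t < q)%N -> x t = x (t - l)%N.
  move=> /andP[jt tq]; apply/eqP; apply: contraT => h.
  by have := minq t; rewrite jt h orbT => /(_ isT); lia.
have lj : (0 < l <= j)%N by rewrite /l; lia.
(* Going back along the cycle, every edge used before [q] is found among the first [j] steps. *)
have canon r : (r.+1 < q)%N -> exists r', [/\ (r' < j)%N, x r = x r' & x r.+1 = x r'.+1].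
  elim/ltn_ind: r => r IH rq; have [rj|jr] := ltnP r j; first by exists r.
  have [||r' [h1 h2 h3]] := IH (r - l)%N; try lia.
  exists r'; split=> //; first by rewrite per ?h2 //; lia.
  by rewrite per ?subSn ?h3 //; lia.
(* Leaving the cycle for an old vertex would need a second chord or an old edge, and an old edge
   continues along the cycle. So the vertices from [q] on are all new, which bounds their number. *)
have fresh t : (q <= t <= M)%N -> x t \notin mkseq x t.
  move=> /andP[qt tM]; rewrite -(subnKC qt).
  have : (q + (t - q) <= M)%N by lia.
  elim: (t - q)%N => [|n IH].
    rewrite addn0 => qM'; apply/negP => xq'.
    have jltq : (j < q)%N.
      rewrite ltn_neqAle jq andbT; apply/eqP => e; move: xq.
      have ji : (j - l = i)%N by rewrite /l; lia.
      by rewrite -e ji xji eqxx orbF => /eqP jM1; rewrite jM1 ltnn in jM.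
    have q0 : (0 < q)%N by lia.
    have : pr q.-1 \in mkseq pr q.-1 by apply: noch; [lia|rewrite prednK].
    move=> /mem_mkseq[r rq []]; rewrite prednK // => e1 e2.
    have [|r' [h1 h2 h3]] := canon r; first lia.
    have [|r2 [h4 h5 h6]] := canon (q.-1 - l)%N; first lia.
    have e3 : x q.-1 = x (q.-1 - l)%N by apply: per; lia.
    have e4 : r' = r2 by apply: inj => //; rewrite -h2 -h5 -e3 e1.
    move: xq; rewrite e2 h3 e4 -h6 => /orP[/eqP|]; first lia.
    by rewrite (_ : (q.-1 - l).+1 = q - l)%N ?eqxx //; lia.
  rewrite addnS => nM; apply/negP => xn.
  have : pr (q + n)%N \in mkseq pr (q + n)%N by apply: noch; [lia|].
  move=> /mem_mkseq[r rq [e1 _]]; have /negP := IH (ltnW nM); apply.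
  by apply/mem_mkseq; exists r.
exists j, l, q; split=> //; first by rewrite jq qM.
suff h n : (n <= M.+1 - q)%N -> (n <= nv (q + n))%N.
  by have := h _ (leqnn _); rewrite subnKC.
elim: n => [//|n IH] nM; rewrite addnS /nv mkseqS size_undup_rcons -/(nv _) fresh; last lia.
by rewrite addn1 ltnS; apply: IH; lia.
Qed.

End Walk.

Section Words.
Context {T : eqType}.
Implicit Types w s p u v : seq T.

Definition factors m w : seq (seq T) :=
  mkseq (fun i => take m (drop i w)) (size w - m).+1.

Lemma periodic_take x0 s l n e : (n <= size s)%N ->
  (forall t, (l <= t < n)%N -> nth x0 s t = nth x0 s (t - l)%N) ->
  (e * l <= n)%N -> take (e * l) s = flatten (nseq e (take l s)).
Proof.
move=> ns per; elim: e => [|e IH] h; first by rewrite mul0n take0.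
rewrite mulSn in h *; rewrite takeD /= -IH; last lia.
congr (_ ++ _); apply: (@eq_from_nth _ x0).
  by rewrite !size_take_min size_drop; lia.
move=> t; rewrite size_take_min size_drop leq_min => /andP[h1 h2].
rewrite !nth_take // nth_drop per; last lia.
by congr nth; lia.
Qed.

(** The word is a walk in its Rauzy graph, whose vertices are the factors of length [m.-1] and whose
    edges are those of length [m]. For the least positive [m] with at most [m] factors of length [m]
    there are at least [m] vertices, so [walk_shape] applies. *)
Lemma word_shape w d : (0 < d)%N -> (size (undup (factors d w)) <= d)%N ->
  exists u p e v, [/\ w = u ++ flatten (nseq e p) ++ v, (size u <= 3 * d + 3)%N,
    (size p <= 3 * d + 3)%N & (size v <= 3 * d + 3)%N].
Proof.
move=> d0 hd; have [->|w0] := eqVneq w [::]; first by exists [::], [::], 0%N, [::].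
have x0 : T by case: (w) w0.
have [wd|dw] := ltnP (size w) d.
  by exists w, [::], 0%N, [::]; rewrite /= cats0; split=> //; lia.
have ex : exists m, (0 < m)%N && (size (undup (factors m w)) <= m)%N.
  by exists d; rewrite d0.
case: (ex_minnP ex) => m /andP[m0 hm] minm {ex}.
have md : (m <= d)%N by apply: minm; rewrite d0.
pose x i := take m.-1 (drop i w); pose M := (size w - m.-1)%N.
have hM : ((size w - m).+1 = M)%N by rewrite /M; lia.
have hN : (m <= size (undup (mkseq x M.+1)))%N.
  have [e|m1] := eqVneq m.-1 0%N.
    rewrite (_ : m = 1%N); last lia.
    have : x 0%N \in undup (mkseq x M.+1).
      by rewrite mem_undup; apply/mem_mkseq; exists 0%N.
    by case: undup.
  rewrite leqNgt; apply/negP => lt; have : (m <= m.-1)%N; last lia.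
  by apply: minm; rewrite lt0n m1 -ltnS prednK.
have hnp : (size (undup (mkseq (fun i => (x i, x i.+1)) M)) <= m)%N.
  apply: leq_trans hm; rewrite /factors hM.
  pose f (s : seq T) := (take m.-1 s, drop 1 s).
  rewrite -(eq_mkseq (f := f \o (fun i => take m (drop i w)))).
    by rewrite /mkseq map_comp; apply: size_undup_map.
  move=> i; rewrite /f /= /x; congr (_, _).
    by rewrite take_takel // leq_pred.
  by rewrite -[i.+1]add1n -drop_drop [RHS]take_drop addn1 prednK.
have [j [l [q [lj jq jN qN per]]]] := walk_shape (leq_trans hnp hN).
have Nd : (size (undup (mkseq x M.+1)) <= d.+1)%N.
  by apply: leq_trans (vertices_le_edges x M) _; rewrite addn1 ltnS (leq_trans hnp).
have {}jN := leq_trans jN Nd; have {}qN := leq_trans qN Nd.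
pose n := minn q (size w); pose a := (j - l)%N.
have nper t : (j <= t < n)%N -> nth x0 w t = nth x0 w (t - l)%N.
  rewrite /n leq_min => /and3P[jt tq tw].
  (* For [m = 1] the vertices are empty words and carry no information, but then the word has a
     single letter. *)
  have [m1|m1] := ltnP 0 m.-1.
    have e y : nth x0 (x y) 0 = nth x0 w y by rewrite nth_take // nth_drop addn0.
    by rewrite -!e per // jt.
  have {m1} m1 : m = 1%N by lia.
  have const y : (y < size w)%N -> take 1 (drop y w) = [:: nth x0 w y].
    by move=> yw; rewrite (drop_nth x0) //= take0.
  have fac y : (y < size w)%N -> [:: nth x0 w y] \in undup (factors m w).
    move=> yw; rewrite mem_undup m1; apply/mem_mkseq; exists y; first lia.
    by rewrite const.
  have tlw : (t - l < size w)%N by lia.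
  move: hm (fac _ tw) (fac _ tlw); rewrite m1.
  case: (undup _) => [|b [|]] // _; rewrite !inE => /eqP e1 /eqP e2.
  by have [->] : [:: nth x0 w t] = [:: nth x0 w (t - l)%N] by rewrite e1 e2.
have l0 : (0 < l)%N by case/andP: lj.
have la : (l <= j)%N by case/andP: lj.
have ad : (a <= d.+1)%N by apply: leq_trans (leq_subr _ _) jN.
have tail : (size w - n <= d.+1 + d)%N.
  by move: jq qN dw md m0; rewrite /n /M; clear; lia.
have nw : (n <= size w)%N by rewrite geq_minr.
have {}nper t : (l <= t < n - a)%N -> nth x0 w (a + t) = nth x0 w (a + (t - l)).
  move=> h; rewrite nper; first by rewrite addnBA //; case/andP: h.
  by move: h la; rewrite /a; clear; lia.
have {}la := leq_trans la jN.
(* [e] whole periods fit between the start [a] of the cycle and the end [n] of the periodic stretch;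
   the incomplete last period goes into the tail. *)
have [e [e1 e2]] : exists e, (e * l <= n - a)%N /\ (n - a < e * l + l)%N.
  exists ((n - a) %/ l)%N; split; first exact: leq_trunc_div.
  by rewrite {1}(divn_eq (n - a) l) ltn_add2l ltn_pmod.
clear -d0 l0 ad tail nw nper la e1 e2.
exists (take a w), (take l (drop a w)), e, (drop (e * l) (drop a w)); split.
- have [wa|aw] := leqP (size w) a.
    have -> : e = 0%N by move: e1 l0; rewrite (_ : n - a = 0)%N; [clear; nia|lia].
    by rewrite [drop a w]drop_oversize // [take a w]take_oversize // cats0.
  rewrite -(@periodic_take x0 _ l (n - a)) ?cat_take_drop //.
    by rewrite size_drop leq_sub2r.
  by move=> t ht; rewrite !nth_drop nper.
- by rewrite size_take_min; move: ad; clear; lia.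
- by rewrite size_take_min; move: la; clear; lia.
- by rewrite !size_drop; move: tail nw e1 e2 la ad; clear; lia.
Qed.

End Words.

(* A word u p^e v is determined by (u, p, v) and its weight. *)
Lemma count_words (T : finType) (d : T -> nat) (K m : nat) (s : seq (seq T)) :
  (forall t, 0 < d t)%N -> uniq s ->
  (forall w, w \in s -> sumn (map d w) = m /\ exists u p e v,
     [/\ w = u ++ flatten (nseq e p) ++ v, (size u <= K)%N, (size p <= K)%N & (size v <= K)%N]) ->
  (size s <= #|{: K.-bseq T * K.-bseq T * K.-bseq T}|)%N.
Proof.
move=> d0 us hs.
pose bs := (K.-bseq T * K.-bseq T * K.-bseq T)%type.
have /boolp.choice[f hf] w : exists f : bs, w \in s -> exists e,
    w = f.1.1 ++ flatten (nseq e (f.1.2 : seq T)) ++ f.2.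
  have [ws|_] := boolP (w \in s); last by exists ([bseq], [bseq], [bseq]).
  have [_ [u [p [e [v [we hu hp hv]]]]]] := hs _ ws.
  by exists (Bseq hu, Bseq hp, Bseq hv) => _; exists e.
have inj : {in s &, injective f}.
  move=> w w' ws ws' ff; have [e we] := hf _ ws; have [e' we'] := hf _ ws'.
  have [mw _] := hs _ ws; have [mw' _] := hs _ ws'.
  have sumf n (r : seq T) : sumn (map d (flatten (nseq n r))) = (n * sumn (map d r))%N.
    by elim: n => [|n IH] //=; rewrite map_cat sumn_cat IH.
  move: mw mw'; rewrite {1}we {1}we' -ff !map_cat !sumn_cat !sumf => <- /eqP.
  rewrite eqn_add2l eqn_add2r eqn_mul2r => /orP[p0|/eqP ee]; last by rewrite we we' ff ee.
  rewrite we we' ff.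
  (* The weights leave the exponents undetermined only for an empty period, whose powers are all
     empty. *)
  have -> : bseqval (f w').1.2 = [::].
    rewrite -ff; case: (bseqval _) p0 => [//|t r] /=; by rewrite addn_eq0 eqn0Ngt d0.
  have nil n : flatten (nseq n ([::] : seq T)) = [::] by elim: n.
  by rewrite !nil.
rewrite -(size_map f) -(card_uniqP _) ?map_inj_in_uniq //.
exact: max_card.
Qed.

(** * Bounded Hilbert function *)

Section NormalWords.
Context {k : fieldType} {A : algType k} {G : nat -> set A}.
Hypothesis hG : connected_graded G.
Variables (g : nat) (y : 'I_g -> A) (d : 'I_g -> nat).
Hypothesis d0 : forall i, (0 < d i)%N.
Hypothesis hy : forall i, G (d i) (y i).
Hypothesis hspan : forall s a, G s a ->
  lspan [set \prod_(i <- w) y i | w in [set w : seq 'I_g | sumn (map d w) = s]] a.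

Implicit Types u v w : seq 'I_g.

Let wdeg w := sumn (map d w).
Let ev w := \prod_(i <- w) y i.
Let ltw u v := ((u : seqlexi 'I_g) < v)%O.
Let lower w : set (seq 'I_g) := [set u | wdeg u = wdeg w /\ ltw u w].

(* The leading words: their complement is the monomial ideal of leading terms
   of relations, for the lexicographic order on words of equal degree. *)
Definition normal w : bool := `[< ~ lspan [set ev u | u in lower w] (ev w) >].

Let wdeg_cat u v : wdeg (u ++ v) = (wdeg u + wdeg v)%N.
Proof. by rewrite /wdeg map_cat sumn_cat. Qed.

Let ev_cat u v : ev (u ++ v) = ev u * ev v.
Proof. exact: big_cat. Qed.

Let evG w : G (wdeg w) (ev w). Proof. exact: (gr_prod hG). Qed.

Let size_wdeg w : (size w <= wdeg w)%N.
Proof.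
elim: w => [//|i w IH]; have := d0 i; rewrite /wdeg /= -/(wdeg w); lia.
Qed.

Let ltw_catl w u v : ltw u v -> ltw (w ++ u) (w ++ v).
Proof. by elim: w => [//|i w IH] /IH; rewrite /ltw /= eqhead_ltxiE. Qed.

(* Words of the same positive weight are never proper prefixes of each other. *)
Let ltw_catr u v w : wdeg u = wdeg v -> ltw u v -> ltw (u ++ w) (v ++ w).
Proof.
elim: u v => [|i u IH] [|j v]; rewrite /ltw //=.
- move=> e _; exfalso; have := d0 j; move: e; rewrite /wdeg /=; lia.
- rewrite /wdeg /= !ltxi_cons => e /andP[ij /implyP h].
  rewrite ij; apply/implyP => ji; have := h ji.
  move=> lt; apply: IH => //; move: e; have -> : i = j.
    by apply/eqP; rewrite eq_le ij ji.
  by move/addnI.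
Qed.

(** A rewriting of [v] by smaller words of the same weight can be carried out inside [u ++ v ++ w],
    as the order is compatible with concatenation on both sides. *)
Lemma normal_factor u v w : normal (u ++ v ++ w) -> normal v.
Proof.
move=> /asboolP h; apply/asboolP => hv; apply: h; rewrite !ev_cat.
set V := lspan _; have sV : subspace V by apply: subspace_lspan.
have sW : subspace [set x | V (ev u * (x * ev w))].
  split=> [/=|c a b /= ha hb]; first by rewrite mul0r mulr0; apply: subspace0.
  by rewrite mulrDl mulrDr -scalerAl -scalerAr; case: sV => _; apply.
apply: (lspan_sub sW _ hv) => _ [v' [e lt] <-] /=.
rewrite -!ev_cat; apply: sub_lspan; exists (u ++ v' ++ w) => //; split.
  by rewrite !wdeg_cat e.
exact/ltw_catl/ltw_catr.
Qed.

Definition bwords n : seq (seq 'I_g) := [seq val b | b <- enum {: n.-bseq 'I_g}].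

Lemma mem_bwords n w : (w \in bwords n) = (size w <= n)%N.
Proof.
apply/mapP/idP => [[b _ ->]|h]; first exact: size_bseq.
by exists (Bseq h) => //; rewrite mem_enum.
Qed.

Lemma uniq_bwords n : uniq (bwords n).
Proof. by rewrite map_inj_uniq ?enum_uniq //; apply: val_inj. Qed.

Let words s : seq (seq 'I_g) :=
  sort (fun u v => ((u : seqlexi 'I_g) <= v)%O) [seq w <- bwords s | wdeg w == s].

Let mem_words s w : (w \in words s) = (wdeg w == s).
Proof.
rewrite mem_sort mem_filter mem_bwords; case: eqP => //= <-.
exact: size_wdeg.
Qed.

Lemma uniq_words s : uniq (words s).
Proof. by rewrite sort_uniq filter_uniq // uniq_bwords. Qed.

Lemma normal_dim s : has_dim (G s) (count normal (words s)).
Proof.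
have -> : G s = lspan [set ev w | w in [set` words s]].
  apply/seteqP; split=> a.
    move=> /hspan; apply: lspanS => _ [w e <-]; exists w => //=.
    by rewrite mem_words; apply/eqP.
  apply: lspan_sub; first exact: gr_sub hG s.
  by move=> x [w /=]; rewrite mem_words => /eqP e <-; rewrite -e; apply: evG.
have irr : irreflexive ltw by move=> u; rewrite /ltw ltxx.
have trn : transitive ltw by move=> ? ? ?; apply: lt_trans.
have srt : sorted ltw (words s).
  have := sort_lt_sorted ([seq w <- bwords s | wdeg w == s] : seq (seqlexi 'I_g)).
  by rewrite filter_uniq // uniq_bwords.
have := pivot_dim ev irr trn srt; congr (has_dim _ _).
apply: eq_in_count => w; rewrite mem_words => /eqP ws.
congr (`[< ~ lspan [set _ | _ in _] _ >]); apply/seteqP; split=> u /=.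
  by rewrite mem_words => -[/eqP us lt]; split=> //; rewrite us.
by move=> [us lt]; rewrite mem_words us ws.
Qed.

(** The largest word of a given degree in a relation would be a combination of smaller ones. The
    projection to one degree is needed because words of equal length may have different degrees. *)
Lemma normal_free (s : seq (seq 'I_g)) : uniq s -> all normal s ->
  freemod [set 0] (fun i : 'I_(size s) => ev (nth [::] s i)).
Proof.
move=> us /allP ns c /= sum0 j; apply: contrapT => /eqP cj.
pose w (i : 'I_(size s)) : seqlexi 'I_g := nth [::] s i.
pose P (i : 'I_(size s)) := (c i != 0) && (wdeg (w i) == wdeg (w j)).
have Pj : P j by rewrite /P cj eqxx.
case: (arg_maxP w Pj) => i /andP[ci /eqP di] imax.
have : normal (w i) by apply: ns; apply: mem_nth.
move=> /asboolP; apply.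
set V := lspan _; have sV : subspace V by apply: subspace_lspan.
have : gproj hG (wdeg (w j)) (\sum_(i < size s) c i *: ev (nth [::] s i)) = 0.
  by rewrite sum0 linear0.
rewrite linear_sum (bigD1 i) //= linearZ /= gproj_id; last by rewrite -di; apply: evG.
move=> /eqP; rewrite addrC addr_eq0 => /eqP e.
suff : V (c i *: ev (w i)).
  move=> /(subspaceZ (c i)^-1 sV); rewrite scalerA mulVf // scale1r //.
rewrite -[_ *: _]opprK -e; apply: subspaceN => //; apply: subspace_sum => // i' ii'.
rewrite linearZ /=; have [->|ci'] := eqVneq (c i') 0; first by rewrite scale0r; apply: subspace0.
apply: subspaceZ => //; have [e'|ne] := eqVneq (wdeg (w i')) (wdeg (w j)); last first.
  rewrite (gproj0 hG (nesym _) (evG _)); first exact: subspace0.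
  exact/eqP.
rewrite gproj_id; last by rewrite -e'; apply: evG.
apply: sub_lspan; exists (w i') => //; split; first by rewrite e'.
have le : (w i' <= w i)%O by apply: imax; rewrite /P ci' e' eqxx.
rewrite /ltw lt_neqAle le andbT; apply: contra ii' => /eqP eqw.
apply/eqP/val_inj/eqP; rewrite -(nth_uniq [::] (ltn_ord i') (ltn_ord i) us).
by apply/eqP; exact: eqw.
Qed.

(** Words are counted here by length and not by weight, since [power_span] filters by the number of
    factors. *)
Let p n := count normal [seq w <- bwords n | size w == n].

Lemma sum_p n : (\sum_(i < n.+1) p i <= dimk (power_span (codom y) n))%N.
Proof.
pose s := [seq w <- bwords n | normal w].
have -> : (\sum_(i < n.+1) p i = size s)%N.
  rewrite size_filter -sum1_count (partition_big (fun w => inord (size w) : 'I_n.+1) predT) //=.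
  apply: eq_bigr => i _; rewrite /p -sum1_count big_filter_cond -[LHS]big_filter -[RHS]big_filter.
  apply: perm_big; apply: uniq_perm; rewrite ?filter_uniq ?uniq_bwords // => w.
  rewrite !mem_filter !mem_bwords; have i_n := ltn_ord i.
  have [wn|wn] := leqP (size w) n; rewrite ?andbT ?andbF.
    rewrite -[inord _ == _]val_eqE /= inordK //.
    by case: eqP => [->|]; rewrite ?andbF //= leqnn andbT.
  by case: eqP => [e|//]; move: wn i_n; rewrite e; lia.
have hs : freemod [set 0] (fun i : 'I_(size s) => ev (nth [::] s i)).
  by apply: normal_free; [rewrite filter_uniq // uniq_bwords|apply: filter_all].
apply: (has_dim_free (V := power_span (codom y) n)) hs; last first.
  move=> i; apply: sub_lspan; exists (map y (nth [::] s i)); last by rewrite /ev big_map.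
  have : nth [::] s i \in s by apply: mem_nth.
  rewrite mem_filter mem_bwords => /andP[_ h]; split; first by rewrite size_map.
  by move=> _ /mapP[t _ ->]; apply: codom_f.
apply: (@has_dim_lspan _ _ _ (map ev (bwords n))) => _ [w [wn wy] <-] /=.
have [v vE] : exists v, w = map y v.
  elim: w wy {wn} => [|a w IH] h; first by exists [::].
  have /codomP[t ->] : a \in codom y by apply: h; rewrite mem_head.
  have [|v ->] := IH; first by move=> b bw; apply: h; rewrite inE bw orbT.
  by exists (t :: v).
rewrite vE size_map in wn *; apply/mapP; exists v; first by rewrite mem_bwords.
by rewrite /ev big_map.
Qed.

Lemma factors_normal w m : normal w ->
  {subset factors m w <= [seq w <- bwords m | normal w]}.
Proof.
move=> nw v /mem_mkseq[i _ ->]; rewrite mem_filter mem_bwords size_take_min geq_minl andbT.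
apply: (@normal_factor (take i w) _ (drop m (drop i w))).
by rewrite !cat_take_drop.
Qed.

(* Bergman's gap: if some length n >= 1 carries at most n normal words then
   the normal words have boundedly many patterns u p^e v. *)
Lemma bounded_of_p n : (0 < n)%N -> (p n <= n)%N ->
  exists C, forall s, has_dim (G s) (dimk (G s)) /\ (dimk (G s) <= C)%N.
Proof.
move=> n0 pn; exists #|{: (3 * n + 3).-bseq 'I_g * (3 * n + 3).-bseq 'I_g * (3 * n + 3).-bseq 'I_g}|.
move=> s; have hs := normal_dim s; rewrite (dimkE hs); split=> //.
rewrite -size_filter; apply: (count_words (m := s) d0).
  by rewrite filter_uniq // uniq_words.
suff hw (w : seq 'I_g) : normal w -> exists (u v : seq 'I_g) e (r : seq 'I_g),
     [/\ w = u ++ flatten (nseq e v) ++ r, (size u <= 3 * n + 3)%N,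
      (size v <= 3 * n + 3)%N & (size r <= 3 * n + 3)%N].
  by move=> w; rewrite mem_filter mem_words => /andP[/hw ? /eqP ws].
move=> nw; have [wn|nw'] := ltnP (size w) n.
  by exists w, [::], 0%N, [::]; rewrite /= cats0; split=> //; lia.
apply: word_shape => //; apply: leq_trans pn.
rewrite /p -size_filter; apply: uniq_leq_size; first exact: undup_uniq.
move=> v; rewrite mem_undup => vw; rewrite !mem_filter.
have := factors_normal nw vw; rewrite mem_filter => /andP[-> ->]; rewrite andbT /=.
have /mem_mkseq[i hi ->] := vw.
rewrite ltnS in hi; rewrite size_take_min size_drop; apply/eqP/minn_idPl.
by rewrite -{1}(subKn nw') leq_sub2l.
Qed.

(** If every length [i >= 1] carried more than [i] normal words, the dimensions would be at least
    n^2 / 2; the square n^4 / 4 is at least n^3 once n >= 4. *)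
Lemma bounded_of_growth : (exists N, forall n, (N <= n)%N -> (1 < n)%N ->
    (dimk (power_span (codom y) n) ^ 2 < n ^ 3)%N) ->
  exists C, forall s, has_dim (G s) (dimk (G s)) /\ (dimk (G s) <= C)%N.
Proof.
move=> [N hN]; have [n n0 pn] : exists2 n, (0 < n)%N & (p n <= n)%N; last exact: bounded_of_p pn.
apply: contrapT => h; pose n := (maxn N 4).
have pge i : (0 < i)%N -> (i < p i)%N.
  by move=> i0; rewrite ltnNge; apply/negP => ple; apply: h; exists i.
have sump m : (m * m <= 2 * \sum_(i < m.+1) p i)%N.
  elim: m => [//|m IH]; rewrite big_ord_recr /=; move: (pge m.+1 isT) IH.
  by move: (p m.+1) (\sum_(i < m.+1) p i)%N => a b; clear; nia.
have n4 : (4 <= n)%N by rewrite leq_maxr.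
have := hN n (leq_maxl _ _) (leq_trans _ n4); rewrite ltnNge => /(_ isT)/negP; apply.
have := leq_trans (sump n) (_ : (_ <= 2 * dimk (power_span (codom y) n))%N).
rewrite leq_mul2l sum_p => /(_ isT).
move: (dimk _) n4 => D; move: (n) => m; clear => m4 h.
have : (m * m * (m * m) <= 2 * D * (2 * D))%N by apply: leq_mul.
rewrite !expnS !expn0 !muln1 => h2.
have : (4 * (m * (m * m)) <= m * m * (m * m))%N by rewrite -[X in (_ <= X)%N]mulnA leq_mul2r m4 orbT.
by move: h2; clear; nia.
Qed.

End NormalWords.

(** Any exponent strictly between 1 and 2 separates linear from quadratic growth; with 3/2, squaring
    gives an inequality between natural numbers. *)
Lemma GKdim_growth (R : realType) {k : fieldType} {A : algType k} (v : seq A) :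
  (GKdim R A <= 1%:E)%E ->
  exists N, forall n, (N <= n)%N -> (1 < n)%N -> (dimk (power_span v n) ^ 2 < n ^ 3)%N.
Proof.
move=> hGK; pose u n := (ln (dimk (power_span v n))%:R / ln n%:R : R)%:E.
have : (limn_esup u <= 1%:E)%E.
  by apply: le_trans hGK; apply: ereal_sup_ubound; exists v.
rewrite limn_esup_lim (cvg_lim _ (@cvg_esups_inf _ u)) // => h.
have /ereal_inf_lt[_ [N _ <-] hN] : (ereal_inf (range (esups u)) < (3 / 2)%:E)%E.
  by apply: le_lt_trans h _; rewrite lte_fin ltr_pdivlMr // mul1r ltr_nat.
exists N => n Nn n1.
have : (u n < (3 / 2)%:E)%E.
  by apply: le_lt_trans hN; apply: ereal_sup_ubound; exists n.
have n0 : 0 < (n%:R : R) by rewrite ltr0n; lia.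
have lnn : 0 < ln (n%:R : R) by rewrite ln_gt0 // ltr1n.
rewrite /u lte_fin ltr_pdivrMr // => lt.
(* For [D = 0] the logarithm is a default value, and the bound holds trivially. *)
set D := dimk _ in lt *; have [->|D0] := posnP D; first by rewrite exp0n // expn_gt0; lia.
have D0' : 0 < (D%:R : R) by rewrite ltr0n.
rewrite -(ltr_nat R) !natrX -ltr_ln ?posrE ?exprn_gt0 // !lnXn //.
rewrite -[_ *+ 2]mulr_natr -[_ *+ 3]mulr_natl.
by move: lt; rewrite mulrAC ltr_pdivlMr.
Qed.

Lemma bounded_dims (R : realType) {k : fieldType} {A : algType k} (G : nat -> set A) :
  connected_graded G -> finitely_generated A -> (GKdim R A <= 1%:E)%E ->
  exists C, forall s, has_dim (G s) (dimk (G s)) /\ (dimk (G s) <= C)%N.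
Proof.
move=> hG hfg hGK; have [g [y [d [d0 hy hspan]]]] := ex_hgen hG hfg.
by apply: (bounded_of_growth hG d0 hy hspan); apply: GKdim_growth hGK.
Qed.

(** * Semiprime algebras *)

Section Ideals.
Context {A : nzRingType} (N : set A).
Hypothesis hN : two_sided_ideal N.

Lemma ideal0 : N 0. Proof. by have [[]] := hN. Qed.
Lemma idealB x y : N x -> N y -> N (x - y). Proof. by have [[_ h _] _] := hN; apply: h. Qed.
Lemma idealN x : N x -> N (- x).
Proof. by move=> Nx; rewrite -[- x]add0r; apply: idealB => //; apply: ideal0. Qed.
Lemma idealD x y : N x -> N y -> N (x + y).
Proof. by move=> Nx Ny; rewrite -[y]opprK; apply: idealB => //; apply: idealN. Qed.
Lemma idealMr x a : N x -> N (x * a). Proof. by have [[_ _ h] _] := hN; apply: h. Qed.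
Lemma idealMl x a : N x -> N (a * x). Proof. by have [_ h] := hN; apply: h. Qed.

Lemma ideal_trans x y : N (x - y) -> N y -> N x.
Proof. by move=> h Ny; rewrite -(subrK y x); apply: idealD. Qed.

Lemma ideal_congr x y : N (x - y) -> N x -> N y.
Proof. by move=> h; apply: ideal_trans; rewrite -opprB; apply: idealN. Qed.

End Ideals.

Lemma ideal_subspace {k : fieldType} {A : algType k} (N : set A) :
  two_sided_ideal N -> subspace N.
Proof.
move=> hN; split=> [|c x y Nx Ny]; first exact: ideal0.
by apply: idealD => //; rewrite -mulr_algl; apply: idealMl.
Qed.

Lemma ex_max_nat (P : nat -> Prop) B : (exists m, P m) -> (forall m, P m -> (m <= B)%N) ->
  exists m, P m /\ forall m', P m' -> (m' <= m)%N.
Proof.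
move=> [m0 Pm0] hB; have ex : exists m, `[< P m >] by exists m0; apply/asboolP.
have ub m : `[< P m >] -> (m <= B)%N by move=> /asboolP /hB.
case: (ex_maxnP ex ub) => m /asboolP Pm mmax; exists m; split=> // m' Pm'.
by apply: mmax; apply/asboolP.
Qed.

Section Semiprime.
Context {k : fieldType} {A : algType k} {G : nat -> set A}.
Hypothesis hG : connected_graded G.
Variables (C D : nat) (N : set A).
Hypothesis hC : forall s, has_dim (G s) (dimk (G s)) /\ (dimk (G s) <= C)%N.
Hypothesis hD : forall n m a, (n <= m)%N -> G m a -> lspan [set x | exists i u v,
    [/\ (i < D)%N, (n + i <= m)%N, G (n + i)%N u, G (m - (n + i))%N v & x = u * v]] a.
Hypothesis hN : two_sided_ideal N.
(* The graded form of semiprimeness of A / N. *)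
Hypothesis hsp : forall s b, (0 < s)%N -> G s b ->
  (forall t x, G t x -> N (b * x * b)) -> N b.

Let sN := ideal_subspace hN.

(** Otherwise [b] annihilates everything of degree at least [n] modulo [N]. In the last degree [i]
    where it does not, some [b * x] outside [N] is killed by the whole positive part; then
    [b * x * y * (b * x)] lies in [N] for all [y], against [hsp]. *)
Lemma window_hit s b n : (0 < s)%N -> G s b -> ~ N b ->
  exists i x, [/\ (i < D)%N, G (n + i)%N x & ~ N (b * x)].
Proof.
move=> s0 bs nb; apply: contrapT => H.
have kill m a : (n <= m)%N -> G m a -> N (b * a).
  move=> nm /(hD nm); apply: (lspan_sub (V := [set x | N (b * x)])) => [|_ [i [u [v [iD _ hu _ ->]]]]].
    split=> /= [|c x y hx hy]; first by rewrite mulr0; apply: (ideal0 hN).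
    by rewrite mulrDr -scalerAr; case: sN => _; apply.
  rewrite /= mulrA; apply: (idealMr hN); apply: contrapT => nbu.
  by apply: H; exists i, u.
pose P i := exists x, G i x /\ ~ N (b * x).
have [|m|i [[x [xi nbx]] imax]] := @ex_max_nat P n.
- by exists 0%N, 1; split; [exact: gr1|rewrite mulr1].
- move=> [x [xm nbx]]; rewrite leqNgt; apply/negP => nm.
  by apply: nbx; apply: kill xm; apply: ltnW.
apply: nbx; apply: (hsp (s := (s + i)%N)); first by rewrite addn_gt0 s0.
  exact: (grM hG bs xi).
have bx0 j y : (0 < j)%N -> G j y -> N (b * x * y).
  move=> j0 yj; apply: contrapT => ny.
  have : P (i + j)%N by exists (x * y); rewrite mulrA; split=> //; apply: (grM hG xi yj).
  by move=> /imax; rewrite -{2}[i]addn0 leq_add2l leqNgt j0.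
have bb : N (b * x * (b * x)).
  by apply: (bx0 (s + i)%N); [rewrite addn_gt0 s0|apply: (grM hG bs xi)].
move=> [|t] y yt; last by rewrite mulrA; do 2 apply: (idealMr hN); apply: bx0 yt.
move: yt; rewrite (graded_connected hG) => -[c _ <-].
by rewrite -mulrA mulr_algl -scalerAr; apply: subspaceZ.
Qed.

Let ann b n : set A := [set x | G n x /\ N (b * x)].

Let ann_dim b n : has_dim (ann b n) (dimk (ann b n)) /\ (dimk (ann b n) <= C)%N.
Proof.
have sub : ann b n `<=` G n by move=> x [].
have [h1 h2] := ex_has_dim_sub sub (hC n).1.
by split=> //; apply: leq_trans h2 (hC n).2.
Qed.

Let ann_sub b n : subspace (ann b n).
Proof.
split=> [|c x y [hx bx] [hy by_]].
  by split; [exact: (gr0 hG)|rewrite mulr0; apply: (ideal0 hN)].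
split; first by apply: (grD hG) => //; apply: (grZ hG).
by rewrite mulrDr -scalerAr; case: sN => _; apply.
Qed.

(** The size of the right annihilator of [b] modulo [N] in one window. It is bounded and detects
    strict inclusions in all late windows, so it serves for ascending and for descending chain
    arguments. *)
Let mu b n := (\sum_(i < D) dimk (ann b (n + i)))%N.

Let mu_le b n : (mu b n <= C * D)%N.
Proof.
apply: (@leq_trans (\sum_(i < D) C)); last by rewrite sum_nat_const card_ord mulnC.
by apply: leq_sum => i _; apply: (ann_dim _ _).2.
Qed.

(** Each late window contains a product [y * x] with [b * y * x] outside [N], and this product
    separates the two annihilators. *)
Let mu_lt b c s t y : (forall n x, G n x -> N (b * x) -> N (c * x)) ->
  (0 < s)%N -> G s (b * y) -> G t y -> ~ N (b * y) -> N (c * y) ->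
  exists n0, forall n, (n0 <= n)%N -> (mu b n < mu c n)%N.
Proof.
move=> bc s0 bys yt nby cy; exists t => n tn.
have sub m : ann b m `<=` ann c m by move=> x [xm bx]; split=> //; apply: (bc _ _ xm).
have le m : (dimk (ann b m) <= dimk (ann c m))%N.
  exact: has_dim_le (sub m) (ann_dim b m).1 (ann_dim c m).1.
have [i [x [iD xi nx]]] := window_hit (n - t) s0 bys nby.
have lt : (dimk (ann b (n + i)) < dimk (ann c (n + i)))%N.
  apply: has_dim_lt (ann_sub b _) (sub _) (ann_dim _ _).1 (ann_dim _ _).1 _ => h.
  have [|_] := h (y * x); last by rewrite mulrA.
  split; last by rewrite mulrA; apply: (idealMr hN).
  by apply: (grM hG yt xi); rewrite addnA subnKC.
rewrite /mu (bigD1 (Ordinal iD)) //= [X in (_ < X)%N](bigD1 (Ordinal iD)) //=.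
by rewrite -addSn leq_add // leq_sum.
Qed.

(** As [mu b n] varies with the window, what is maximized is an eventual lower bound of it. *)
Let max_mu (F : A -> Prop) : (exists b, F b) -> exists b, F b /\ forall c, F c ->
  ~ exists n0, forall n, (n0 <= n)%N -> (mu b n < mu c n)%N.
Proof.
move=> [b0 Fb0].
pose P m := exists b, F b /\ exists n0, forall n, (n0 <= n)%N -> (m <= mu b n)%N.
have [||m [[b [Fb [n0 hn0]]] mmax]] := @ex_max_nat P (C * D).
- by exists 0%N, b0; split=> //; exists 0%N.
- by move=> m [b [_ [n0 /(_ _ (leqnn _)) h]]]; apply: leq_trans h (mu_le _ _).
exists b; split=> // c Fc [n1 hn1].
suff /mmax : P m.+1 by rewrite ltnn.
exists c; split=> //; exists (maxn n0 n1) => n; rewrite geq_max => /andP[h0 h1].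
by apply: leq_ltn_trans (hn0 _ h0) (hn1 _ h1).
Qed.

Let min_mu (F : A -> Prop) : (exists b, F b) -> exists b, F b /\ forall c, F c ->
  ~ exists n0, forall n, (n0 <= n)%N -> (mu c n < mu b n)%N.
Proof.
move=> [b0 Fb0].
pose P m := exists b, F b /\ exists n0, forall n, (n0 <= n)%N -> (mu b n + m <= C * D)%N.
have [||m [[b [Fb [n0 hn0]]] mmax]] := @ex_max_nat P (C * D).
- by exists 0%N, b0; split=> //; exists 0%N => n _; rewrite addn0; apply: mu_le.
- by move=> m [b [_ [n0 /(_ _ (leqnn _))]]]; apply: leq_trans; rewrite leq_addl.
exists b; split=> // c Fc [n1 hn1].
suff /mmax : P m.+1 by rewrite ltnn.
exists c; split=> //; exists (maxn n0 n1) => n; rewrite geq_max => /andP[h0 h1].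
by rewrite addnS -addSn; apply: leq_trans (hn0 _ h0); rewrite leq_add2r hn1.
Qed.

Let mulX_shift (x a : A) n : (x * a) ^+ n.+1 = x * (a * x) ^+ n * a.
Proof.
elim: n => [|n IH]; first by rewrite expr1 expr0 mulr1.
by rewrite exprS IH [in RHS]exprS !mulrA.
Qed.

(* Levitzki's argument: a nil one-sided ideal vanishes modulo N. *)
Lemma ex_nonnilpotent s a : (0 < s)%N -> G s a -> ~ N a ->
  exists t x, G t x /\ forall n, ~ N ((a * x) ^+ n).
Proof.
move=> s0 sa na; apply: contrapT => H.
have {}H t x : G t x -> exists n, N ((a * x) ^+ n).
  move=> xt; apply: contrapT => h; apply: H; exists t, x; split=> // n h'.
  by apply: h; exists n.
have [|b0 [[t [y [yt -> nb]]] bmax]] :=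
    @max_mu (fun b => exists t y, [/\ G t y, b = y * a & ~ N b]).
  by exists a, 0%N, 1; rewrite mul1r; split=> //; apply: gr1.
set b := y * a in nb bmax *.
have bG : G (t + s)%N b by apply: (grM hG yt sa).
(* As long as [c * b] is outside [N], it is another left multiple of [a]. Its annihilator contains
   that of [b], so by maximality the two agree. *)
have key u c v x : G u c -> ~ N (c * b) -> G v x -> N (c * b * x) -> N (b * x).
  move=> cu ncb xv cbx; apply: contrapT => nbx; apply: (bmax (c * b)).
    by exists (u + t)%N, (c * y); rewrite -mulrA; split=> //; apply: (grM hG cu yt).
  apply: (mu_lt (s := (t + s + v)%N) (t := v) (y := x)) => //.
  - by move=> n x' _ h; rewrite -mulrA; apply: (idealMl hN).
  - by rewrite !addn_gt0 s0 orbT.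
  - exact: (grM hG bG xv).
apply: (nb); apply: (hsp _ bG); first by rewrite addn_gt0 s0 orbT.
move=> u x xu; rewrite -mulrA.
have [|nxb] := pselect (N (x * b)); first exact: idealMl.
have xbG : G (u + (t + s))%N (x * b) by apply: (grM hG xu bG).
(* Nilpotency modulo [N] passes from [a * (x * y)] to [x * y * a], which is [x * b]. *)
have [n hn] := H _ _ (grM hG xu yt erefl).
have ex : exists n, `[< N ((x * b) ^+ n) >].
  exists n.+1; apply/asboolP; rewrite /b mulrA mulX_shift.
  by apply: (idealMr hN); apply: (idealMl hN).
case: (ex_minnP ex) => m /asboolP hm minm.
case: m hm minm => [|[|m]] hm minm.
- by case: nb; rewrite -[b]mulr1; apply: (idealMl hN).
- by [].
have nm : ~ N ((x * b) ^+ m.+1) by move=> /asboolP/minm; rewrite ltnn.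
(* For [c = (x * b) ^+ m * x], the product [c * b] is the last power of [x * b] outside [N]. It
   kills [x * b] modulo [N], hence so does [b]. *)
rewrite exprSr in nm hm; apply: (key _ ((x * b) ^+ m * x) _ _ _ _ xbG).
- exact: (grM hG (grX hG m xbG) xu).
- by rewrite -mulrA.
- by rewrite -[_ * x * b]mulrA -exprSr -exprSr.
Qed.

(** Homogeneity of [z ^+ s + f ^+ d] forces a passage to powers; stability makes this harmless for
    annihilators. *)
Let stable z := forall j n x, G n x -> N (z ^+ j.+1 * x) -> N (z * x).

Let ex_stable_power s e : (0 < s)%N -> G s e -> (forall n, ~ N (e ^+ n)) ->
  exists i, stable (e ^+ i.+1).
Proof.
move=> s0 es ne.
have [|b [[i ->] bmax]] := @max_mu (fun b => exists i, b = e ^+ i.+1).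
  by exists (e ^+ 1), 0%N.
exists i => j n x xn hx; apply: contrapT => nx; apply: (bmax (e ^+ i.+1 ^+ j.+1)).
  by exists (i.+1 * j.+1).-1; rewrite prednK ?muln_gt0 // exprM.
apply: (mu_lt (s := (s * i.+1 + n)%N) (y := x) (t := n)) => //.
- by move=> n' x' _ h; rewrite exprSr -mulrA; apply: (idealMl hN).
- by rewrite addn_gt0 muln_gt0 s0.
- exact: (grM hG (grX hG i.+1 es) xn).
Qed.

Section Step.
Variables (d s : nat) (z f : A).
Hypotheses (d0 : (0 < d)%N) (s0 : (0 < s)%N) (Sz : stable z) (Sf : stable f).
Hypotheses (zd : G d z) (fs : G s f) (zf : N (z * f)).

Let z' := z ^+ s + f ^+ d.

Let zf' i j : (0 < i)%N -> (0 < j)%N -> N (z ^+ i * f ^+ j).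
Proof.
move=> i0 j0; rewrite -(prednK i0) -(prednK j0) exprSr exprS mulrA -[_ * z * f]mulrA.
by apply: (idealMr hN); apply: (idealMl hN).
Qed.

Let zz' j : N (z * z' ^+ j - z ^+ (s * j).+1).
Proof.
elim: j => [|j IH]; first by rewrite muln0 expr0 mulr1 subrr; apply: (ideal0 hN).
have -> : z * z' ^+ j.+1 - z ^+ (s * j.+1).+1 =
    (z * z' ^+ j - z ^+ (s * j).+1) * z' + z ^+ (s * j).+1 * f ^+ d.
  by rewrite mulrBl exprSr mulrA -addrA; congr (_ + _); rewrite /z' mulrDr opprD -exprD
    addSn addnC -mulnS subrK.
by apply: (idealD hN); [apply: (idealMr hN)|apply: zf'].
Qed.

(** Only [z * f] is known to lie in [N], not [f * z], whence the asymmetry. Multiplying by [z] on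
    the left removes [f] and yields [z * x]; after that, powers of [z] drop out of [z' ^+ i * x] and
    only powers of [f] remain. *)
Lemma ann_sum j n x : G n x -> N (z' ^+ j.+1 * x) -> N (z * x) /\ N (f * x).
Proof.
move=> xn hx; have zx : N (z * x).
  apply: (Sz (j := (s * j.+1)%N) xn).
  apply: (ideal_congr hN (x := z * z' ^+ j.+1 * x)).
    by rewrite -mulrBl; apply: (idealMr hN).
  by rewrite -mulrA; apply: (idealMl hN).
split=> //; have zix i : (0 < i)%N -> N (z ^+ i * x).
  by move=> i0; rewrite -(prednK i0) exprSr -mulrA; apply: (idealMl hN).
have cong i : N (z' ^+ i * x - f ^+ (d * i) * x).
  elim: i => [|i IH]; first by rewrite muln0 !expr0 subrr; apply: (ideal0 hN).
  have -> : z' ^+ i.+1 * x - f ^+ (d * i.+1) * x =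
      z' * (z' ^+ i * x - f ^+ (d * i) * x) + z ^+ s * f ^+ (d * i) * x.
    have e : z' * (f ^+ (d * i) * x) = f ^+ (d * i.+1) * x + z ^+ s * f ^+ (d * i) * x.
      by rewrite /z' mulrDl !mulrA -exprD -mulnS addrC.
    by rewrite mulrBr e opprD addrA subrK mulrA -exprS.
  apply: (idealD hN); first exact: idealMl.
  case: i {IH} => [|i]; first by rewrite muln0 expr0 mulr1; apply: zix.
  by apply: (idealMr hN); apply: zf'; rewrite ?muln_gt0 ?d0.
have dj : (0 < d * j.+1)%N by rewrite muln_gt0 d0.
apply: (Sf (j := (d * j.+1).-1) xn); rewrite prednK //.
exact: (ideal_congr hN (cong _) hx).
Qed.

Lemma stable_sum : stable z'.
Proof.
move=> j n x xn /(ann_sum xn)[zx fx]; rewrite mulrDl; apply: (idealD hN).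
  by rewrite -(prednK s0) exprSr -mulrA; apply: (idealMl hN).
by rewrite -(prednK d0) exprSr -mulrA; apply: (idealMl hN).
Qed.

Lemma gr_sum : G (d * s)%N z'.
Proof.
by apply: (grD hG); [apply: (grX hG)|rewrite mulnC; apply: (grX hG)].
Qed.

Lemma sum_mul_congr : N (z' * f - f ^+ d.+1).
Proof. by rewrite mulrDl exprSr addrK -[f in z ^+ s * f]expr1; apply: zf'. Qed.

End Step.

(* Adding up orthogonal non-nilpotent elements of equal degree shrinks the
   annihilator until it lies in N. *)
Lemma ex_regular_mod : exists d z, [/\ (0 < d)%N, G d z &
  forall n x, (0 < n)%N -> G n x -> N (z * x) -> N x].
Proof.
have [|z [[d [d0 zd Sz]] zmin]] := @min_mu (fun z => exists d, [/\ (0 < d)%N, G d z & stable z]).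
  exists 0, 1%N; split=> //; first exact: gr0.
  by move=> j n x _ _; rewrite mul0r; apply: (ideal0 hN).
exists d, z; split=> // n a n0 an za; apply: contrapT => na.
have [t [x [xt nn]]] := ex_nonnilpotent n0 an na.
have eG : G (n + t)%N (a * x) by apply: (grM hG an xt).
have e0 : (0 < n + t)%N by rewrite addn_gt0 n0.
have [i Sf] := ex_stable_power e0 eG nn.
set f := (a * x) ^+ i.+1 in Sf.
have fs : G ((n + t) * i.+1)%N f by apply: (grX hG).
have s0 : (0 < (n + t) * i.+1)%N by rewrite muln_gt0 e0.
have zf : N (z * f) by rewrite /f exprS !mulrA; do 2 apply: (idealMr hN).
set s := ((n + t) * i.+1)%N in fs s0.
apply: (zmin (z ^+ s + f ^+ d)).
  exists (d * s)%N; split; first by rewrite muln_gt0 d0.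
    exact: gr_sum.
  exact: stable_sum.
(* The annihilator of the sum lies in that of [z] and misses [f]: the sum times [f] is congruent to
   [f ^+ d.+1], which is outside [N]. *)
apply: (mu_lt (s := (d * s + s)%N) (t := s) (y := f)) => //.
- move=> m y ym h; apply: (ann_sum d0 s0 Sz Sf zf (j := 0%N) ym _).1.
  by rewrite expr1.
- by rewrite addn_gt0 s0 orbT.
- by apply: (grM hG _ fs erefl); apply: gr_sum.
- move=> /(ideal_congr hN (sum_mul_congr d s0 zf)).
  by rewrite -exprM; apply: nn.
Qed.

End Semiprime.

(** * Bounded functions that are monotone along steps of length d *)

Section EventualPeriodicity.
Variables (h : nat -> nat) (d n0 C : nat).
Hypotheses (d0 : (0 < d)%N) (hC : forall n, (h n <= C)%N).

(* The sum of h over a window of length d is monotone and bounded. *)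
Lemma periodic_of_mono : (forall n, (n0 <= n)%N -> (h n <= h (n + d))%N) ->
  eventually_periodic h.
Proof.
move=> mono; pose W n := (\sum_(i < d) h (n + i))%N.
have WS n : (W n + h (n + d) = W n.+1 + h n)%N.
  rewrite /W -(big_mkord xpredT (fun i => h (n + i)%N)) -(big_mkord xpredT (fun i => h (n.+1 + i)%N)).
  rewrite -(big_nat_recr _ _ (fun i => h (n + i)%N)) //= big_nat_recl // addn0 addnC; congr (_ + _)%N.
  by apply: eq_bigr => i _; rewrite addSnnS.
have Wmono n m : (n0 <= n <= m)%N -> (W n <= W m)%N.
  move=> /andP[n0n /subnKC <-]; elim: (m - n)%N => [|j IH]; first by rewrite addn0.
  apply: leq_trans IH _; rewrite addnS -(leq_add2r (h (n + j))) -WS leq_add2l.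
  by apply: mono; apply: leq_trans n0n (leq_addr _ _).
pose P w := exists n, (n0 <= n)%N /\ W n = w.
have [||w [[n [n0n <-]] wmax]] := @ex_max_nat P (C * d).
- by exists (W n0), n0.
- move=> _ [n [_ <-]]; apply: (@leq_trans (\sum_(i < d) C)); first exact: leq_sum.
  by rewrite sum_nat_const card_ord mulnC.
have Wc m : (n <= m)%N -> W m = W n.
  move=> nm; apply/eqP; rewrite eqn_leq andbC Wmono ?n0n //=; apply: wmax.
  by exists m; split=> //; apply: leq_trans nm.
exists d, n.+1; split=> // m nm; have := WS m.
rewrite (Wc m) ?(Wc m.+1); [by move/addnI|by apply: ltnW; apply: ltnW|exact: ltnW].
Qed.

End EventualPeriodicity.

Lemma periodic_of_antimono (h : nat -> nat) d n0 C : (0 < d)%N ->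
  (forall n, (h n <= C)%N) -> (forall n, (n0 <= n)%N -> (h (n + d) <= h n)%N) ->
  eventually_periodic h.
Proof.
move=> d0 hC anti.
have [n|n n0n|e [N [e0 N0 per]]] := @periodic_of_mono (fun n => C - h n)%N d n0 C d0.
- by rewrite leq_subr.
- by apply: leq_sub2l; apply: anti.
exists e, N; split=> // n /per H; apply/eqP.
by rewrite -(eqn_add2l (C - h n)) {2}H !subnK.
Qed.

(** * Ascending chains of ideals *)

Section AscendingChains.
Context {A : nzRingType}.

Lemma acc_max (P Q : set A -> Prop) : acc P -> (forall I, Q I -> P I) ->
  (exists I, Q I) -> exists I, Q I /\ forall J, Q J -> I `<=` J -> J `<=` I.
Proof.
move=> accP QP [I0 QI0]; apply: contrapT => H.
have step (I : {I | Q I}) : exists J : {I | Q I}, sval I `<=` sval J /\ ~ sval J `<=` sval I.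
  case: I => I QI /=; apply: contrapT => h; apply: H; exists I; split=> // J QJ IJ.
  by apply: contrapT => nJI; apply: h; exists (exist _ J QJ).
have [f hf] := boolp.choice step.
pose chain n := iter n f (exist _ I0 QI0).
have [n hn] := accP (fun n => sval (chain n)) (fun n => QP _ (svalP (chain n)))
  (fun n => (hf (chain n)).1).
by apply: (hf (chain n)).2; rewrite (hn n.+1).
Qed.

Lemma two_sided_ideal_generated (S : set A) : two_sided_ideal (ideal_generated S).
Proof.
split; first split.
- by move=> I hI _; apply: (ideal0 hI).
- by move=> x y hx hy I hI SI; apply: (idealB hI); [apply: hx|apply: hy].
- by move=> x a hx I hI SI; apply: (idealMr hI); apply: hx.
- by move=> x a hx I hI SI; apply: (idealMl hI); apply: hx.
Qed.

Lemma noetherian_ideal_fg (I : set A) : two_sided_noetherian A -> two_sided_ideal I ->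
  exists X : seq A, (forall x, x \in X -> I x) /\
    forall J, two_sided_ideal J -> (forall x, x \in X -> J x) -> I `<=` J.
Proof.
move=> accA hI.
have [||J [[X [XI ->]] Jmax]] := @acc_max _ (fun J => exists X : seq A,
    (forall x, x \in X -> I x) /\ J = ideal_generated [set` X]) accA.
- by move=> J [X [_ ->]]; apply: two_sided_ideal_generated.
- by exists (ideal_generated [set` [::]]), [::].
exists X; split=> // J' hJ' XJ' x Ix.
suff : ideal_generated [set` X] x by apply.
apply: (Jmax (ideal_generated [set` x :: X])).
- exists (x :: X); split=> // y; rewrite inE => /orP[/eqP->|] //; exact: XI.
- move=> y hy K hK sub; apply: hy => // u /= uX; apply: sub => /=.
  by rewrite inE uX orbT.
- by move=> K hK sub; apply: sub; rewrite /= mem_head.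
Qed.

Lemma right_noetherian_two_sided : right_noetherian A -> two_sided_noetherian A.
Proof. by move=> accA I hI; apply: accA => n; case: (hI n). Qed.

Lemma prime_semiprime : prime_ring A -> semiprime_ring A.
Proof. by move=> pA I hI I2; case: (pA I I hI hI I2). Qed.

End AscendingChains.

Section RegularElement.
Context {k : fieldType} {A : algType k} {G : nat -> set A}.
Hypothesis hG : connected_graded G.
Variables (C D : nat).
Hypothesis hC : forall s, has_dim (G s) (dimk (G s)) /\ (dimk (G s) <= C)%N.
Hypothesis hD : forall n m a, (n <= m)%N -> G m a -> lspan [set x | exists i u v,
    [/\ (i < D)%N, (n + i <= m)%N, G (n + i)%N u, G (m - (n + i))%N v & x = u * v]] a.

Lemma semiprime_periodic : semiprime_ring A ->
  eventually_periodic (fun n => dimk (G n)).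
Proof.
move=> spA; have hN : two_sided_ideal [set (0 : A)].
  split; first split=> //.
  - by move=> x y /= -> ->; rewrite subr0.
  - by move=> x a /= ->; rewrite mul0r.
  - by move=> x a /= ->; rewrite mulr0.
have [|d [z [d0 zd zreg]]] := ex_regular_mod hG hC hD hN.
  move=> s b s0 bs hb.
  have {}hb x : b * x * b = 0.
    apply: (@gr_ind _ _ _ hG [set x | b * x * b = 0]); last exact: hb.
    split=> /= [|c u v hu hv]; first by rewrite mulr0 mul0r.
    by rewrite mulrDr mulrDl -scalerAr -scalerAl hu hv scaler0 addr0.
  (* An ideal of square zero containing [b] is described by annihilators, which avoids sums of
     products [x * b * y]: [J] is the left annihilator of [A * b], and the ideal consists of the
     elements of [J] that [J] kills from the left. *)
  pose J := [set x | forall c, x * c * b = 0].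
  have hJ : two_sided_ideal J.
    split; first split.
    - by move=> c; rewrite !mul0r.
    - by move=> x y hx hy c; rewrite !mulrBl hx hy subrr.
    - by move=> x a hx c; rewrite -[x * a * c]mulrA hx.
    - by move=> x a hx c; rewrite -!mulrA [x * _]mulrA hx mulr0.
  have hK : two_sided_ideal (J `&` [set y | forall x, J x -> x * y = 0]).
    have [[J0 JB JR] JL] := hJ; split; first split.
    - by split=> // x _; rewrite mulr0.
    - move=> x y [Jx hx] [Jy hy]; split; first exact: JB.
      by move=> u Ju; rewrite mulrBr hx // hy // subrr.
    - move=> x a [Jx hx]; split; first exact: JR.
      by move=> u Ju; rewrite mulrA hx // mul0r.
    - move=> x a [Jx hx]; split; first exact: JL.
      by move=> u Ju; rewrite mulrA hx //; apply: JR.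
  have K0 := spA _ hK (fun x y Kx Ky => Ky.2 x Kx.1).
  have : (J `&` [set y | forall x, J x -> x * y = 0]) b.
    by split=> // x Jx; have := Jx 1; rewrite mulr1.
  by rewrite K0.
apply: (@periodic_of_mono _ d 1 C d0) => [n|n n0]; first exact: (hC n).2.
have /has_dimP[e [Ge fe _]] := (hC n).1.
apply: (has_dim_free (hC (n + d)).1 (e := fun i => z * e i)).
  by move=> i; apply: (grM hG zd (Ge i)); rewrite addnC.
move=> c hc; apply: fe => /=; apply: (zreg _ _ n0).
  by apply: subspace_sum; [exact: gr_sub hG n|move=> i _; apply: (grZ hG)].
by rewrite /= mulr_sumr -[RHS]hc; apply: eq_bigr => i _; rewrite scalerAr.
Qed.

End RegularElement.

(** * Two-sided Noetherian algebras *)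

Section Bimodule.
Context {k : fieldType} {A : algType k} {G : nat -> set A}.
Hypothesis hG : connected_graded G.
Variables (C d m : nat) (z : A) (w : 'I_m -> A) (e : 'I_m -> nat).
Hypothesis hC : forall s, has_dim (G s) (dimk (G s)) /\ (dimk (G s) <= C)%N.
Hypotheses (d0 : (0 < d)%N) (zd : G d z) (we : forall j, G (e j) (w j)).
Hypothesis hspan : forall x,
  lspan [set y | exists a j b, y = z ^+ a * w j * z ^+ b] x.

(* The pair (j, b) stands in degree n for the element z^a w_j z^b, where
   a + b = (n - e j) / d. *)
Let T := ('I_m *l nat)%type.
Let top n (j : 'I_m) := ((n - e j) %/ d)%N.
Let valid n (p : T) : bool :=
  [&& (e p.1 <= n)%N, (d %| n - e p.1)%N & (p.2 <= top n p.1)%N].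
Let phi n (p : T) : A := z ^+ (top n p.1 - p.2) * w p.1 * z ^+ p.2.
Let L n : seq T := sort <=%O [seq p <- allpairs (fun j b => (j, b) : T) (enum 'I_m) (iota 0 n.+1) | valid n p].

Let mem_L n p : (p \in L n) = valid n p.
Proof.
rewrite mem_sort mem_filter; have [vp|//] := boolP (valid n p); rewrite andTb.
case: p vp => j b /and3P[_ _ hb].
apply: (allpairs_f (fun j b => (j, b) : T)); first by rewrite mem_enum.
rewrite mem_iota /= ltnS (leq_trans hb) //.
by rewrite (leq_trans (leq_div _ _)) ?leq_subr.
Qed.

Let uniq_L n : uniq (L n).
Proof.
rewrite sort_uniq filter_uniq // allpairs_uniq ?enum_uniq ?iota_uniq //.
by move=> [a b] [c f].
Qed.

Let topS n j : (e j <= n)%N -> top (n + d) j = (top n j).+1.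
Proof. by move=> h; rewrite /top -addnBAC // divnDr ?divnn ?d0 ?addn1 // dvdnn. Qed.

Let deg_phi n p : valid n p -> G n (phi n p).
Proof.
case: p => j b /and3P[/= h1 h2 h3].
apply: (grM hG (grM hG (grX hG _ zd) (we j) erefl) (grX hG _ zd)) => /=.
by rewrite addnAC -mulnDr subnK // mulnC divnK // subnK.
Qed.

Let GE n : G n = lspan [set phi n p | p in [set` L n]].
Proof.
apply/seteqP; split=> x; last first.
  apply: lspan_sub; first exact: gr_sub hG n.
  by move=> y [p /=]; rewrite mem_L => vp <-; apply: deg_phi.
move=> xn; rewrite -(gproj_id hG xn); set V := lspan _.
have sV : subspace V by apply: subspace_lspan.
apply: (lspan_sub (V := [set x | V (gproj hG n x)]) _ _ (hspan x)).
  split=> /= [|c u v hu hv]; first by rewrite linear0; apply: subspace0.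
  by rewrite linearP; case: sV => _; apply.
move=> _ [a [j [b ->]]] /=.
have h : G (d * a + e j + d * b)%N (z ^+ a * w j * z ^+ b).
  by apply: (grM hG (grM hG (grX hG _ zd) (we j) erefl) (grX hG _ zd)).
have [en|/eqP ne] := eqVneq n (d * a + e j + d * b)%N; last first.
  by rewrite (gproj0 hG ne h); apply: subspace0.
have h' : (n - e j = d * (a + b))%N by rewrite en mulnDr addnAC addnK.
have ht : top n j = (a + b)%N by rewrite /top h' mulKn.
rewrite gproj_id; last by rewrite en.
apply: sub_lspan; exists (j, b); last by rewrite /phi /= ht addnK.
by rewrite /= mem_L /valid /= ht h' dvdn_mulr // leq_addl en addnAC leq_addl.
Qed.

Let pivot n (p : T) : bool :=
  `[< ~ lspan [set phi n q | q in [set q | q \in L n /\ (q < p)%O]] (phi n p) >].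

Let P n := [seq p <- L n | pivot n p].

Let size_P n : size (P n) = dimk (G n).
Proof.
rewrite size_filter; apply/esym/dimkE; rewrite GE.
apply: (@pivot_dim _ _ T (<%O : rel T)); first by move=> ?; rewrite ltxx.
  by move=> ? ? ?; apply: lt_trans.
by rewrite sort_lt_sorted filter_uniq // allpairs_uniq ?enum_uniq ?iota_uniq // => -[a b] [c f].
Qed.

Let mem_P n p : (p \in P n) = valid n p && pivot n p.
Proof. by rewrite mem_filter mem_L andbC. Qed.

Let validS n j b : valid n (j, b) ->
  [/\ valid (n + d) (j, b), valid (n + d) (j, b.+1),
    phi (n + d) (j, b) = z * phi n (j, b) &
    phi (n + d) (j, b.+1) = phi n (j, b) * z].
Proof.
move=> /and3P[/= h1 h2 h3]; rewrite /valid /phi /= topS //.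
have -> : (e j <= n + d)%N by rewrite (leq_trans h1) // leq_addr.
rewrite -addnBAC // dvdn_addl ?dvdnn // h2 /= ltnS h3 (leqW h3); split=> //.
  by rewrite subSn // exprS !mulrA.
by rewrite subSS exprSr mulrA.
Qed.

(** Multiplication by [z] preserves the order of the spanning family; on the left it keeps the
    exponents [b], on the right it raises them by one. Hence a non-pivot of degree [n] yields
    non-pivots of degree [n + d] in both ways. *)
Let pivot_left n j b : valid n (j, b) -> pivot (n + d) (j, b) -> pivot n (j, b).
Proof.
move=> v /asboolP h; apply/asboolP => hn; apply: h.
have [_ _ -> _] := validS v; set V := lspan _.
have sV : subspace V by apply: subspace_lspan.
apply: (lspan_sub (V := [set x | V (z * x)]) _ _ hn).
  split=> /= [|c x y hx hy]; first by rewrite mulr0; apply: subspace0.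
  by rewrite mulrDr -scalerAr; case: sV => _; apply.
move=> y [[j' b'] [/=]]; rewrite mem_L => v' lt <-.
have [v2 _ <- _] := validS v'; apply: sub_lspan; exists (j', b') => //=.
by rewrite mem_L.
Qed.

Let pivot_right n j b : valid n (j, b) -> pivot (n + d) (j, b.+1) -> pivot n (j, b).
Proof.
move=> v /asboolP h; apply/asboolP => hn; apply: h.
have [_ _ _ ->] := validS v; set V := lspan _.
have sV : subspace V by apply: subspace_lspan.
apply: (lspan_sub (V := [set x | V (x * z)]) _ _ hn).
  split=> /= [|c x y hx hy]; first by rewrite mul0r; apply: subspace0.
  by rewrite mulrDl -scalerAl; case: sV => _; apply.
move=> y [[j' b'] [/=]]; rewrite mem_L => v' lt <-.
have [_ v2 _ <-] := validS v'; apply: sub_lspan; exists (j', b'.+1) => //=.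
by rewrite mem_L; split=> //; move: lt; rewrite !ltxi_pair /= !ltEnat /= ltnS.
Qed.

(* Once a generator w_j has a gap among its leading terms in degree n, its
   leading terms in degree n + d inject into those in degree n. *)
Lemma bimodule_periodic : eventually_periodic (fun n => dimk (G n)).
Proof.
(* From degree [n0] on, a generator of degree congruent to [n] modulo [d] has more than [C]
   candidates, so they cannot all be pivots. *)
pose n0 := (\max_j e j + d * C)%N.
apply: (@periodic_of_antimono _ d n0 C d0) => [n|n n0n]; first exact: (hC n).2.
have le j : (e j <= n)%N.
  by rewrite (leq_trans _ n0n) // (leq_trans _ (leq_addr _ _)) // leq_bigmax.
have big j : (C <= top n j)%N.
  rewrite /top leq_divRL // leq_subRL // mulnC (leq_trans _ n0n) // leq_add2r.
  exact: leq_bigmax.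
have gap j : exists b, (d %| n - e j)%N -> (b <= top n j)%N /\ ~~ pivot n (j, b).
  apply: contrapT => H; have {}H b : (d %| n - e j)%N /\ ((b <= top n j)%N -> pivot n (j, b)).
    apply: contrapT => h; apply: H; exists b => dv; apply: contrapT => h'.
    apply: h; split=> // hb; apply: contraT => np; case: h'; split=> //.
  have dv := (H 0%N).1; have : (C < size (P n))%N; last first.
    by rewrite size_P ltnNge (hC n).2.
  pose s : seq T := [seq (j, b) | b <- iota 0 (top n j).+1].
  apply: (@leq_trans (size s)); first by rewrite size_map size_iota ltnS.
  apply: uniq_leq_size; first by rewrite map_inj_uniq ?iota_uniq // => a b [].
  move=> p /mapP[b]; rewrite mem_iota /= add0n ltnS => hb ->.
  by rewrite mem_P /valid /= le dv hb (H b).2.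
have {gap} [g hg] := boolp.choice gap.
(* Since [g j] is not a pivot in degree [n], neither [g j] nor [(g j).+1] is one in degree [n + d].
   Lowering the exponents above this double gap by one is therefore injective. *)
rewrite -!size_P; pose f (p : T) : T := (p.1, if (p.2 < g p.1)%N then p.2 else p.2.-1).
have key p : p \in P (n + d) -> [/\ f p \in P n, p.2 != g p.1 & p.2 != (g p.1).+1].
  case: p => j b; rewrite !mem_P => /andP[vp pp].
  have dv : (d %| n - e j)%N.
    by case/and3P: vp => _ /=; rewrite -addnBAC // dvdn_addl // dvdnn.
  have bt : (b <= (top n j).+1)%N by case/and3P: vp => _ _ /=; rewrite topS.
  have [gt /negP ng] := hg j dv.
  have vn c : (c <= top n j)%N -> valid n (j, c) by rewrite /valid /= le dv => ->.
  have n1 : b != g j.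
    by apply/eqP => bg; apply: ng; rewrite -bg in gt *; apply: pivot_left pp; apply: vn.
  have n2 : b != (g j).+1.
    by apply/eqP => bg; apply: ng; rewrite bg in pp; apply: pivot_right pp; apply: vn.
  split=> //; rewrite /f /=; case: ltnP => bg.
    have h : valid n (j, b) by apply: vn; apply: ltnW (leq_trans bg gt).
    by rewrite h (pivot_left h).
  case: b vp pp bt n1 n2 bg => [|b] vp pp bt n1 n2 bg /=.
    by move: n1; rewrite eq_sym -leqn0 bg.
  by rewrite (vn b) // (pivot_right _ pp) // vn.
rewrite -(size_map f); apply: uniq_leq_size.
  rewrite map_inj_in_uniq ?filter_uniq ?uniq_L // => -[j b] [j' b'] h h' [ej eb].
  have [_ /= n1 n2] := key _ h; have [_ /= n1' n2'] := key _ h'.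
  rewrite -ej in n1' n2' eb *; congr (_, _); move: eb n1 n2 n1' n2'.
  by move: (g j) => c; clear; case: (ltnP b c); case: (ltnP b' c); lia.
by move=> _ /mapP[p hp ->]; case: (key _ hp).
Qed.

End Bimodule.

(** * Normal elements modulo an ideal *)

Section ModN.
Context {k : fieldType} {A : algType k} {G : nat -> set A}.
Hypothesis hG : connected_graded G.
Variables (C D : nat) (N : set A).
Hypothesis hC : forall s, has_dim (G s) (dimk (G s)) /\ (dimk (G s) <= C)%N.
Hypothesis hD : forall n m a, (n <= m)%N -> G m a -> lspan [set x | exists i u v,
    [/\ (i < D)%N, (n + i <= m)%N, G (n + i)%N u, G (m - (n + i))%N v & x = u * v]] a.
Hypothesis hN : two_sided_ideal N.
Hypothesis hsp : forall s b, (0 < s)%N -> G s b ->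
  (forall t x, G t x -> N (b * x * b)) -> N b.

Let sN := ideal_subspace hN.

Lemma ex_dim_mod : exists g : nat -> nat, (forall n, (g n <= C)%N) /\
  forall n, exists e : 'I_(g n) -> A,
    [/\ forall i, G n (e i), freemod N e & forall x, G n x -> spanmod N e x].
Proof.
have /boolp.choice[g hg] n : exists m, exists e : 'I_m -> A,
    [/\ forall i, G n (e i), freemod N e & forall x, G n x -> spanmod N e x].
  apply: (@max_freemod _ _ _ _ (dimk (G n))) => // m e Ge fe.
  apply: (has_dim_free (hC n).1 Ge); apply: freemodS fe => _ ->.
  exact: ideal0.
exists g; split=> // n; have [e [Ge fe _]] := hg n.
apply: leq_trans (hC n).2; apply: (has_dim_free (hC n).1 Ge).
by apply: freemodS fe => _ ->; apply: ideal0.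
Qed.

Lemma injective_mod (f : {linear A -> A}) n m p q (e : 'I_p -> A) (e' : 'I_q -> A) :
  (forall x, G n x -> G m (f x)) -> (forall x, G n x -> N (f x) -> N x) ->
  (forall i, G n (e i)) -> freemod N e -> (forall x, G m x -> spanmod N e' x) ->
  (p <= q)%N /\ (p = q -> forall y, G m y -> exists x, G n x /\ N (y - f x)).
Proof.
move=> Gf fN Ge fe se'.
have fsum (c : 'I_p -> k) : f (\sum_(i < p) c i *: e i) = \sum_(i < p) c i *: f (e i).
  by rewrite linear_sum; apply: eq_bigr => i _; rewrite linearZ.
have Gsum (c : 'I_p -> k) : G n (\sum_(i < p) c i *: e i).
  by apply: subspace_sum; [exact: gr_sub hG n|move=> i _; apply: (grZ hG)].
have ffe : freemod N (fun i => f (e i)).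
  move=> c; rewrite -fsum => /fN h; apply: fe; apply: h; exact: Gsum.
split; first by apply: (freemod_le sN ffe) => i; apply/se'/Gf.
move=> pq y Gy; apply: contrapT => H.
have fsn : freemod N (snoc (fun i => f (e i)) y).
  apply: snoc_free => // -[c hc]; apply: H.
  by exists (\sum_(i < p) c i *: e i); rewrite fsum.
suff : (p < q)%N by rewrite pq ltnn.
apply: (freemod_le sN fsn) => i; apply: se'; rewrite /snoc.
by case: (unlift _ _) => // j; apply: Gf.
Qed.

(** Left multiplication by a regular [z] is injective modulo [N]. Once the bounded dimensions of the
    pieces of [A / N] stop growing along steps of [d], it is surjective as well, and this in turn
    gives the injectivity of right multiplication. *)
Lemma ex_normal_mod : exists d z n1, [/\ (0 < d)%N, G d z &
  forall n y, (n1 <= n)%N -> G (n + d)%N y ->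
    (exists x, G n x /\ N (y - z * x)) /\ (exists x, G n x /\ N (y - x * z))].
Proof.
have [d [z [d0 zd zreg]]] := ex_regular_mod hG hC hD hN hsp.
have [g [gC he]] := ex_dim_mod.
pose Lz : {linear A -> A} := HB.pack ( *%R z) (GRing.isLinear.Build _ _ _ _ ( *%R z)
  (fun c x y => etrans (mulrDr _ _ _) (congr1 (fun t => t + _) (esym (scalerAr _ _ _))))).
pose Rz : {linear A -> A} := HB.pack (fun x => x * z) (GRing.isLinear.Build _ _ _ _ (fun x => x * z)
  (fun c x y => etrans (mulrDl _ _ _) (congr1 (fun t => t + _) (esym (scalerAl _ _ _))))).
have LG n x : G n x -> G (n + d)%N (Lz x).
  by move=> xn; apply: (grM hG zd xn); rewrite addnC.
have RG n x : G n x -> G (n + d)%N (Rz x) by move=> xn; apply: (grM hG xn zd).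
have gmono n : (1 <= n)%N -> (g n <= g (n + d))%N.
  move=> n0; have [e [Ge fe _]] := he n; have [e' [_ _ se']] := he (n + d)%N.
  exact: (injective_mod (LG n) (fun x => zreg n x n0) Ge fe se').1.
have [d' [n1 [d'0 _ per]]] := periodic_of_mono d0 gC gmono.
(* Along steps of [d] the dimensions increase from [n] to [n + d * d'], and the period [d'] makes
   the two end values equal. *)
have geq n : (n1 <= n)%N -> (0 < n)%N -> g (n + d)%N = g n.
  move=> n1n n0; apply/eqP; rewrite eqn_leq gmono // andbT.
  have mono j : (g (n + d) <= g (n + d * j.+1))%N.
    elim: j => [|j IH]; first by rewrite muln1.
    apply: leq_trans IH _; rewrite [(d * j.+2)%N]mulnS [(d + _)%N]addnC addnA.
    by apply: gmono; rewrite addn_gt0 n0.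
  have perj j : g (n + d' * j)%N = g n.
    elim: j => [|j IH]; first by rewrite muln0 addn0.
    by rewrite mulnS [(d' + _)%N]addnC addnA -per // (leq_trans n1n) // leq_addr.
  by have := mono d'.-1; rewrite prednK // mulnC perj.
have left n y : (n1.+1 <= n)%N -> G (n + d)%N y -> exists x, G n x /\ N (y - z * x).
  move=> n1n; have n0 : (0 < n)%N by apply: leq_ltn_trans n1n.
  have [e [Ge fe _]] := he n; have [e' [_ _ se']] := he (n + d)%N.
  apply: (injective_mod (LG n) (fun x => zreg n x n0) Ge fe se').2.
  by rewrite geq // ltnW.
exists d, z, n1.+1; split=> // n y n1n yG; split; first exact: left.
have n0 : (0 < n)%N by apply: leq_ltn_trans n1n.
have [e [Ge fe _]] := he n; have [e' [_ _ se']] := he (n + d)%N.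
apply: (injective_mod (RG n) _ Ge fe se').2 yG; last by rewrite geq // ltnW.
(* Every [v] of large degree is congruent to some [z * u], so [x * z] in [N] would put [x * v] in
   [N], against [window_hit]. *)
move=> x xn /= xz; apply: contrapT => nx.
have [i [v [_ vG nv]]] := window_hit hG hD hN hsp (n1.+1 + d) n0 xn nx.
apply: nv; rewrite addnAC in vG.
have [u [uG vu]] := left _ _ (leq_addr _ _) vG.
rewrite -[v](subrK (z * u)) mulrDr mulrA; apply: (idealD hN).
  exact: idealMl.
exact: idealMr.
Qed.

End ModN.

(** * The graded nilpotent radical and its powers *)

Section NilpotentRadical.
Context {k : fieldType} {A : algType k} {G : nat -> set A}.
Hypothesis hG : connected_graded G.
Hypothesis accA : two_sided_noetherian A.

Definition nilpotent_ideal (N : set A) : Prop := exists q, forall w : seq A,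
  (forall x, x \in w -> N x) -> size w = q -> \prod_(x <- w) x = 0.

Lemma nilpotent_of_square (K N : set A) : (forall x y, K x -> K y -> N (x * y)) ->
  nilpotent_ideal N -> nilpotent_ideal K.
Proof.
move=> KN [q hq]; exists q.*2 => w wK sw.
suff [w' [w'N sw' ->]] : exists w' : seq A, [/\ forall x, x \in w' -> N x,
    size w' = q & \prod_(x <- w) x = \prod_(x <- w') x] by apply: hq.
elim: q w wK sw {hq} => [|q IH] [|x [|y w]] //= wK sw; first by exists [::].
have [||w' [h1 h2 h3]] := IH w; first by move=> u uw; apply: wK; rewrite !inE uw !orbT.
  by case: sw.
exists (x * y :: w'); split=> /=; last by rewrite !big_cons h3 mulrA.
  by move=> u; rewrite inE => /orP[/eqP->|/h1 //]; apply: KN; apply: wK; rewrite !inE eqxx ?orbT.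
by rewrite h2.
Qed.

(** The chain condition gives a maximal homogeneous nilpotent ideal [N]. If [b * A * b] lies in [N],
    then [b] lies in a homogeneous ideal [K] whose square is in [N]; as [K] is again nilpotent, it
    is contained in [N]. *)
Lemma ex_graded_radical : exists N, [/\ two_sided_ideal N, nilpotent_ideal N &
  forall s b, (0 < s)%N -> G s b -> (forall t x, G t x -> N (b * x * b)) -> N b].
Proof.
pose Q I := [/\ two_sided_ideal I, nilpotent_ideal I &
  forall s x, I x -> I (gproj hG s x)].
have [||N [[hN nN homN] Nmax]] := @acc_max _ _ Q accA.
- by move=> I [].
- exists [set 0]; split; last by move=> s x ->; rewrite linear0.
    split; first split=> //.
    + by move=> x y /= -> ->; rewrite subr0.
    + by move=> x a /= ->; rewrite mul0r.
    + by move=> x a /= ->; rewrite mulr0.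
  exists 1%N => -[|x [|]] // w _; rewrite big_seq1; apply: w.
  exact: mem_head.
exists N; split=> // s b s0 bs hb.
have sN := ideal_subspace hN.
have {}hb x : N (b * x * b).
  apply: (@gr_ind _ _ _ hG [set x | N (b * x * b)]); last exact: hb.
  split=> /= [|c u v hu hv]; first by rewrite mulr0 mul0r; apply: (ideal0 hN).
  by rewrite mulrDr mulrDl -scalerAr -scalerAl; case: sN => _; apply.
pose J := [set x | forall c, N (x * c * b)].
have hJ : two_sided_ideal J.
  split; first split.
  - by move=> c; rewrite !mul0r; apply: (ideal0 hN).
  - by move=> x y hx hy c; rewrite !mulrBl; apply: (idealB hN).
  - by move=> x a hx c; rewrite -[x * a * c]mulrA; apply: hx.
  - by move=> x a hx c; rewrite -!mulrA [x * _]mulrA; apply: (idealMl hN).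
have NJ : N `<=` J by move=> x Nx c; do 2 apply: (idealMr hN).
have homJ u x : J x -> J (gproj hG u x).
  move=> Jx; apply: (@gr_ind _ _ _ hG [set c | N (gproj hG u x * c * b)]).
    split=> /= [|c y v hu hv]; first by rewrite mulr0 mul0r; apply: (ideal0 hN).
    by rewrite mulrDr mulrDl -scalerAr -scalerAl; case: sN => _; apply.
  move=> t c ct /=; rewrite -(gproj_mulr hG _ _ ct) -(gproj_mulr hG _ _ bs).
  exact: homN.
pose K := J `&` [set y | forall x, J x -> N (x * y)].
have NK : N `<=` K.
  by move=> x Nx; split; [exact: NJ|move=> y _; apply: (idealMl hN)].
have Kb : K b.
  by split=> // x Jx; have := Jx 1; rewrite mulr1.
apply: (Nmax K) => //; split.
- have [[J0 JB JR] JL] := hJ; split; first split.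
  + by apply/NK/(ideal0 hN).
  + move=> x y [Jx hx] [Jy hy]; split; first exact: JB.
    by move=> u Ju; rewrite mulrBr; apply: (idealB hN); [apply: hx|apply: hy].
  + move=> x a [Jx hx]; split; first exact: JR.
    by move=> u Ju; rewrite mulrA; apply: (idealMr hN); apply: hx.
  + move=> x a [Jx hx]; split; first exact: JL.
    by move=> u Ju; rewrite mulrA; apply: hx; apply: JR.
- by apply: nilpotent_of_square nN => x y [Jx _] [_ hy]; apply: hy.
- move=> u y [Jy hy]; split; first exact: homJ.
  move=> x Jx; have [n /(_ n (leqnn n)) ->] := gproj_sum hG x.
  rewrite mulr_suml; apply: subspace_sum => // i _.
  rewrite -(gproj_mull hG _ _ (gprojG hG i x)); apply: homN; apply: hy.
  exact: homJ.
Qed.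

(* The powers of N, in a form convenient for multiplication on both sides. *)
Definition ideal_power (N : set A) i : set A :=
  lspan [set \prod_(x <- w) x | w in [set w : seq A | (i <= count (fun x => `[< N x >]) w)%N]].

Section Powers.
Variable N : set A.
Hypothesis hN : two_sided_ideal N.

Lemma sub_ideal_power i : subspace (ideal_power N i).
Proof. exact: subspace_lspan. Qed.

Lemma ideal_power0 x : ideal_power N 0 x.
Proof. by apply: sub_lspan; exists [:: x] => //; rewrite big_seq1. Qed.

Lemma ideal_powerMl i j a x : (j <= i + `[< N a >])%N -> ideal_power N i x ->
  ideal_power N j (a * x).
Proof.
move=> ji; apply: (lspan_sub (V := [set x | ideal_power N j (a * x)])).
  split=> /= [|c u v hu hv]; first by rewrite mulr0; apply: subspace0 (sub_ideal_power j).
  by rewrite mulrDr -scalerAr; case: (sub_ideal_power j) => _; apply.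
move=> _ [w /= hw <-]; apply: sub_lspan; exists (a :: w); last by rewrite big_cons.
by rewrite /= addnC (leq_trans ji) // leq_add2r.
Qed.

Lemma ideal_powerMr i j a x : (j <= i + `[< N a >])%N -> ideal_power N i x ->
  ideal_power N j (x * a).
Proof.
move=> ji; apply: (lspan_sub (V := [set x | ideal_power N j (x * a)])).
  split=> /= [|c u v hu hv]; first by rewrite mul0r; apply: subspace0 (sub_ideal_power j).
  by rewrite mulrDl -scalerAl; case: (sub_ideal_power j) => _; apply.
move=> _ [w /= hw <-]; apply: sub_lspan; exists (rcons w a); last by rewrite big_rcons.
by rewrite /= -cats1 count_cat /= addn0 (leq_trans ji) // leq_add2r.
Qed.

Lemma ideal_power_ideal i : two_sided_ideal (ideal_power N i).
Proof.
split; first split.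
- exact: subspace0 (sub_ideal_power i).
- by move=> x y; apply: subspaceB (sub_ideal_power i).
- by move=> x a; apply: ideal_powerMr; apply: leq_addr.
- by move=> x a; apply: ideal_powerMl; apply: leq_addr.
Qed.

(** Letters outside [N] are absorbed into the next letter from [N], which leaves a product of at
    least [q] elements of [N] times a remainder. *)
Lemma ideal_power_nil : nilpotent_ideal N -> exists q, forall x, ideal_power N q x -> x = 0.
Proof.
move=> [q hq]; exists q; apply: lspan_sub; first exact: subspace_set0.
move=> _ [w /= cw <-].
have [w' [a [Nw' sw' ->]]] : exists (w' : seq A) a, [/\ forall x, x \in w' -> N x,
    size w' = count (fun x => `[< N x >]) w & \prod_(x <- w) x = \prod_(x <- w') x * a].
  elim: w {cw} => [|x w [w' [a [Nw' sw' e]]]].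
    by exists [::], 1; rewrite !big_nil mulr1.
  rewrite big_cons e /=; case: asboolP => [Nx|nx].
    exists (x :: w'), a; rewrite /= big_cons mulrA sw'; split=> // y.
    by rewrite inE => /orP[/eqP->|/Nw'].
  case: w' Nw' sw' {e} => [|y w'] Nw' sw'.
    by exists [::], (x * a); rewrite !big_nil !mul1r.
  exists (x * y :: w'), a; rewrite !big_cons !mulrA; split=> // u.
  rewrite inE => /orP[/eqP->|uw]; last by apply: Nw'; rewrite inE uw orbT.
  by apply: (idealMl hN); apply: Nw'; apply: mem_head.
rewrite -(cat_take_drop q w') big_cat /= hq ?mul0r //.
  by move=> x /mem_take/Nw'.
by rewrite size_takel // sw'.
Qed.

End Powers.

Variables (C D : nat).
Hypothesis hC : forall s, has_dim (G s) (dimk (G s)) /\ (dimk (G s) <= C)%N.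
Hypothesis hD : forall n m a, (n <= m)%N -> G m a -> lspan [set x | exists i u v,
    [/\ (i < D)%N, (n + i <= m)%N, G (n + i)%N u, G (m - (n + i))%N v & x = u * v]] a.

Lemma ex_gr_list n : exists V : seq A, 1 \in V /\ forall i x, (i < n)%N -> G i x ->
  lspan [set` V] x.
Proof.
elim: n => [|n [V [V1 hV]]]; first by exists [:: 1]; rewrite mem_head.
have /has_dimP[e [Ge _ se]] := (hC n).1; exists (V ++ codom e).
rewrite mem_cat V1; split=> // i x; rewrite ltnS leq_eqVlt => /orP[/eqP->|lt] xi.
  have /spanmod0[c ->] := se _ xi; apply: lspan_comb => j /=.
  by rewrite mem_cat codom_f orbT.
by apply: lspanS (hV _ _ lt xi) => y /= yV; rewrite mem_cat yV.
Qed.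

(** Modulo [N] the algebra is spanned by the [z ^+ a * v], and also by the [v * z ^+ b], with [v] in
    a finite list [V]. If a finite [X] generates the power N^i as an ideal, the products of the
    three kinds, with [X] in the middle, span N^i modulo N^(i+1). The powers of [N] reach 0 after
    finitely many steps. *)
Lemma noetherian_span : exists d z (W : seq A), [/\ (0 < d)%N, G d z &
  forall x, lspan [set y | exists a w b, w \in W /\ y = z ^+ a * w * z ^+ b] x].
Proof.
have [N [hN nN hsp]] := ex_graded_radical; have sN := ideal_subspace hN.
have [d [z [n1 [d0 zd hz]]]] := ex_normal_mod hG hC hD hN hsp.
have [V [V1 hV]] := ex_gr_list (n1 + d).
pose SL := lspan [set y | exists a v, v \in V /\ y = z ^+ a * v].
pose SR := lspan [set y | exists v b, v \in V /\ y = v * z ^+ b].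
have sSL : subspace SL by apply: subspace_lspan.
have sSR : subspace SR by apply: subspace_lspan.
have modS (S P : set A) : subspace S -> subspace P ->
    subspace [set x | exists b, S b /\ P (x - b)].
  move=> sS sP; split; first by exists 0; rewrite subr0; split; apply: subspace0.
  move=> c x y [b [Sb hb]] [b' [Sb' hb']]; exists (c *: b + b'); split.
    by case: sS => _; apply.
  by rewrite opprD addrACA -scalerBr; case: sP => _; apply.
have spanL x : exists b, SL b /\ N (x - b).
  apply: (gr_ind hG (modS _ _ sSL sN)) => n; elim/ltn_ind: n => n IH y yn.
  have [lt|le] := ltnP n (n1 + d).
    exists y; rewrite subrr; split; last exact: ideal0.
    apply: lspanS (hV _ _ lt yn) => v /= vV; exists 0%N, v.
    by rewrite expr0 mul1r.
  have dn : (d <= n)%N by apply: leq_trans le; rewrite leq_addl.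
  have [||[u [un hu]] _] := hz (n - d)%N y; [by rewrite leq_subRL // addnC|by rewrite subnK|].
  have [|b [Sb hb]] := IH (n - d)%N _ u un; first by rewrite ltn_subrL d0 (leq_trans d0).
  exists (z * b); split; last first.
    rewrite -(subrK (z * u) y) -addrA -mulrBr; apply: (idealD hN) => //.
    exact: idealMl.
  apply: (lspan_sub (V := [set b | SL (z * b)]) _ _ Sb).
    split=> /= [|c x1 x2 h1 h2]; first by rewrite mulr0; apply: subspace0.
    by rewrite mulrDr -scalerAr; case: sSL => _; apply.
  move=> _ [a [v [vV ->]]]; apply: sub_lspan; exists a.+1, v.
  by rewrite mulrA exprS.
have spanR x : exists b, SR b /\ N (x - b).
  apply: (gr_ind hG (modS _ _ sSR sN)) => n; elim/ltn_ind: n => n IH y yn.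
  have [lt|le] := ltnP n (n1 + d).
    exists y; rewrite subrr; split; last exact: ideal0.
    apply: lspanS (hV _ _ lt yn) => v /= vV; exists v, 0%N.
    by rewrite expr0 mulr1.
  have dn : (d <= n)%N by apply: leq_trans le; rewrite leq_addl.
  have [||_ [u [un hu]]] := hz (n - d)%N y; [by rewrite leq_subRL // addnC|by rewrite subnK|].
  have [|b [Sb hb]] := IH (n - d)%N _ u un; first by rewrite ltn_subrL d0 (leq_trans d0).
  exists (b * z); split; last first.
    rewrite -(subrK (u * z) y) -addrA -mulrBl; apply: (idealD hN) => //.
    exact: idealMr.
  apply: (lspan_sub (V := [set b | SR (b * z)]) _ _ Sb).
    split=> /= [|c x1 x2 h1 h2]; first by rewrite mul0r; apply: subspace0.
    by rewrite mulrDl -scalerAl; case: sSR => _; apply.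
  move=> _ [v [b' [vV ->]]]; apply: sub_lspan; exists v, b'.+1.
  by rewrite -mulrA exprSr.
pose S (W : seq A) := lspan [set y | exists a w b, w \in W /\ y = z ^+ a * w * z ^+ b].
have sS W : subspace (S W) by apply: subspace_lspan.
have step i : exists W, forall x, ideal_power N i x -> exists b, S W b /\ ideal_power N i.+1 (x - b).
  have [X [XI XJ]] := noetherian_ideal_fg accA (ideal_power_ideal N i).
  pose W := [seq u * v' | u <- [seq v * x | v <- V, x <- X], v' <- V].
  have inW v x v' a b : v \in V -> x \in X -> v' \in V -> S W (z ^+ a * v * x * v' * z ^+ b).
    move=> vV xX v'V; apply: sub_lspan; exists a, (v * x * v'), b; split.
      by do 2 apply: allpairs_f => //.
    by rewrite !mulrA.
  have sP := sub_ideal_power N i.+1.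
  pose J := [set x | exists b, S W b /\ ideal_power N i.+1 (x - b)].
  have sJ : subspace J := modS _ _ (sS W) sP.
  have PJ x : ideal_power N i.+1 x -> J x.
    by move=> Px; exists 0; rewrite subr0; split=> //; apply: subspace0 (sS W).
  have SJ x : S W x -> J x.
    by move=> Sx; exists x; rewrite subrr; split=> //; apply: subspace0 sP.
  have Psucc a x : N a -> ideal_power N i x -> ideal_power N i.+1 (a * x) /\ ideal_power N i.+1 (x * a).
    move=> Na Px; have le : (i.+1 <= i + `[< N a >])%N by rewrite asboolT // addn1.
    by split; [apply: ideal_powerMl Px|apply: ideal_powerMr Px].
  have PI := ideal_power_ideal N i.+1.
  have JL x a : J x -> J (a * x).
    move=> [b [Sb hb]]; rewrite -(subrK b x) mulrDr; apply: subspaceD => //.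
      by apply: PJ; apply: (idealMl PI).
    apply: (lspan_sub (V := [set b | J (a * b)]) _ _ Sb).
      split=> /= [|c x1 x2 h1 h2]; first by rewrite mulr0; apply: subspace0.
      by rewrite mulrDr -scalerAr; case: sJ => _; apply.
    move=> _ [p [_ [q [/allpairsP[[_ v'] [/= /allpairsP[[v y] [/= vV yX ->]] v'V ->]] ->]]]] /=.
    (* Replacing the left factor by its representative [c] changes the product by an element of the
       next power of [N]. *)
    have [c [SLc hc]] := spanL (a * z ^+ p * v).
    have -> : a * (z ^+ p * (v * y * v') * z ^+ q) =
        (a * z ^+ p * v - c) * y * v' * z ^+ q + c * (y * v' * z ^+ q).
      by rewrite !mulrBl !mulrA subrK.
    apply: subspaceD => //.
      apply: PJ; do 2 apply: (idealMr PI); exact: (Psucc _ _ hc (XI _ yX)).1.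
    apply: SJ; apply: (lspan_sub (V := [set c | S W (c * (y * v' * z ^+ q))]) _ _ SLc).
      split=> /= [|e x1 x2 h1 h2]; first by rewrite mul0r; apply: subspace0 (sS W).
      by rewrite mulrDl -scalerAl; case: (sS W) => _; apply.
    by move=> _ [p' [v'' [v''V ->]]] /=; rewrite !mulrA; apply: inW.
  have JR x a : J x -> J (x * a).
    move=> [b [Sb hb]]; rewrite -(subrK b x) mulrDl; apply: subspaceD => //.
      by apply: PJ; apply: (idealMr PI).
    apply: (lspan_sub (V := [set b | J (b * a)]) _ _ Sb).
      split=> /= [|c x1 x2 h1 h2]; first by rewrite mul0r; apply: subspace0.
      by rewrite mulrDl -scalerAl; case: sJ => _; apply.
    move=> _ [p [_ [q [/allpairsP[[_ v'] [/= /allpairsP[[v y] [/= vV yX ->]] v'V ->]] ->]]]] /=.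
    have [c [SRc hc]] := spanR (v' * z ^+ q * a).
    have -> : z ^+ p * (v * y * v') * z ^+ q * a =
        z ^+ p * v * (y * (v' * z ^+ q * a - c)) + z ^+ p * v * y * c.
      by rewrite !mulrBr !mulrA subrK.
    apply: subspaceD => //.
      by apply: PJ; apply: (idealMl PI); exact: (Psucc _ _ hc (XI _ yX)).2.
    apply: SJ; apply: (lspan_sub (V := [set c | S W (z ^+ p * v * y * c)]) _ _ SRc).
      split=> /= [|e x1 x2 h1 h2]; first by rewrite mulr0; apply: subspace0 (sS W).
      by rewrite mulrDr -scalerAr; case: (sS W) => _; apply.
    by move=> _ [v'' [p' [v''V ->]]] /=; rewrite !mulrA; apply: inW.
  exists W; apply: (XJ J); last first.
    move=> x xX; apply: SJ; have := inW 1 x 1 0%N 0%N V1 xX V1.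
    by rewrite !expr0 !mulr1 !mul1r.
  split; first split.
  - exact: subspace0.
  - by move=> x y; apply: subspaceB.
  - by move=> x a; apply: JR.
  - by move=> x a; apply: JL.
have [q hq] := ideal_power_nil hN nN.
suff [W hW] : exists W, forall x, exists b, S W b /\ ideal_power N q (x - b).
  exists d, z, W; split=> // x; have [b [Sb /hq/eqP]] := hW x.
  by rewrite subr_eq0 => /eqP ->.
elim: (q) => [|i [W hW]].
  exists [::] => x; exists 0; split; first exact: subspace0 (sS _).
  exact: ideal_power0.
have [W' hW'] := step i; exists (W ++ W') => x.
have [b [Sb hb]] := hW x; have [b' [Sb' hb']] := hW' _ hb.
exists (b + b'); rewrite opprD addrA; split=> //; apply: subspaceD; first exact: sS.
  by apply: lspanS Sb => _ [a [w [c [ww ->]]]]; exists a, w, c; rewrite mem_cat ww.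
by apply: lspanS Sb' => _ [a [w [c [ww ->]]]]; exists a, w, c; rewrite mem_cat ww orbT.
Qed.

Lemma noetherian_periodic : eventually_periodic (fun n => dimk (G n)).
Proof.
have [d [z [W [d0 zd hW]]]] := noetherian_span.
(* The elements of [W] need not be homogeneous; their components become the generators w_j. *)
have [B hB] := gproj_bound hG (fun i : 'I_(size W) => W`_i).
pose I := ('I_(size W) * 'I_B)%type.
pose w (j : 'I_#|{: I}|) := gproj hG (enum_val j).2 W`_((enum_val j).1).
apply: (bimodule_periodic hG (w := w) (e := fun j => (enum_val j).2) hC d0 zd).
  by move=> j; apply: gprojG.
move=> x; apply: (lspan_sub _ _ (hW x)) => [|_ [a [u [b [uW ->]]]]].
  exact: subspace_lspan.
have lt : (index u W < size W)%N by rewrite index_mem.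
have := hB (Ordinal lt) B (leqnn _); rewrite /= nth_index // => ->.
rewrite mulr_sumr mulr_suml; apply: subspace_sum; first exact: subspace_lspan.
move=> s _; apply: sub_lspan; exists a, (enum_rank (Ordinal lt, s) : 'I_#|{: I}|), b.
by rewrite /w enum_rankK /= nth_index.
Qed.

End NilpotentRadical.

(** * Irreducible families of points and constancy of ranks *)

Section HilbertBasis.

Lemma acc_le (R : nzRingType) (I : nat -> set R) n m :
  (forall n, I n `<=` I n.+1) -> (n <= m)%N -> I n `<=` I m.
Proof.
move=> h /subnKC <-; elim: (m - n)%N => [|j IH]; first by rewrite addn0.
by rewrite addnS => x /IH /h.
Qed.

Variable R : comNzRingType.

Let lc (I : set {poly R}) d : set R :=
  [set a | exists p, [/\ I p, (size p <= d.+1)%N & p`_d = a]].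

(** The leading coefficient ideals [lc (I n) d] increase in [n] and in [d]. The diagonal sequence
    settles all [d >= N] at once, and each of the finitely many smaller [d] is settled by its own
    chain. *)
Lemma hilbert_basis : right_noetherian R -> right_noetherian {poly R}.
Proof.
move=> nR I hI IS.
have lcI (J : set {poly R}) d : right_ideal J -> right_ideal (lc J d).
  move=> [J0 JB JM]; split.
  - by exists 0; rewrite size_poly0 coef0.
  - move=> _ _ [p [Jp sp <-]] [q [Jq sq <-]]; exists (p - q); split; first exact: JB.
      by rewrite (leq_trans (size_polyD _ _)) // size_polyN geq_max sp.
    by rewrite coefB.
  - move=> _ a [p [Jp sp <-]]; exists (p * a%:P); split; first exact: JM.
      by rewrite mulrC mul_polyC (leq_trans (size_scale_leq _ _)).
    by rewrite coefMC.
have lcS (J : set {poly R}) d : right_ideal J -> lc J d `<=` lc J d.+1.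
  move=> [_ _ JM] _ [p [Jp sp <-]]; exists (p * 'X); split; first exact: JM.
    by rewrite (leq_trans (size_polyMleq _ _)) // size_polyX addn2.
  by rewrite coefMX.
have lcmono n m d e : (n <= m)%N -> (d <= e)%N -> lc (I n) d `<=` lc (I m) e.
  move=> nm de x hx; have : lc (I m) d x.
    case: hx => p [Ip sp <-]; exists p; split=> //.
    exact: (acc_le IS nm).
  by move: x {hx}; apply: (acc_le (I := lc (I m))) de => j; apply: lcS.
have [N hN] := nR (fun n => lc (I n) n) (fun n => lcI _ n (hI n))
  (fun n => lcmono _ _ _ _ (leqnSn n) (leqnSn n)).
have /boolp.choice[M hM] d := nR (fun n => lc (I n) d) (fun n => lcI _ d (hI n))
  (fun n => lcmono _ _ _ _ (leqnSn n) (leqnn d)).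
pose N' := maxn N (\max_(d < N) M d).
have key n d : (N' <= n)%N -> lc (I n) d `<=` lc (I N') d.
  move=> N'n; have [dN|Nd] := ltnP d N.
    have h : (M d <= N')%N.
      by rewrite leq_max (leq_bigmax (F := fun i : 'I_N => M i) (Ordinal dN)) orbT.
    by rewrite (hM d n) ?(hM d N') // (leq_trans h).
  have Nn : (N <= n)%N by apply: leq_trans N'n; rewrite leq_maxl.
  move=> x /(lcmono _ (maxn n d) _ (maxn n d) (leq_maxl _ _) (leq_maxr _ _)).
  rewrite hN; last by rewrite leq_max Nn.
  by apply: lcmono => //; apply: leq_maxl.
exists N' => n N'n; apply/seteqP; split; last exact: acc_le.
suff h s (p : {poly R}) : (size p <= s)%N -> I n p -> I N' p by move=> p; apply: (h (size p)).
elim: s p => [|d IH] p sp Ip.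
  by move: sp; rewrite leqn0 size_poly_eq0 => /eqP ->; case: (hI N').
have [q [Iq sq e]] : lc (I N') d p`_d by apply: (key n) => //; exists p.
have [_ IB _] := hI n; have [_ IB' IM'] := hI N'.
have I0 : I N' 0 by case: (hI N').
rewrite -[p](subrK q) -[q in _ + q]opprK; apply: (IB'); last first.
  by rewrite -[- q]sub0r; apply: IB'.
apply: IH; last by apply: IB => //; apply: (acc_le IS N'n).
apply/leq_sizeP => j; rewrite leq_eqVlt => /orP[/eqP<-|dj]; rewrite coefB ?e ?subrr //.
by rewrite !nth_default ?subr0 // (leq_trans _ dj).
Qed.

End HilbertBasis.

Lemma field_noetherian (k : fieldType) : right_noetherian k.
Proof.
move=> I hI IS; have [[N [x [Ix x0]]]|h] := pselect (exists N x, I N x /\ x != 0).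
  have IT n : (N <= n)%N -> I n = setT.
    move=> Nn; apply/seteqP; split=> // y _; have [_ _ IM] := hI n.
    by rewrite -(mulVKf x0 y); apply: IM; apply: acc_le Nn _ Ix.
  by exists N => n Nn; rewrite !IT.
have I0 n : I n = [set 0].
  apply/seteqP; split=> [x Ix /=|x ->]; last by case: (hI n).
  by apply: contrapT => /eqP x0; apply: h; exists n, x.
by exists 0%N => n _; rewrite !I0.
Qed.

(* Every finitely generated algebra of functions from nat to k is a quotient
   of a noetherian ring. *)
Lemma ex_noetherian_functions (k : fieldType) N (x : 'I_N -> nat -> k) :
  exists (S : comNzRingType) (ev : nat -> {rmorphism S -> k}) (X : 'I_N -> S) (c : k -> S),
  [/\ right_noetherian S, forall i n, ev n (X i) = x i n & forall a n, ev n (c a) = a].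
Proof.
elim: N x => [|N IH] x.
  exists k, (fun=> idfun), (fun=> 0), id; split=> //; last by case.
  exact: field_noetherian.
have [S [ev [X [c [nS hX hc]]]]] := IH (fun i => x (lift ord_max i)).
exists {poly S}, (fun n => horner_eval (x ord_max n) \o map_poly (ev n)).
exists (fun i => if unlift ord_max i is Some j then (X j)%:P else 'X), (fun a => (c a)%:P).
split=> [|i n|a n] /=; first exact: hilbert_basis.
  case: (unliftP ord_max i) => [j ->|->].
    by rewrite /horner_eval map_polyC hornerC /= hX.
  by rewrite /horner_eval map_polyX hornerX.
by rewrite /horner_eval map_polyC hornerC /= hc.
Qed.

Definition unbounded (T : set nat) : Prop := forall m, exists n, (m <= n)%N /\ T n.

Section Irreducible.
Context {S : comNzRingType} {k : fieldType} (ev : nat -> {rmorphism S -> k}).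

(** Irreducibility of the Zariski closure of the points indexed by [T], stated through the functions
    coming from [S]. *)
Definition irreducible_family (T : set nat) : Prop := forall f g,
  (forall n, T n -> ev n (f * g) = 0) ->
  (forall n, T n -> ev n f = 0) \/ (forall n, T n -> ev n g = 0).

(** Among the unbounded subsets, take one with a maximal vanishing ideal. If [f * g] vanishes on it,
    the zeros of [f] and of [g] cover it, and one of these parts is unbounded; by maximality its
    vanishing ideal is no larger. *)
Lemma ex_irreducible (T0 : set nat) : right_noetherian S -> unbounded T0 ->
  exists T, [/\ T `<=` T0, unbounded T & irreducible_family T].
Proof.
move=> nS uT0; pose van (T : set nat) := [set f | forall n, T n -> ev n f = 0].
have [||I [[T [TT0 uT ->]] Imax]] := @acc_max _ _ (fun I => exists T,
    [/\ T `<=` T0, unbounded T & I = van T]) nS.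
- move=> _ [T [_ _ ->]]; split=> [n _|x y hx hy n Tn|x a hx n Tn].
  + exact: rmorph0.
  + by rewrite rmorphB hx // hy // subrr.
  + by rewrite rmorphM hx // mul0r.
- by exists (van T0), T0; split.
exists T; split=> // f g fg.
have sub h : unbounded (T `&` [set n | ev n h = 0]) -> forall n, T n -> ev n h = 0.
  move=> u; apply: (Imax (van (T `&` [set n | ev n h = 0]))).
  - by exists (T `&` [set n | ev n h = 0]); split=> // n [/TT0].
  - by move=> h' hh' n [/hh'].
  - by move=> n [].
apply: contrapT => /not_orP[nf ng].
have /existsNP[m1 h1] : ~ unbounded (T `&` [set n | ev n f = 0]) by move=> /sub.
have /existsNP[m2 h2] : ~ unbounded (T `&` [set n | ev n g = 0]) by move=> /sub.
have [n [mn Tn]] := uT (maxn m1 m2); move: mn; rewrite geq_max => /andP[m1n m2n].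
have := fg n Tn; rewrite rmorphM => /eqP; rewrite mulf_eq0 => /orP[/eqP e|/eqP e].
  by apply: h1; exists n.
by apply: h2; exists n.
Qed.

End Irreducible.

Section Minors.
Context {k : fieldType}.

Lemma row_free_minor r b (M : 'M[k]_(r, b)) : row_free M ->
  exists fc : 'I_r -> 'I_b, \det (colsub fc M) != 0.
Proof.
move=> fM; have e : \rank M^T = r by rewrite mxrank_tr; apply/eqP.
move: (maxrankfun M^T) (maxrowsub_free M^T); rewrite e => f ff; exists f.
by rewrite -det_tr trmx_mxsub -unitfE -unitmxE -row_free_unit.
Qed.

Lemma ex_minor a b (M : 'M[k]_(a, b)) :
  exists (fr : 'I_(\rank M) -> 'I_a) (fc : 'I_(\rank M) -> 'I_b), \det (mxsub fr fc M) != 0.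
Proof.
have [fc hfc] := row_free_minor (maxrowsub_free M).
by exists (maxrankfun M), fc; rewrite -mxsub_comp in hfc.
Qed.

Lemma minor_rank a b r (M : 'M[k]_(a, b)) (fr : 'I_r -> 'I_a) (fc : 'I_r -> 'I_b) :
  \det (mxsub fr fc M) != 0 -> (r <= \rank M)%N.
Proof.
rewrite -unitfE -unitmxE -row_free_unit => /eqP <-.
have -> : mxsub fr fc M = rowsub fr (colsub fc M) by rewrite -mxsub_comp.
apply: leq_trans (mxrankS (rowsub_sub _ _)) _.
by rewrite -mxrank_tr trmx_mxsub -[X in (_ <= X)%N]mxrank_tr mxrankS // rowsub_sub.
Qed.

End Minors.

(* Both ranks are lower semicontinuous along the family, so a constant sum
   forces each of them to be constant. *)
Lemma rank_constant (S : comNzRingType) (k : fieldType) (ev : nat -> {rmorphism S -> k})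
  (T : set nat) a b c r (D0 : 'M[S]_(a, b)) (D1 : 'M[S]_(b, c)) :
  irreducible_family ev T ->
  (forall n, T n -> (\rank (map_mx (ev n) D0) + \rank (map_mx (ev n) D1) = r)%N) ->
  forall n m, T n -> T m -> \rank (map_mx (ev n) D0) = \rank (map_mx (ev m) D0).
Proof.
move=> irr sum n m Tn Tm.
have gen a' b' (D : 'M[S]_(a', b')) : exists r' f, [/\ exists n, T n /\ ev n f != 0,
    forall n, T n -> (\rank (map_mx (ev n) D) <= r')%N &
    forall n, ev n f != 0 -> (r' <= \rank (map_mx (ev n) D))%N].
  have [||r' [[n0 [Tn0 <-]] rmax]] :=
      @ex_max_nat (fun r => exists n, T n /\ \rank (map_mx (ev n) D) = r) a'.
  - by exists (\rank (map_mx (ev n) D)), n.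
  - by move=> _ [n' [_ <-]]; apply: rank_leq_row.
  have [fr [fc h]] := ex_minor (map_mx (ev n0) D).
  exists (\rank (map_mx (ev n0) D)), (\det (mxsub fr fc D)).
  have e n' : ev n' (\det (mxsub fr fc D)) = \det (mxsub fr fc (map_mx (ev n') D)).
    by rewrite -map_mxsub det_map_mx.
  split=> [|n' Tn'|n']; first by exists n0; rewrite e.
    by apply: rmax; exists n'.
  by rewrite e => /minor_rank.
have [r0 [f [[nf [Tnf hf]] le0 ge0]]] := gen _ _ D0.
have [r1 [g [[ng [Tng hg]] le1 ge1]]] := gen _ _ D1.
(* At [p] both chosen minors are nonzero, so both ranks take their maximal values there; as the sum
   is constant, neither can drop elsewhere. *)
have [p [Tp hp]] : exists p, T p /\ ev p (f * g) != 0.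
  apply: contrapT => h; have [p Tp|h0|h0] := irr f g.
  - by apply: contrapT => /eqP ne; apply: h; exists p.
  - by move: hf; rewrite h0 // eqxx.
  - by move: hg; rewrite h0 // eqxx.
move: hp; rewrite rmorphM mulf_eq0 negb_or => /andP[/ge0 pf /ge1 pg].
have rE q : T q -> \rank (map_mx (ev q) D0) = r0.
  move=> Tq; have := sum _ Tq; have := sum _ Tp; have := le0 _ Tq; have := le1 _ Tq.
  by move: pf pg; do 4 move: (\rank _); clear; lia.
by rewrite !rE.
Qed.

(** * Vanishing of Ext^2 and Ext^3 in large degrees *)

Section Functionals.
Context {k : fieldType} {M : lmodType k}.

(** A predicate on plain functions, because the cochains below are pieced together by case
    distinctions on degrees. *)
Definition lin1 (f : M -> k) : Prop := forall c x y, f (c *: x + y) = c * f x + f y.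

Lemma lin1_0 f : lin1 f -> f 0 = 0.
Proof. by move=> lf; have /eqP := lf 1 0 0; rewrite scaler0 addr0 mul1r -subr_eq subrr eq_sym => /eqP. Qed.

Lemma lin1D f x y : lin1 f -> f (x + y) = f x + f y.
Proof. by move=> lf; have := lf 1 x y; rewrite scale1r mul1r. Qed.

Lemma lin1Z f c x : lin1 f -> f (c *: x) = c * f x.
Proof. by move=> lf; have := lf c x 0; rewrite !addr0 (lin1_0 lf) addr0. Qed.

Lemma lin1N f x : lin1 f -> f (- x) = - f x.
Proof. by move=> lf; rewrite -scaleN1r lin1Z // mulN1r. Qed.

Lemma lin1B f x y : lin1 f -> f (x - y) = f x - f y.
Proof. by move=> lf; rewrite lin1D // lin1N. Qed.

Lemma lin1_sum f (I : Type) (r : seq I) (P : pred I) (F : I -> M) : lin1 f ->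
  f (\sum_(i <- r | P i) F i) = \sum_(i <- r | P i) f (F i).
Proof. by move=> lf; apply: big_morph => [x y|]; [apply: lin1D|apply: lin1_0]. Qed.

Lemma lin1_cst0 : lin1 (fun=> 0).
Proof. by move=> c x y; rewrite mulr0 addr0. Qed.

Lemma lin1_add f g : lin1 f -> lin1 g -> lin1 (fun x => f x + g x).
Proof. by move=> hf hg c x y; rewrite hf hg mulrDr addrACA. Qed.

Lemma lin1_opp f : lin1 f -> lin1 (fun x => - f x).
Proof. by move=> hf c x y; rewrite hf opprD mulrN. Qed.

Lemma lin1_scale f a : lin1 f -> lin1 (fun x => a * f x).
Proof. by move=> hf c x y; rewrite hf mulrDr mulrCA. Qed.

Lemma lin1_scaler f a : lin1 f -> lin1 (fun x => f x * a).
Proof. by move=> hf c x y; rewrite hf mulrDl mulrA. Qed.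

Lemma lin1_bigsum (I : Type) (r : seq I) (P : pred I) (f : I -> M -> k) :
  (forall i, lin1 (f i)) -> lin1 (fun x => \sum_(i <- r | P i) f i x).
Proof.
move=> hf c x y; rewrite mulr_sumr -big_split; apply: eq_bigr => i _.
exact: hf.
Qed.

End Functionals.

Definition bilin {k : fieldType} {M M' : lmodType k} (f : M -> M' -> k) : Prop :=
  (forall b, lin1 (f^~ b)) /\ (forall a, lin1 (f a)).

Definition trilin {k : fieldType} {M : lmodType k} (f : M -> M -> M -> k) : Prop :=
  (forall c, bilin (fun a b => f a b c)) /\ (forall a b, lin1 (f a b)).

Section Coordinates.
Context {k : fieldType} {A : lmodType k}.

(** The coordinate functionals are extended to the whole space by [lin_ext] and padded with 0 beyond
    the dimension, so that one index set ['I_C] can serve all degrees. *)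
Lemma ex_coord (V : set A) n : has_dim V n -> exists (e : nat -> A) (co : nat -> A -> k),
  [/\ forall p, V (e p) \/ e p = 0, forall p, lin1 (co p),
   (forall p, (n <= p)%N -> e p = 0) /\ (forall p x, (n <= p)%N -> co p x = 0),
   forall p q, co p (e q) = ((p == q) && (q < n)%N)%:R &
   forall C x, (n <= C)%N -> V x -> x = \sum_(p < C) co p x *: e p].
Proof.
move=> /has_dimP[e [Ve fe se]].
pose U (p : nat) : set (A * k^o) := [set z | exists c : 'I_n -> k,
  z.1 = \sum_(i < n) c i *: e i /\ z.2 = if insub p is Some i then c i else 0].
have /boolp.choice[co hco] p : exists f : {linear A -> k^o}, forall m c, U p (m, c) -> f m = c.
  apply: lin_ext.
    split=> [|c x y [cx [x1 x2]] [cy [y1 y2]]].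
      exists (fun=> 0); rewrite /= big1; first by case: insub.
      by move=> i _; rewrite scale0r.
    exists (fun i => c * cx i + cy i); rewrite /= x1 x2 y1 y2; split.
      rewrite scaler_sumr -big_split; apply: eq_bigr => i _.
      by rewrite scalerDl scalerA.
    by case: insub => //; rewrite scaler0 addr0.
  move=> c [d [/= d0 ->]]; case: insub => // i; apply: fe.
  by rewrite -d0.
have coE p (c : 'I_n -> k) : co p (\sum_(i < n) c i *: e i) =
    if insub p is Some i then c i else 0 by apply: hco; exists c.
exists (fun p => if insub p is Some i then e i else 0), (fun p x => if (p < n)%N then co p x else 0).
split.
- by move=> p; case: insub => [i|]; [left|right].
- move=> p; case: (p < n)%N; last exact: lin1_cst0.
  by move=> c x y; rewrite linearP.
- split=> p; first by move=> np; rewrite insubF // ltnNge np.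
  by move=> x np; rewrite ltnNge np.
- move=> p q; have [pn|np] := ltnP p n; last first.
    by case: eqP => [<-|//]; rewrite ltnNge np.
  case: insubP => [i qn iq|]; last first.
    by rewrite -leqNgt => nq; rewrite linear0 ltnNge nq andbF.
  have -> : e i = \sum_(j < n) (j == i)%:R *: e j.
    rewrite (bigD1 i) //= eqxx scale1r big1 ?addr0 // => j /negPf ->.
    by rewrite scale0r.
  by rewrite coE insubT -val_eqE /= iq qn andbT.
- move=> C x nC Vx; have /spanmod0[c xE] := se _ Vx.
  rewrite -(subnKC nC) big_split_ord /= [X in _ + X]big1 ?addr0; last first.
    by move=> i _; rewrite ltnNge leq_addr scale0r.
  rewrite {1}xE; apply: eq_bigr => i _; rewrite ltn_ord xE coE.
  have -> : insub (i : nat) = Some i by apply: valK.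
  by [].
Qed.

End Coordinates.

Section Ext.
Context {k : fieldType} {A : algType k} (G : nat -> set A).

(* ext2_from 1 t and ext3_from 1 t are the vanishing of Ext^2_A(k, k) and
   Ext^3_A(k, k) in internal degree t, in terms of multilinear cochains on the
   positive part; for general n they are the vanishing of Ext^1_A(M, k) and
   Ext^2_A(M, k) for the right module M = A_n + A_(n+1) + ... *)
Definition ext2_from n t : Prop := forall f : nat -> A -> A -> k,
  (forall s, bilin (f s)) ->
  (forall s u v a b c, (n <= s)%N -> (0 < u)%N -> (0 < v)%N -> (s + u + v = t)%N ->
    G s a -> G u b -> G v c -> f (s + u)%N (a * b) c = f s a (b * c)) ->
  exists g : A -> k, lin1 g /\ forall s u a b, (n <= s)%N -> (0 < u)%N -> (s + u = t)%N ->
    G s a -> G u b -> f s a b = g (a * b).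

Definition ext3_from n t : Prop := forall f : nat -> nat -> A -> A -> A -> k,
  (forall s u, trilin (f s u)) ->
  (forall s u v w a b c d, (n <= s)%N -> (0 < u)%N -> (0 < v)%N -> (0 < w)%N ->
    (s + u + v + w = t)%N -> G s a -> G u b -> G v c -> G w d ->
    f (s + u)%N v (a * b) c d - f s (u + v)%N a (b * c) d + f s u a b (c * d) = 0) ->
  exists g : nat -> A -> A -> k, (forall s, bilin (g s)) /\
   forall s u v a b c, (n <= s)%N -> (0 < u)%N -> (0 < v)%N -> (s + u + v = t)%N ->
    G s a -> G u b -> G v c -> f s u a b c = g (s + u)%N (a * b) c - g s a (b * c).

End Ext.

(** * Cocycles on the truncations of A *)

Section Windows.
Context {k : fieldType} {A : algType k} {G : nat -> set A}.
Hypothesis hG : connected_graded G.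
Variables (C : nat) (e : nat -> nat -> A) (co : nat -> nat -> A -> k).
Hypothesis eG : forall s p, G s (e s p).
Hypothesis lco : forall s p, lin1 (co s p).
Hypothesis coE : forall s a, G s a -> a = \sum_(p < C) co s p a *: e s p.

Lemma lin1_coE s a (f : A -> k) : lin1 f -> G s a -> f a = \sum_(p < C) co s p a * f (e s p).
Proof.
move=> lf /coE aE; rewrite {1}aE lin1_sum //; apply: eq_bigr => p _.
exact: lin1Z.
Qed.

Let lin1_mulr (f : A -> k) b : lin1 f -> lin1 (fun a => f (a * b)).
Proof. by move=> lf c x y; rewrite mulrDl -scalerAl lf. Qed.

Let lin1_mull (f : A -> k) b : lin1 f -> lin1 (fun a => f (b * a)).
Proof. by move=> lf c x y; rewrite mulrDr -scalerAr lf. Qed.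

(** The long exact sequence of 0 -> M_(n+1) -> M_n -> A_n -> 0, where A_n is a sum of copies of k in
    degree n: Ext^1 of M_(n+1) lies between Ext^1 of M_n and Ext^2 of these copies. Concretely, [f]
    is continued to [s = n] by one functional [g p] per basis element of A_n. *)
Lemma ext2_fromS n t : (n <= t)%N -> ext2_from G 1 (t - n) -> ext2_from G n t ->
  ext2_from G n.+1 t.
Proof.
move=> nt E2 En f bf fc.
have /boolp.choice[g hg] p : exists g : A -> k, lin1 g /\ forall u v b c, (0 < u)%N ->
    (0 < v)%N -> (u + v = t - n)%N -> G u b -> G v c -> f (n + u)%N (e n p * b) c = g (b * c).
  have [|u v w b c d|g [lg hg]] := E2 (fun u b c => f (n + u)%N (e n p * b) c).
  - move=> u; split=> b; first by apply: (lin1_mull (f := (f (n + u)%N)^~ b)); apply: (bf _).1.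
    exact: (bf _).2.
  - move=> u0 v0 w0 uvw bu cv dw; rewrite mulrA addnA.
    apply: fc (grM hG (eG n p) bu erefl) cv dw => //.
      by rewrite -{1}[n]addn0 ltn_add2l.
    by rewrite -addnA -addnA [(u + _)%N]addnA uvw subnKC.
  - by exists g; split.
pose f' s a b := if s == n then \sum_(p < C) co n p a * g p b else f s a b.
have [||q [lq hq]] := En f'.
- move=> s; rewrite /f'; split=> b; case: eqP => _.
  + by apply: lin1_bigsum => p; apply: lin1_scaler.
  + exact: (bf _).1.
  + by apply: lin1_bigsum => p; apply: lin1_scale; apply: (hg p).1.
  + exact: (bf _).2.
- move=> s u v a b c ns u0 v0 suv sa ub vc.
  have -> : f' (s + u)%N (a * b) c = f (s + u)%N (a * b) c.
    by rewrite /f' ifF //; apply/eqP; move: ns u0; clear; lia.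
  rewrite /f'; case: eqP => [sn|/eqP sn]; last first.
    by apply: (fc s u v) => //; rewrite ltn_neqAle eq_sym sn.
  rewrite sn in sa suv *.
  rewrite (lin1_coE (f := fun a => f (n + u)%N (a * b) c) _ sa).
    apply: eq_bigr => p _; congr (_ * _); apply: (hg p).2 ub vc => //.
    by rewrite -suv -addnA addKn.
  by apply: (lin1_mulr (f := (f (n + u)%N)^~ c)); apply: (bf _).1.
- exists q; split=> // s u a b ns u0 su sa ub; rewrite -(hq s u) //; last exact: ltnW.
  by rewrite /f' ifF //; apply/eqP; move: ns; clear; lia.
Qed.

(** The same shift one cohomological degree higher, with bilinear [g p]. *)
Lemma ext3_fromS n t : (n <= t)%N -> ext3_from G 1 (t - n) -> ext3_from G n t ->
  ext3_from G n.+1 t.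
Proof.
move=> nt E3 En f bf fc.
have /boolp.choice[g hg] p : exists g : nat -> A -> A -> k, (forall u, bilin (g u)) /\
    forall u v w b c d, (0 < u)%N -> (0 < v)%N -> (0 < w)%N -> (u + v + w = t - n)%N ->
    G u b -> G v c -> G w d ->
    f (n + u)%N v (e n p * b) c d = g (u + v)%N (b * c) d - g u b (c * d).
  have [|u v w x b c d y|g [lg hg]] := E3 (fun u v b c d => f (n + u)%N v (e n p * b) c d).
  - move=> u v; split=> [d|b c]; last exact: (bf _ _).2.
    split=> b; last exact: ((bf _ _).1 d).2.
    by apply: (lin1_mull (f := fun a => f _ _ a b d)); apply: ((bf _ _).1 d).1.
  - move=> u0 v0 w0 x0 sum bu cv dw yx; rewrite mulrA addnA.
    apply: fc (grM hG (eG n p) bu erefl) cv dw yx => //.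
      by rewrite -{1}[n]addn0 ltn_add2l.
    by move: sum nt; clear; lia.
  - by exists g; split.
pose f' s u a b c := if s == n then \sum_(p < C) co n p a * g p u b c else f s u a b c.
have [||q [lq hq]] := En f'.
- move=> s u; rewrite /f'; case: eqP => _; last exact: bf.
  split=> [c|a b].
    split=> b; first by apply: lin1_bigsum => p; apply: lin1_scaler.
    by apply: lin1_bigsum => p; apply: lin1_scale; apply: ((hg p).1 u).1.
  by apply: lin1_bigsum => p; apply: lin1_scale; apply: ((hg p).1 u).2.
- move=> s u v w a b c d ns u0 v0 w0 sum sa ub vc wd.
  have -> : f' (s + u)%N v (a * b) c d = f (s + u)%N v (a * b) c d.
    by rewrite /f' ifF //; apply/eqP; move: ns u0; clear; lia.
  rewrite /f'; case: eqP => [sn|/eqP sn]; last first.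
    by apply: (fc s u v w) => //; rewrite ltn_neqAle eq_sym sn.
  rewrite sn in sa sum *.
  rewrite (lin1_coE (f := fun a => f (n + u)%N v (a * b) c d) _ sa); last first.
    by apply: (lin1_mulr (f := fun a => f _ _ a c d)); apply: ((bf _ _).1 d).1.
  rewrite -sumrB -big_split /= big1 // => p _; rewrite -mulrBr -mulrDr.
  rewrite ((hg p).2 _ _ w) //; first by rewrite [_ - _ - _]addrAC subrr sub0r addNr mulr0.
  by move: sum; clear; lia.
- exists q; split=> // s u v a b c ns u0 v0 suv sa ub vc; rewrite -(hq s u v) //; last exact: ltnW.
  by rewrite /f' ifF //; apply/eqP; move: ns; clear; lia.
Qed.

Variable D0 : nat.
Hypothesis E2 : forall t, (D0 <= t)%N -> ext2_from G 1 t.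

Lemma ext2_large n t : (0 < n)%N -> (n + D0 <= t)%N -> ext2_from G n t.
Proof.
case: n => // n _; elim: n => [|n IH] h.
  by apply: E2; apply: leq_trans h; apply: leq_addl.
have h' : (n.+1 + D0 <= t)%N by apply: leq_trans h; rewrite leq_add2r.
apply: ext2_fromS; last exact: IH.
  by apply: leq_trans h'; apply: leq_addr.
by apply: E2; rewrite leq_subRL //; apply: leq_trans h'; apply: leq_addr.
Qed.

(* The presentation of A_n + A_(n+1) + ... by generators of degree < T and the
   multiplication table up to degree T, with values in degree t. *)
Lemma window2 n T t (g : nat -> A -> A -> k) : (0 < n)%N -> (n + D0 <= T)%N ->
  (forall s, bilin (g s)) ->
  (forall s u a b c, (n <= s)%N -> (0 < u)%N -> (s + u < T)%N -> (s + u <= t)%N ->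
    G s a -> G u b -> G (t - (s + u))%N c -> g (s + u)%N (a * b) c = g s a (b * c)) ->
  exists p, lin1 p /\ forall s a c, (n <= s)%N -> (s < T)%N -> (s <= t)%N ->
    G s a -> G (t - s)%N c -> g s a c = p (a * c).
Proof.
move=> n0; move mE : (t.+1 - T)%N => m; elim: m T mE g => [|m IH] T mE g nT bg gc.
  have tT : (t < T)%N by rewrite -subn_eq0 mE.
  (* If [T] exceeds [t], every degree is available and the functional is read off at [c = 1]. *)
  exists (fun x => g t x 1); split; first exact: (bg _).1.
  move=> s a c ns sT st sa; have [->|/eqP lt] := eqVneq s t.
    rewrite subnn (graded_connected hG) => -[x _ <-].
    by rewrite -[a * _]scalerAr mulr1 (lin1Z _ _ ((bg t).1 _)) (lin1Z _ _ ((bg t).2 _)).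
  move=> ct; have e1 : (s + (t - s) = t)%N by rewrite subnKC.
  rewrite -{1}[c]mulr1 -(gc s (t - s)%N a c 1) ?e1 //.
    by rewrite subn_gt0 ltn_neqAle st andbT; apply/eqP.
  by rewrite subnn; apply: gr1.
have Tt : (T <= t)%N by move: mE; clear; lia.
(* With a basis element of degree [t - T] as right factor, [g] becomes a cocycle of degree [T] on
   M_n. The functionals [h q] bounding it continue [g] to generators of degree [T]. *)
have /boolp.choice[h hh] q : exists h : A -> k, lin1 h /\ forall s u a b, (n <= s)%N ->
    (0 < u)%N -> (s + u = T)%N -> G s a -> G u b -> g s a (b * e (t - T)%N q) = h (a * b).
  have [|s u v a b c|h [lh hh]] := ext2_large n0 nT (f := fun s a b => g s a (b * e (t - T)%N q)).
  - move=> s; split=> b; first exact: (bg _).1.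
    by apply: lin1_mulr; apply: (bg _).2.
  - move=> ns u0 v0 suv sa ub vc; rewrite -[b * c * _]mulrA; apply: gc => //.
    + by rewrite -suv -{1}[(s + u)%N]addn0 ltn_add2l.
    + by rewrite (leq_trans _ Tt) // -suv leq_addr.
    + by apply: (grM hG vc (eG _ _)); rewrite -suv in Tt *; move: Tt; clear; lia.
  - by exists h.
pose g' s a c := if s == T then \sum_(q < C) co (t - T)%N q c * h q a else g s a c.
have mE' : (t.+1 - T.+1 = m)%N by move: mE; clear; lia.
have [||p [lp hp]] := IH T.+1 mE' g' (leqW nT).
- move=> s; rewrite /g'; case: eqP => _; last exact: bg.
  split=> a; first by apply: lin1_bigsum => q; apply: lin1_scale; apply: (hh q).1.
  by apply: lin1_bigsum => q; apply: lin1_scaler.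
- move=> s u a b c ns u0 suT sut sa ub ct.
  have -> : g' s a (b * c) = g s a (b * c).
    by rewrite /g' ifF //; apply/eqP; move: suT u0; clear; lia.
  rewrite /g'; case: eqP => [e1|/eqP ne]; last first.
    by apply: (gc s u) => //; rewrite ltn_neqAle ne.
  rewrite e1 in ct; rewrite (lin1_coE (f := fun c => g s a (b * c)) _ ct); last first.
    by apply: lin1_mull; apply: (bg _).2.
  by apply: eq_bigr => q _; rewrite -((hh q).2 s u).
- exists p; split=> // s a c ns sT st sa cs; rewrite -(hp s) //; last exact: leqW.
  by rewrite /g' ifF //; apply/eqP; move: sT; clear; lia.
Qed.

Hypothesis E3 : forall t, (D0 <= t)%N -> ext3_from G 1 t.

Lemma ext3_large n t : (0 < n)%N -> (n + D0 <= t)%N -> ext3_from G n t.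
Proof.
case: n => // n _; elim: n => [|n IH] h.
  by apply: E3; apply: leq_trans h; apply: leq_addl.
have h' : (n.+1 + D0 <= t)%N by apply: leq_trans h; rewrite leq_add2r.
apply: ext3_fromS; last exact: IH.
  by apply: leq_trans h'; apply: leq_addr.
by apply: E3; rewrite leq_subRL //; apply: leq_trans h'; apply: leq_addr.
Qed.

(** The counterpart of [window2] one step to the left in the resolution: [T] is raised by bounding
    the cocycles of degree [T] that arise from a basis element in the last factor. *)
Lemma window3 n T t (f : nat -> nat -> A -> A -> A -> k) : (0 < n)%N -> (n + D0 <= T)%N ->
  (forall s u, trilin (f s u)) ->
  (forall s u v a b c d, (n <= s)%N -> (0 < u)%N -> (0 < v)%N -> (s + u + v < T)%N ->
    (s + u + v <= t)%N -> G s a -> G u b -> G v c -> G (t - (s + u + v))%N d ->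
    f (s + u)%N v (a * b) c d - f s (u + v)%N a (b * c) d + f s u a b (c * d) = 0) ->
  exists g : nat -> A -> A -> k, (forall s, bilin (g s)) /\
   forall s u a b c, (n <= s)%N -> (0 < u)%N -> (s + u < T)%N -> (s + u <= t)%N ->
    G s a -> G u b -> G (t - (s + u))%N c -> f s u a b c = g (s + u)%N (a * b) c - g s a (b * c).
Proof.
move=> n0; move mE : (t.+1 - T)%N => m; elim: m T mE f => [|m IH] T mE f nT bf fc.
  have tT : (t < T)%N by rewrite -subn_eq0 mE.
  (* Once all degrees up to [t] are available, inserting 1 in the last slot is a contracting
     homotopy. *)
  exists (fun s a c => if (s < t)%N then - f s (t - s)%N a c 1 else 0); split.
    move=> s; split=> a /=; case: (s < t)%N; try exact: lin1_cst0; apply: lin1_opp.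
      exact: ((bf _ _).1 _).1.
    exact: ((bf _ _).1 _).2.
  move=> s u a b c ns u0 suT sut sa ub.
  have st : (s < t)%N by apply: leq_trans sut; rewrite -{1}[s]addn0 ltn_add2l.
  rewrite st opprK; case: ltnP => lt; last first.
    have e1 : (s + u = t)%N by apply/eqP; rewrite eqn_leq sut.
    rewrite e1 subnn (graded_connected hG) => -[x _ <-].
    rewrite -[b * _]scalerAr mulr1 -e1 addKn.
    by rewrite (lin1Z _ _ ((bf _ _).2 _ _)) (lin1Z _ _ (((bf _ _).1 _).2 _)) add0r.
  move=> ct; have e1 : (s + u + (t - (s + u)) = t)%N by rewrite subnKC.
  have := fc s u (t - (s + u))%N a b c 1 ns u0; rewrite subn_gt0 lt e1 mulr1 => /(_ isT tT (leqnn _) sa ub ct).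
  rewrite subnn => /(_ (gr1 hG))/eqP.
  have -> : (u + (t - (s + u)) = t - s)%N by move: sut; clear; lia.
  by rewrite addrC addr_eq0 opprB => /eqP ->; rewrite addrC.
have Tt : (T <= t)%N by move: mE; clear; lia.
have /boolp.choice[h hh] q : exists h : nat -> A -> A -> k, (forall s, bilin (h s)) /\
    forall s u v a b c, (n <= s)%N -> (0 < u)%N -> (0 < v)%N -> (s + u + v = T)%N ->
    G s a -> G u b -> G v c ->
    f s u a b (c * e (t - T)%N q) = h s a (b * c) - h (s + u)%N (a * b) c.
  have [||h [lh hh]] := ext3_large n0 nT (f := fun s u a b c => - f s u a b (c * e (t - T)%N q)).
  - move=> s u; split=> [c|a b].
      split=> b; apply: lin1_opp; first exact: ((bf _ _).1 _).1.
      exact: ((bf _ _).1 _).2.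
    by apply: lin1_opp; apply: lin1_mulr; apply: (bf _ _).2.
  - move=> s u v w a b c d ns u0 v0 w0 sum sa ub vc wd.
    have := fc s u v a b c (d * e (t - T)%N q) ns u0 v0.
    rewrite mulrA => /(_ _ _ sa ub vc) h.
    rewrite -[RHS]oppr0 -{}h; first by rewrite !opprD !opprK.
    + by rewrite -sum -{1}[(s + u + v)%N]addn0 ltn_add2l.
    + by rewrite (leq_trans _ Tt) // -sum leq_addr.
    + by apply: (grM hG wd (eG _ _)); rewrite -sum in Tt *; move: Tt; clear; lia.
  - exists h; split=> // s u v a b c ns u0 v0 suv sa ub vc.
    by apply/eqP; rewrite -eqr_opp (hh s u v) // opprB.
pose f' s u a b d := if (s + u == T)%N then
   \sum_(q < C) co (t - T)%N q d * h q s a b else f s u a b d.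
have mE' : (t.+1 - T.+1 = m)%N by move: mE; clear; lia.
have [||g [bg hg]] := IH T.+1 mE' f' (leqW nT).
- move=> s u; rewrite /f'; case: eqP => _; last exact: bf.
  split=> [c|a b]; last by apply: lin1_bigsum => q; apply: lin1_scaler.
  split=> b; apply: lin1_bigsum => q; apply: lin1_scale.
    exact: ((hh q).1 s).1.
  exact: ((hh q).1 s).2.
- move=> s u v a b c d ns u0 v0; rewrite ltnS => suvT suvt sa ub vc dt.
  have suT : (s + u < T)%N by apply: leq_trans suvT; rewrite -{1}[(s + u)%N]addn0 ltn_add2l.
  have -> : f' s u a b (c * d) = f s u a b (c * d) by rewrite /f' ltn_eqF.
  rewrite /f' addnA; case: eqP => [e1|/eqP ne]; last first.
    by apply: (fc s u v) => //; rewrite ltn_neqAle ne.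
  rewrite e1 in dt; rewrite (lin1_coE (f := fun d => f s u a b (c * d)) _ dt); last first.
    by apply: lin1_mull; apply: (bf _ _).2.
  rewrite -sumrB -big_split /= big1 // => q _; rewrite -mulrBr -mulrDr.
  by rewrite ((hh q).2 s u v) // addrA subrK subrr mulr0.
- exists g; split=> // s u a b c ns u0 suT sut sa ub ct; rewrite -(hg s u) //; last exact: leqW.
  by rewrite /f' ltn_eqF.
Qed.

End Windows.

(** * Multiplication tables of windows *)

Section ExactRank.
Context {k : fieldType} {J0 J1 J2 : finType}.

Definition fun_mx (S : nzRingType) (I J : finType) (d : I -> J -> S) : 'M[S]_(#|I|, #|J|) :=
  \matrix_(x, y) d (enum_val x) (enum_val y).

Lemma fun_mx_map (S S' : nzRingType) (f : {rmorphism S -> S'}) (I J : finType) (d : I -> J -> S) :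
  map_mx f (fun_mx d) = fun_mx (fun x y => f (d x y)).
Proof. by apply/matrixP => x y; rewrite !mxE. Qed.

Lemma mul_fun_mx (I J : finType) (v : 'rV[k]_#|I|) (d : I -> J -> k) y :
  (v *m fun_mx d) 0 (enum_rank y) = \sum_x v 0 (enum_rank x) * d x y.
Proof.
rewrite mxE (reindex_onto enum_rank enum_val) => [|i _]; last exact: enum_valK.
apply: eq_big => [x|x _]; first by rewrite enum_rankK eqxx.
by rewrite mxE !enum_rankK.
Qed.

Variables (d0 : J0 -> J1 -> k) (d1 : J1 -> J2 -> k) (V : pred J1).
Hypothesis d0V : forall x y, ~~ V y -> d0 x y = 0.
Hypothesis d1V : forall y z, ~~ V y -> d1 y z = 0.
Hypothesis dd : forall (g : J0 -> k) z, \sum_y (\sum_x g x * d0 x y) * d1 y z = 0.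
Hypothesis exact01 : forall f : J1 -> k, (forall y, ~~ V y -> f y = 0) ->
  (forall z, \sum_y f y * d1 y z = 0) ->
  exists g : J0 -> k, forall y, f y = \sum_x g x * d0 x y.

(** Rank-nullity on the coordinate subspace of [V], whose inclusion is the matrix [E]; there the row
    space of [d0] is the kernel of [d1]. The coordinates outside [V] are zero padding, which keeps
    the matrix formats independent of the degree. *)
Lemma exact_rank : (\rank (fun_mx d0) + \rank (fun_mx d1))%N = #|V|.
Proof.
pose E : 'M[k]_(#|V|, #|J1|) := \matrix_(i, y) (enum_val i == enum_val y)%:R.
have EE : E *m E^T = 1%:M.
  apply/matrixP => i j; rewrite !mxE (bigD1 (enum_rank (enum_val i))) //= !mxE enum_rankK eqxx mul1r.
  rewrite big1 ?addr0 => [|y]; first by rewrite (inj_eq enum_val_inj) eq_sym.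
  move=> ne; rewrite !mxE; case: eqP => [e|]; last by rewrite mul0r.
  by move: ne; rewrite e enum_valK eqxx.
have exV y : V y -> exists j : 'I_#|V|, enum_val j = y.
  by move=> Vy; exists (enum_rank_in (Vy : y \in V) y); rewrite enum_rankK_in.
have fE : \rank E = #|V| by apply/eqP/row_freeP; exists E^T.
have EV (v : 'rV[k]_#|J1|) : (forall y, ~~ V y -> v 0 (enum_rank y) = 0) -> (v <= E)%MS.
  move=> hv; apply/submxP; exists (v *m E^T); apply/rowP => y.
  rewrite -[y]enum_valK; set y0 := enum_val y; rewrite mxE.
  under eq_bigr => i _.
    rewrite !mxE (bigD1 (enum_rank (enum_val i))) //= !mxE enum_rankK eqxx mulr1.
    rewrite big1 ?addr0 => [|z ne]; last first.
      rewrite !mxE; case: eqP => [e|]; last by rewrite mulr0.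
      by move: ne; rewrite e enum_valK eqxx.
    over.
  rewrite enum_rankK; have [Vy|nV] := boolP (V y0); last first.
    rewrite hv // big1 // => i _; case: eqP => [e|]; last by rewrite mulr0.
    by case/negP: nV; rewrite -e; apply: (enum_valP i).
  have [j jE] := exV _ Vy; rewrite (bigD1 j) //= jE eqxx mulr1 big1 ?addr0 // => i ne.
  case: eqP => [e|]; last by rewrite mulr0.
  by move: ne; rewrite -(inj_eq enum_val_inj) e jE eqxx.
have rE : \rank (E *m fun_mx d1) = \rank (fun_mx d1).
  apply/eqP; rewrite eqn_leq mxrankM_maxr /=.
  suff {1}-> : fun_mx d1 = E^T *m (E *m fun_mx d1) by apply: mxrankM_maxr.
  rewrite mulmxA; apply/matrixP => y z; rewrite [RHS]mxE [LHS]mxE.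
  have [Vy|nV] := boolP (V (enum_val y)); last first.
    rewrite d1V // big1 // => j _; rewrite [X in X * _]mxE big1 ?mul0r // => i _.
    rewrite !mxE; case: eqP => [e|]; last by rewrite mul0r.
    by case/negP: nV; rewrite -e; apply: (enum_valP i).
  have [j jE] := exV _ Vy.
  rewrite (bigD1 y) //= [X in _ = X * _ + _](_ : _ = 1); last first.
    rewrite mxE (bigD1 j) //= !mxE jE eqxx mulr1.
    rewrite big1 ?addr0 // => i ne; rewrite !mxE; case: eqP => [e|]; last by rewrite mul0r.
    by move: ne; rewrite -(inj_eq enum_val_inj) e jE eqxx.
  rewrite mul1r big1 ?addr0; first by rewrite mxE.
  move=> y' ne; rewrite mxE big1 ?mul0r // => i _.
  rewrite !mxE; case: eqP => [e|]; last by rewrite mul0r.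
  by rewrite e (inj_eq enum_val_inj) eq_sym (negPf ne) mulr0.
rewrite -rE addnC; apply: etrans fE; rewrite -(mxrank_mul_ker E (fun_mx d1)).
congr (_ + _)%N.
apply/eqP; rewrite eqn_leq; apply/andP; split; apply: mxrankS; apply/rV_subP => v.
  case/submxP => w ->; rewrite sub_capmx; apply/andP; split.
    apply: EV => y nV; rewrite mul_fun_mx big1 // => x _.
    by rewrite d0V // mulr0.
  apply/sub_kermxP/rowP => z; rewrite -[z]enum_valK mul_fun_mx mxE.
  rewrite -[RHS](dd (fun x => w 0 (enum_rank x)) (enum_val z)).
  by apply: eq_bigr => y _; rewrite mul_fun_mx.
rewrite sub_capmx => /andP[/submxP[w vw] /sub_kermxP vk].
have [y nV|z|g hg] := @exact01 (fun y => v 0 (enum_rank y)).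
- rewrite vw mxE big1 // => i _; rewrite mxE enum_rankK; case: eqP => [e|]; last by rewrite mulr0.
  by case/negP: nV; rewrite -e; apply: (enum_valP i).
- by rewrite -mul_fun_mx vk mxE.
apply/submxP; exists (\row_x g (enum_val x)); apply/rowP => y.
rewrite -[y]enum_valK hg mul_fun_mx; apply: eq_bigr => x _.
by rewrite mxE enum_rankK.
Qed.

End ExactRank.

Lemma sum_section (k : nzRingType) (I J : finType) (f : J -> I) (g : I -> J) (P : pred I) (F : I -> k) :
  cancel f g -> (forall x, P x = (f (g x) == x)) ->
  \sum_x (P x)%:R * F x = \sum_j F (f j).
Proof.
move=> fK PE; rewrite (eq_bigr (fun x => if P x then F x else 0)); last first.
  by move=> x _; case: (P x); rewrite ?mul1r ?mul0r.
rewrite -big_mkcond (reindex_onto f g) => [|x]; last by rewrite PE => /eqP.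
apply: eq_big => // j; by rewrite PE !fK !eqxx.
Qed.

Section Shape.
Variables (D C : nat).
Local Notation J0 := ('I_D.+1 * 'I_C * 'I_C)%type.
Local Notation J1 := ('I_D.+1 * 'I_D.+1 * 'I_C * 'I_C * 'I_C)%type.
Local Notation J2 := ('I_D.+1 * 'I_D.+1 * 'I_D.+1 * 'I_C * 'I_C * 'I_C * 'I_C)%type.

(* The module M = A_n + A_(n+1) + ... has dimensions h (n + i) = eta i in the
   window i <= D.  The basis of its free presentation P1 -> P0 in degree n + m
   consists of tensors of basis vectors of M_(n+i), A_u, A_(m-i-u); all are
   indexed by the same finite types, of which only the valid elements count. *)
Variables (h : nat -> nat) (eta : 'I_D.+1 -> nat) (m : nat).

Definition valid0 (x : J0) : bool :=
  let: (i, p, q) := x in [&& (i <= m)%N, (p < eta i)%N & (q < h (m - i))%N].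

Definition valid1 (x : J1) : bool :=
  let: (i, u, p, q, r) := x in [&& (0 < u)%N, (i + u < D.+1)%N, (i + u <= m)%N,
    (p < eta i)%N, (q < h u)%N & (r < h (m - (i + u)))%N].

Definition valid2 (x : J2) : bool :=
  let: (i, u, v, p, q, r, s) := x in [&& [&& (0 < u)%N, (0 < v)%N,
    (i + u + v < D.+1)%N & (i + u + v <= m)%N],
    (p < eta i)%N, (q < h u)%N, (r < h v)%N & (s < h (m - (i + u + v)))%N].

Section Formulas.
Context {S : nzRingType} (sg : J1 -> S) (kp : nat -> nat -> 'I_C -> 'I_C -> 'I_C -> S).

(** [diff0] and [diff1] are the transposes of the differentials of P1 -> P0 and P2 -> P1; the first
    of these sends a, b, c to ab, c minus a, bc. The constants [sg] of the action on M depend on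
    [n], while the constants [kp] of A do not. The ring is a parameter because the same formulas are
    used over k and over a polynomial ring. *)
Definition diff0 (x : J0) (y : J1) : S :=
  let: (i', p', r') := x in let: (i, u, p, q, r) := y in
  if valid0 x && valid1 y then
    ((i' == i + u :> nat)%N && (r' == r))%:R * sg (i, u, p, q, p')
    - ((i' == i) && (p' == p))%:R * kp u (m - (i + u)) q r r'
  else 0.

Definition diff1 (x : J1) (y : J2) : S :=
  let: (i', u', p', q', r') := x in let: (i, u, v, p, q, r, s) := y in
  if valid1 x && valid2 y then
    [&& (i' == i + u :> nat)%N, u' == v, q' == r & r' == s]%:R * sg (i, u, p, q, p')
    - [&& i' == i, (u' == u + v :> nat)%N, p' == p & r' == s]%:R * kp u v q r q'
    + [&& i' == i, u' == u, p' == p & q' == q]%:R * kp v (m - (i + u + v)) r s r'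
  else 0.

End Formulas.

Lemma diff0_map (S S' : nzRingType) (f : {rmorphism S -> S'}) sg kp x y :
  f (diff0 sg kp x y) = diff0 (fun y => f (sg y)) (fun u v q r s => f (kp u v q r s)) x y.
Proof.
case: x y => -[i' p'] r' [[[[i u] p] q] r] /=; case: ifP => _; last exact: rmorph0.
by rewrite rmorphB !rmorphM !rmorph_nat.
Qed.

Lemma diff1_map (S S' : nzRingType) (f : {rmorphism S -> S'}) sg kp x y :
  f (diff1 sg kp x y) = diff1 (fun y => f (sg y)) (fun u v q r s => f (kp u v q r s)) x y.
Proof.
case: x y => -[[[i' u'] p'] q'] r' [[[[[[i u] v] p] q] r] s] /=.
case: ifP => _; last exact: rmorph0.
by rewrite rmorphD rmorphB !rmorphM !rmorph_nat.
Qed.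

End Shape.

(** * Exactness of the window presentation *)

Section Presentation.
Context {k : fieldType} {A : algType k} {G : nat -> set A}.
Hypothesis hG : connected_graded G.
Variables (C D : nat) (e : nat -> nat -> A) (co : nat -> nat -> A -> k) (h : nat -> nat).
Hypothesis eG : forall s p, G s (e s p).
Hypothesis lco : forall s p, lin1 (co s p).
Hypothesis coE : forall s a, G s a -> a = \sum_(p < C) co s p a *: e s p.
Hypothesis e0 : forall s p, (h s <= p)%N -> e s p = 0.
Hypothesis co0 : forall s p a, (h s <= p)%N -> co s p a = 0.
Hypothesis coe : forall s p q, co s p (e s q) = ((p == q) && (q < h s)%N)%:R.
Hypothesis hD : forall n m a, (n <= m)%N -> G m a -> lspan [set x | exists i u v,
    [/\ (i < D.+1)%N, (n + i <= m)%N, G (n + i)%N u, G (m - (n + i))%N v & x = u * v]] a.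

Local Notation J0 := ('I_D.+1 * 'I_C * 'I_C)%type.
Local Notation J1 := ('I_D.+1 * 'I_D.+1 * 'I_C * 'I_C * 'I_C)%type.
Local Notation J2 := ('I_D.+1 * 'I_D.+1 * 'I_D.+1 * 'I_C * 'I_C * 'I_C * 'I_C)%type.

Definition structure_const n (y : J1) : k :=
  let: (i, u, p, q, r) := y in co (n + (i + u)) r (e (n + i) p * e u q).
Definition structure_const0 (u v : nat) (q r s : 'I_C) : k :=
  co (u + v) s (e u q * e v r).
Definition profile n (i : 'I_D.+1) : nat := h (n + i).

Let vanish s a (f : A -> k) : lin1 f -> G s a ->
  (forall p : 'I_C, (p < h s)%N -> f (e s p) = 0) -> f a = 0.
Proof.
move=> lf sa hf; rewrite (lin1_coE coE lf sa) big1 // => p _.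
have [ps|sp] := ltnP p (h s); first by rewrite hf // mulr0.
by rewrite co0 // mul0r.
Qed.

Let lin1_mulr (f : A -> k) b : lin1 f -> lin1 (fun a => f (a * b)).
Proof. by move=> lf c x y; rewrite mulrDl -scalerAl lf. Qed.

Let lin1_mull (f : A -> k) b : lin1 f -> lin1 (fun a => f (b * a)).
Proof. by move=> lf c x y; rewrite mulrDr -scalerAr lf. Qed.

Let sum_co s (q : 'I_C) (F : 'I_C -> k) : (q < h s)%N ->
  \sum_(p < C) F p * co s p (e s q) = F q.
Proof.
move=> qs; rewrite (bigD1 q) //= coe eqxx qs mulr1 big1 ?addr0 // => p ne.
by rewrite coe [_ == _](negPf ne) mulr0.
Qed.

Variables (n m : nat).
Hypothesis n0 : (0 < n)%N.

Local Notation valid0 := (valid0 h (profile n) m).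
Local Notation valid1 := (valid1 h (profile n) m).
Local Notation valid2 := (valid2 h (profile n) m).
Local Notation d0 := (diff0 h (profile n) m (structure_const n) structure_const0).
Local Notation d1 := (diff1 h (profile n) m (structure_const n) structure_const0).

(** A function on the basis of P0 read as a bilinear cochain. Outside the window [inord] returns a
    default index, and the values carry no meaning. *)
Let hat0 (g : J0 -> k) i a c : k := \sum_(p < C) \sum_(q < C)
  g (inord i, p, q) * (co (n + i) p a * co (m - i) q c).

Let hat1 (F : J1 -> k) i u a b c : k := \sum_(p < C) \sum_(q < C) \sum_(r < C)
  F (inord i, inord u, p, q, r) * (co (n + i) p a * co u q b * co (m - (i + u)) r c).

Let bilin_hat0 g i : bilin (hat0 g i).
Proof.
split=> b; do 2 apply: lin1_bigsum => ?; apply: lin1_scale.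
  exact: lin1_scaler.
exact: lin1_scale.
Qed.

Let trilin_hat1 F i u : trilin (hat1 F i u).
Proof.
split=> [c|a b].
  split=> b; do 3 apply: lin1_bigsum => ?; apply: lin1_scale; apply: lin1_scaler.
    exact: lin1_scaler.
  exact: lin1_scale.
by do 3 apply: lin1_bigsum => ?; apply: lin1_scale; apply: lin1_scale.
Qed.

Let hat0_r g i a (r : 'I_C) : (r < h (m - i))%N ->
  hat0 g i a (e (m - i) r) = \sum_(p < C) g (inord i, p, r) * co (n + i) p a.
Proof.
move=> hr; apply: eq_bigr => p _.
rewrite -(sum_co (fun q => g (inord i, p, q) * co (n + i) p a) hr).
by apply: eq_bigr => q _; rewrite mulrA.
Qed.

Let hat0_l g i (p : 'I_C) c : (p < h (n + i))%N ->
  hat0 g i (e (n + i) p) c = \sum_(q < C) g (inord i, p, q) * co (m - i) q c.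
Proof.
move=> hp; rewrite /hat0 exchange_big; apply: eq_bigr => q _.
rewrite -(sum_co (fun p => g (inord i, p, q) * co (m - i) q c) hp).
by apply: eq_bigr => p' _; rewrite mulrAC mulrA.
Qed.

Let hat0_e g i (p q : 'I_C) : (p < h (n + i))%N -> (q < h (m - i))%N ->
  hat0 g i (e (n + i) p) (e (m - i) q) = g (inord i, p, q).
Proof. by move=> hp hq; rewrite hat0_r // (sum_co (fun p => g (inord i, p, q))). Qed.

Let hat1_12 F i u (p q : 'I_C) c : (p < h (n + i))%N -> (q < h u)%N ->
  hat1 F i u (e (n + i) p) (e u q) c =
  \sum_(r < C) F (inord i, inord u, p, q, r) * co (m - (i + u)) r c.
Proof.
move=> hp hq; rewrite /hat1 (bigD1 p) //= (bigD1 q) //= [X in _ + X + _]big1 ?addr0.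
  rewrite [X in _ + X]big1 ?addr0.
    by apply: eq_bigr => r _; rewrite !coe !eqxx hp hq /= !mul1r.
  move=> p' ne; rewrite big1 // => q' _; rewrite big1 // => r _.
  by rewrite coe [_ == _](negPf ne) !mul0r mulr0.
move=> q' ne; rewrite big1 // => r _.
by rewrite !coe [q' == q :> nat](negPf ne) mulr0 mul0r mulr0.
Qed.

Let hat1_13 F i u (p r : 'I_C) b : (p < h (n + i))%N -> (r < h (m - (i + u)))%N ->
  hat1 F i u (e (n + i) p) b (e (m - (i + u)) r) =
  \sum_(q < C) F (inord i, inord u, p, q, r) * co u q b.
Proof.
move=> hp hr; rewrite /hat1 (bigD1 p) //= [X in _ + X]big1 ?addr0.
  apply: eq_bigr => q _; rewrite (bigD1 r) //= [X in _ + X]big1 ?addr0.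
    by rewrite !coe !eqxx hp hr mul1r mulr1.
  by move=> r' ne; rewrite !coe [r' == r :> nat](negPf ne) !mulr0.
move=> p' ne; rewrite big1 // => q' _; rewrite big1 // => r' _.
by rewrite coe [_ == _](negPf ne) !mul0r mulr0.
Qed.

Let hat1_23 F i u a (q r : 'I_C) : (q < h u)%N -> (r < h (m - (i + u)))%N ->
  hat1 F i u a (e u q) (e (m - (i + u)) r) =
  \sum_(p < C) F (inord i, inord u, p, q, r) * co (n + i) p a.
Proof.
move=> hq hr; apply: eq_bigr => p _; rewrite (bigD1 q) //= [X in _ + X]big1 ?addr0.
  rewrite (bigD1 r) //= [X in _ + X]big1 ?addr0.
    by rewrite !coe !eqxx hq hr !mulr1.
  by move=> r' ne; rewrite !coe [r' == r :> nat](negPf ne) !mulr0.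
by move=> q' ne; rewrite big1 // => r' _; rewrite coe [_ == _](negPf ne) mulr0 mul0r mulr0.
Qed.

Let hat1_e F i u (p q r : 'I_C) : (p < h (n + i))%N -> (q < h u)%N ->
  (r < h (m - (i + u)))%N ->
  hat1 F i u (e (n + i) p) (e u q) (e (m - (i + u)) r) = F (inord i, inord u, p, q, r).
Proof.
move=> hp hq hr; rewrite hat1_12 //.
exact: (sum_co (fun r => F (inord i, inord u, p, q, r))).
Qed.

(** Pairing with a column of [d0] is the coboundary of the associated cochain, so that matrix
    identities can be derived from associativity. *)
Let diff0E g (i u : 'I_D.+1) (p q r : 'I_C) : (forall x, ~~ valid0 x -> g x = 0) ->
  valid1 (i, u, p, q, r) ->
  \sum_x g x * d0 x (i, u, p, q, r) =
  hat0 g (i + u)%N (e (n + i) p * e u q) (e (m - (i + u)) r) -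
  hat0 g i (e (n + i) p) (e u q * e (m - (i + u)) r).
Proof.
move=> sg vy; have /and5P[u0 iuD ium hp /andP[hq hr]] := vy.
rewrite hat0_r // hat0_l //.
pose P1 (x : J0) := (x.1.1 == i + u :> nat)%N && (x.2 == r).
pose P2 (x : J0) := (x.1.1 == i) && (x.1.2 == p).
transitivity (\sum_x (P1 x)%:R * (g x * structure_const n (i, u, p, q, x.1.2)) -
   \sum_x (P2 x)%:R * (g x * structure_const0 u (m - (i + u)) q r x.2)).
  rewrite -sumrB; apply: eq_bigr => x _; have [vx|nx] := boolP (valid0 x).
    case: x vx => -[i' p'] r' vx; rewrite /diff0 vx vy /=.
    by rewrite /P1 /P2 /= mulrBr !mulrA ![_%:R * g _]mulrC.
  by rewrite sg // !mul0r !mulr0 subrr.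
congr (_ - _).
  apply: (sum_section (f := fun p' => (inord (i + u), p', r)) (g := fun x => x.1.2)) => //.
  move=> -[[i' p'] r']; rewrite /P1 /= !xpair_eqE eqxx andbT [r' == r]eq_sym.
  by rewrite -[inord _ == _]val_eqE /= inordK // [in RHS]eq_sym.
transitivity (\sum_r' g (i, p, r') * structure_const0 u (m - (i + u)) q r r').
  apply: (sum_section (f := fun r' => (i, p, r')) (g := fun x => x.2)) => //.
  by move=> -[[i' p'] r']; rewrite /P2 /= !xpair_eqE eqxx andbT [i' == i]eq_sym [p' == p]eq_sym.
apply: eq_bigr => r' _; rewrite inord_val /structure_const0.
by rewrite (_ : (u + (m - (i + u)))%N = (m - i)%N) //; move: ium; clear; lia.
Qed.

Let diff1E F (i u v : 'I_D.+1) (p q r s : 'I_C) : (forall x, ~~ valid1 x -> F x = 0) ->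
  valid2 (i, u, v, p, q, r, s) ->
  \sum_x F x * d1 x (i, u, v, p, q, r, s) =
  hat1 F (i + u)%N v (e (n + i) p * e u q) (e v r) (e (m - (i + u + v)) s) -
  hat1 F i (u + v)%N (e (n + i) p) (e u q * e v r) (e (m - (i + (u + v))) s) +
  hat1 F i u (e (n + i) p) (e u q) (e v r * e (m - (i + u + v)) s).
Proof.
move=> sF vz; have /and5P[/and4P[u0 v0 iuvD iuvm] hp hq hr hs] := vz.
have hs' : (s < h (m - (i + (u + v))))%N by rewrite addnA.
rewrite hat1_23 // hat1_13 // hat1_12 //.
pose P1 (x : J1) := [&& (x.1.1.1.1 == i + u :> nat)%N, x.1.1.1.2 == v, x.1.2 == r & x.2 == s].
pose P2 (x : J1) := [&& x.1.1.1.1 == i, (x.1.1.1.2 == u + v :> nat)%N, x.1.1.2 == p & x.2 == s].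
pose P3 (x : J1) := [&& x.1.1.1.1 == i, x.1.1.1.2 == u, x.1.1.2 == p & x.1.2 == q].
transitivity (\sum_x (P1 x)%:R * (F x * structure_const n (i, u, p, q, x.1.1.2)) -
   \sum_x (P2 x)%:R * (F x * structure_const0 u v q r x.1.2) +
   \sum_x (P3 x)%:R * (F x * structure_const0 v (m - (i + u + v)) r s x.2)).
  rewrite -sumrB -big_split; apply: eq_bigr => x _; have [vx|nx] := boolP (valid1 x).
    case: x vx => -[[[i' u'] p'] q'] r' vx; rewrite /diff1 vx vz /=.
    by rewrite /P1 /P2 /P3 /= mulrDr mulrBr !mulrA ![_%:R * F _]mulrC.
  by rewrite sF //= !mul0r !mulr0 subrr addr0.
congr (_ - _ + _).
- transitivity (\sum_p' F (inord (i + u), v, p', r, s) * structure_const n (i, u, p, q, p')).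
    apply: (sum_section (f := fun p' => (inord (i + u), v, p', r, s)) (g := fun x => x.1.1.2)) => //.
    move=> -[[[[i' u'] p'] q'] r']; rewrite /P1 /= !xpair_eqE eqxx andbT -!andbA.
    rewrite [v == _]eq_sym [r == _]eq_sym [s == _]eq_sym -[inord _ == _]val_eqE /= inordK.
      by rewrite [(i + u == _)%N]eq_sym.
    by apply: leq_ltn_trans iuvD; apply: leq_addr.
  by apply: eq_bigr => p' _; rewrite inord_val.
- transitivity (\sum_q' F (i, inord (u + v), p, q', s) * structure_const0 u v q r q').
    apply: (sum_section (f := fun q' => (i, inord (u + v), p, q', s)) (g := fun x => x.1.2)) => //.
    move=> -[[[[i' u'] p'] q'] r']; rewrite /P2 /= !xpair_eqE eqxx andbT -!andbA.
    rewrite [i == _]eq_sym [p == _]eq_sym [s == _]eq_sym -[inord _ == _]val_eqE /= inordK.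
      by rewrite [(u + v == _)%N]eq_sym.
    by apply: leq_ltn_trans iuvD; rewrite -addnA leq_addl.
  by apply: eq_bigr => p' _; rewrite inord_val.
- transitivity (\sum_r' F (i, u, p, q, r') * structure_const0 v (m - (i + u + v)) r s r').
    apply: (sum_section (f := fun r' => (i, u, p, q, r')) (g := fun x => x.2)) => //.
    move=> -[[[[i' u'] p'] q'] r']; rewrite /P3 /= !xpair_eqE eqxx andbT -!andbA.
    by rewrite [i == _]eq_sym [u == _]eq_sym [p == _]eq_sym [q == _]eq_sym.
  apply: eq_bigr => r' _; rewrite !inord_val /structure_const0.
  by rewrite (_ : (v + (m - (i + u + v)))%N = (m - (i + u))%N) //; move: iuvm; clear; lia.
Qed.

(** Both sides are linear in each argument, so the identity on basis vectors extends to all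
    homogeneous elements. *)
Let hat1_diff g F (i u : 'I_D.+1) a b c : (forall x, ~~ valid0 x -> g x = 0) ->
  (forall y, F y = \sum_x g x * d0 x y) -> (0 < u)%N -> (i + u < D.+1)%N -> (i + u <= m)%N ->
  G (n + i)%N a -> G u b -> G (m - (i + u))%N c ->
  hat1 F i u a b c = hat0 g (i + u)%N (a * b) c - hat0 g i a (b * c).
Proof.
move=> sg FE u0 iuD ium ia ub wc; apply/eqP; rewrite -subr_eq0; apply/eqP.
apply: (vanish (f := fun a => hat1 F i u a b c - (hat0 g (i + u)%N (a * b) c - hat0 g i a (b * c))) _ ia) => [|p hp].
  apply: lin1_add; first exact: ((trilin_hat1 _ _ _).1 _).1.
  apply: lin1_opp; apply: lin1_add; last by apply: lin1_opp; apply: (bilin_hat0 _ _).1.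
  exact: (lin1_mulr (f := (hat0 g (i + u)%N)^~ c) _ ((bilin_hat0 _ _).1 _)).
apply: (vanish (f := fun b => hat1 F i u _ b c - (hat0 g (i + u)%N (_ * b) c - hat0 g i _ (b * c))) _ ub) => [|q hq].
  apply: lin1_add; first exact: ((trilin_hat1 _ _ _).1 _).2.
  apply: lin1_opp; apply: lin1_add; last first.
    by apply: lin1_opp; apply: lin1_mulr; apply: (bilin_hat0 _ _).2.
  exact: (lin1_mull (f := (hat0 g (i + u)%N)^~ c) _ ((bilin_hat0 _ _).1 _)).
apply: (vanish (f := fun c => hat1 F i u _ _ c - (hat0 g (i + u)%N _ c - hat0 g i _ (_ * c))) _ wc) => [|r hr].
  apply: lin1_add; first exact: (trilin_hat1 _ _ _).2.
  apply: lin1_opp; apply: lin1_add; first exact: (bilin_hat0 _ _).2.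
  by apply: lin1_opp; apply: lin1_mull; apply: (bilin_hat0 _ _).2.
rewrite hat1_e // !inord_val FE diff0E ?subrr //.
by rewrite /valid1 /= u0 iuD ium hp hq hr.
Qed.

Let diff0_valid x y : ~~ valid1 y -> d0 x y = 0.
Proof.
by case: x y => -[i' p'] r' [[[[i u] p] q] r] /negPf nv; rewrite /diff0 nv andbF.
Qed.

Let diff0_valid0 x y : ~~ valid0 x -> d0 x y = 0.
Proof.
by case: x y => -[i' p'] r' [[[[i u] p] q] r] /negPf nv; rewrite /diff0 nv.
Qed.

Let diff1_valid y z : ~~ valid1 y -> d1 y z = 0.
Proof.
by case: y z => -[[[i' u'] p'] q'] r' [[[[[[i u] v] p] q] r] s] /negPf nv; rewrite /diff1 nv.
Qed.

Let diff1_valid2 y z : ~~ valid2 z -> d1 y z = 0.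
Proof.
by case: y z => -[[[i' u'] p'] q'] r' [[[[[[i u] v] p] q] r] s] /negPf nv; rewrite /diff1 nv andbF.
Qed.

Let mask (g : J0 -> k) x := if valid0 x then g x else 0.

Let maskE g y : \sum_x g x * d0 x y = \sum_x mask g x * d0 x y.
Proof.
apply: eq_bigr => x _; rewrite /mask; case: ifP => // /negbT nv.
by rewrite diff0_valid0 // mul0r mulr0.
Qed.

Let mask_supp g x : ~~ valid0 x -> mask g x = 0.
Proof. by rewrite /mask => /negPf ->. Qed.

Lemma diff01 (g : J0 -> k) z : \sum_y (\sum_x g x * d0 x y) * d1 y z = 0.
Proof.
have [vz|nz] := boolP (valid2 z); last by rewrite big1 // => y _; rewrite diff1_valid2 // mulr0.
pose F y := \sum_x mask g x * d0 x y.
rewrite (eq_bigr (fun y => F y * d1 y z)); last by move=> y _; rewrite maskE.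
case: z vz => -[[[[[i u] v] p] q] r] s vz.
have /and5P[/and4P[u0 v0 iuvD iuvm] hp hq hr hs] := vz.
rewrite diff1E //; last first.
  by move=> y ny; rewrite /F big1 // => x _; rewrite diff0_valid // mulr0.
have iuD : (i + u < D.+1)%N by apply: leq_ltn_trans iuvD; apply: leq_addr.
have uvD : (u + v < D.+1)%N by apply: leq_ltn_trans iuvD; rewrite -addnA leq_addl.
have h1 := @hat1_diff (mask g) F (Ordinal iuD) v _ _ _ (@mask_supp g) (fun=> erefl) v0 iuvD iuvm
  (grM hG (eG (n + i) p) (eG u q) (esym (addnA _ _ _))) (eG v r) (eG (m - (i + u + v)) s).
have iuvD' : (i + (u + v) < D.+1)%N by rewrite addnA.
have iuvm' : (i + (u + v) <= m)%N by rewrite addnA.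
have h2 := @hat1_diff (mask g) F i (Ordinal uvD) _ _ _ (@mask_supp g) (fun=> erefl)
  (ltn_addr _ u0) iuvD' iuvm' (eG (n + i) p) (grM hG (eG u q) (eG v r) erefl) (eG (m - (i + (u + v))) s).
have ium : (i + u <= m)%N by apply: leq_trans iuvm; apply: leq_addr.
have e4 : G (m - (i + u))%N (e v r * e (m - (i + u + v)) s).
  by apply: (grM hG (eG v r) (eG _ s)); move: iuvm; clear; lia.
have h3 := @hat1_diff (mask g) F i u _ _ _ (@mask_supp g) (fun=> erefl)
  u0 iuD ium (eG (n + i) p) (eG u q) e4.
have alg (x y w : k) : x - y - (x - w) + (y - w) = 0.
  by rewrite opprB [x - y + _]addrC [w - x + _]addrA subrK [_ + (y - w)]addrA subrK subrr.
by rewrite h1 h2 h3 /= !addnA !mulrA alg.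
Qed.

Variable N0 : nat.
Hypothesis E2 : forall t, (N0 <= t)%N -> ext2_from G 1 t.
Hypothesis N0D : (N0 <= D.+1)%N.

Let tE s : (n + m - (n + s) = m - s)%N. Proof. exact: subnDl. Qed.

Let hat0_g (g0 : J0 -> k) (g : nat -> A -> A -> k) (i : 'I_D.+1) a c :
  (forall s, bilin (g s)) -> (i <= m)%N ->
  (forall p q : 'I_C, valid0 (i, p, q) -> g0 (i, p, q) = g (n + i)%N (e (n + i) p) (e (m - i) q)) ->
  G (n + i)%N a -> G (m - i)%N c -> hat0 g0 i a c = g (n + i)%N a c.
Proof.
move=> bg im g0E ia cm; apply/eqP; rewrite -subr_eq0; apply/eqP.
apply: (vanish (f := fun a => hat0 g0 i a c - g (n + i)%N a c) _ ia) => [|p hp].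
  by apply: lin1_add; [exact: (bilin_hat0 _ _).1|apply: lin1_opp; apply: (bg _).1].
apply: (vanish (f := fun c => hat0 g0 i _ c - g (n + i)%N _ c) _ cm) => [|q hq].
  by apply: lin1_add; [exact: (bilin_hat0 _ _).2|apply: lin1_opp; apply: (bg _).2].
by rewrite hat0_e // inord_val g0E ?subrr // /valid0 /= im hp hq.
Qed.

Let base (j : 'I_C) (x : J0) : k :=
  let: (i, p, q) := x in
  if valid0 x then co (n + m) j (e (n + i) p * e (m - i) q) else 0.

Let base_valid j x : ~~ valid0 x -> base j x = 0.
Proof. by case: x => -[i p] q /negPf nv; rewrite /base nv. Qed.

(* A functional on A_(n+m), given by its coordinates f, as a function on the
   basis of P0. *)
Let pull (f : 'I_C -> k) (x : J0) := \sum_j f j * base j x.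

Let pull_valid f x : ~~ valid0 x -> pull f x = 0.
Proof. by move=> nv; rewrite /pull big1 // => j _; rewrite base_valid // mulr0. Qed.

Let lin1_comb (f : 'I_C -> k) : lin1 (fun x => \sum_j f j * co (n + m) j x).
Proof. by apply: lin1_bigsum => j; apply: lin1_scale. Qed.

Let hat0_pull f (i : 'I_D.+1) a c : (i <= m)%N -> G (n + i)%N a -> G (m - i)%N c ->
  hat0 (pull f) i a c = \sum_j f j * co (n + m) j (a * c).
Proof.
move=> im ia cm; apply: (hat0_g (g := fun _ a c => \sum_j f j * co (n + m) j (a * c))) => //.
  move=> s; split=> b; first exact: (lin1_mulr _ (lin1_comb f)).
  exact: (lin1_mull _ (lin1_comb f)).
by move=> p q vx; rewrite /pull /base; apply: eq_bigr => j _; rewrite vx.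
Qed.

Lemma base_diff0 (f : 'I_C -> k) y : \sum_x (\sum_j f j * base j x) * d0 x y = 0.
Proof.
have [vy|ny] := boolP (valid1 y); last by rewrite big1 // => x _; rewrite diff0_valid // mulr0.
case: y vy => -[[[i u] p] q] r vy; have /and5P[u0 iuD ium hp /andP[hq hr]] := vy.
have im : (i <= m)%N by apply: leq_trans ium; apply: leq_addr.
rewrite (diff0E (g := pull f) (@pull_valid f) vy).
have -> := @hat0_pull f (Ordinal iuD) _ _ ium
  (grM hG (eG (n + i) p) (eG u q) (esym (addnA _ _ _))) (eG (m - (i + u)) r).
have e4 : G (m - i)%N (e u q * e (m - (i + u)) r).
  by apply: (grM hG (eG u q) (eG _ r)); move: ium; clear; lia.
by rewrite (hat0_pull f im (eG (n + i) p) e4) mulrA subrr.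
Qed.

(** Independence of the nonzero rows of [base] is the dual form of the surjectivity of P0 -> M in
    degree n + m, which is the window property [hD]. *)
Lemma rank_base : (h (n + m) <= C)%N -> \rank (fun_mx base) = h (n + m).
Proof.
move=> hC; pose V : pred 'I_C := [pred j : 'I_C | (j < h (n + m))%N].
have <- : #|V| = h (n + m).
  rewrite -sum1_card -(big_mkord (fun j => (j < h (n + m))%N) (fun=> 1%N)).
  by rewrite -(big_nat_widen 0 (h (n + m)) C predT) // sum_nat_const_nat muln1 subn0.
(* An empty first index type stands for the zero at the left end of the dual sequence. *)
have := @exact_rank k void 'I_C _ (fun=> fun=> 0) base V.
have -> : fun_mx (fun (_ : void) (_ : 'I_C) => 0 : k) = 0 by apply/matrixP => x y; rewrite !mxE.
rewrite mxrank0 add0n; apply => //.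
- by move=> j [[i p] q] /= nj; case: ifP => // _; rewrite co0 // leqNgt.
- by move=> g z; rewrite big1 // => y _; rewrite big1 ?mul0r // => -[].
move=> f fV fb; exists (fun=> 0) => j; rewrite [RHS]big1; last by move=> -[].
have [jV|nj] := boolP (V j); last exact: fV.
pose P x := \sum_j f j * co (n + m) j x.
have P0 x : G (n + m)%N x -> P x = 0.
  move=> /(hD (leq_addr m n)); apply: (lspan_sub (V := [set x | P x = 0])).
    split=> /= [|c x' y hx hy]; first exact: (lin1_0 (lin1_comb f)).
    by rewrite /P (lin1_comb f) -!/(P _) hx hy mulr0 addr0.
  move=> _ [i [u [v [iD im ui vi ->]]]] /=.
  have {}im : (i <= m)%N by rewrite -(leq_add2l n).
  rewrite tE in vi; rewrite /P; have <- := @hat0_pull f (Ordinal iD) u v im ui vi.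
  by rewrite /hat0 big1 // => p _; rewrite big1 // => q _; rewrite inord_val /pull fb mul0r.
have := P0 _ (eG (n + m) j); rewrite /P (bigD1 j) //= coe eqxx.
rewrite (jV : (j < h (n + m))%N) mulr1 big1 ?addr0 // => j' ne.
by rewrite coe [_ == _](negPf ne) mulr0.
Qed.

(* Exactness of P1 -> P0 -> M -> 0, by duality. *)
Lemma dim_rank_diff0 : (h (n + m) <= C)%N ->
  (h (n + m) + \rank (fun_mx d0))%N = #|(valid0 : pred J0)|.
Proof.
move=> hC; rewrite -rank_base //; apply: exact_rank => //.
- exact: base_diff0.
move=> f fV fd.
(* A function killed by [d0] is a cochain on the window with zero coboundary; [window2] makes it a
   functional of the product in A_(n+m). *)
have [||s u a b c ns u0 suT sut sa ub vc|p [lp hp]] := window2 hG eG lco coE E2 (T := (n + D.+1)%N) (t := (n + m)%N) (g := fun s => hat0 f (s - n)%N) n0.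
- by rewrite leq_add2l.
- by move=> s; apply: bilin_hat0.
- have [i iE] : exists i, s = (n + i)%N by exists (s - n)%N; rewrite subnKC.
  rewrite {}iE -addnA in sa suT sut vc *; rewrite !addKn.
  rewrite ltn_add2l in suT; rewrite leq_add2l in sut; rewrite tE in vc.
  have iD : (i < D.+1)%N by apply: leq_ltn_trans suT; apply: leq_addr.
  have uD : (u < D.+1)%N by apply: leq_ltn_trans suT; apply: leq_addl.
  have := @hat1_diff f (fun=> 0) (Ordinal iD) (Ordinal uD) a b c fV (fun y => esym (fd y)) u0 suT sut sa ub vc.
  have -> : hat1 (fun=> 0) (Ordinal iD) (Ordinal uD) a b c = 0.
    by rewrite /hat1 big1 // => ? _; rewrite big1 // => ? _; rewrite big1 // => ? _; rewrite mul0r.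
  by move=> /eqP; rewrite eq_sym subr_eq0 => /eqP.
exists (fun j : 'I_C => p (e (n + m) j)) => x; have [vx|nx] := boolP (valid0 x); last first.
  by rewrite fV // [RHS]pull_valid.
case: x vx => -[i s] q vx; have /and3P[im hs hq] := vx.
have -> : f (i, s, q) = p (e (n + i) s * e (m - i) q).
  rewrite -(hp (n + i)%N) ?leq_addr ?leq_add2l ?ltn_add2l ?tE //.
  by rewrite addKn hat0_e // inord_val.
rewrite (lin1_coE coE lp (s := (n + m)%N)).
  by apply: eq_bigr => j _; rewrite /base vx mulrC.
by apply: (grM hG (eG _ _) (eG _ _)); rewrite -addnA subnKC.
Qed.

Hypothesis E3 : forall t, (N0 <= t)%N -> ext3_from G 1 t.

(* Exactness of P2 -> P1 -> P0, by duality. *)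
Lemma rank_diff0_diff1 : (\rank (fun_mx d0) + \rank (fun_mx d1))%N = #|(valid1 : pred J1)|.
Proof.
apply: exact_rank => //; first exact: diff01.
move=> F sF Fd.
have [||s u v a b c d ns u0 v0 suvT suvt sa ub vc wd|g [bg hg]] := window3 hG eG lco coE E3
  (T := (n + D.+1)%N) (t := (n + m)%N) (f := fun s u => hat1 F (s - n)%N u) n0.
- by rewrite leq_add2l.
- by move=> s u; apply: trilin_hat1.
- have [i iE] : exists i, s = (n + i)%N by exists (s - n)%N; rewrite subnKC.
  rewrite {}iE -!addnA in sa suvT suvt wd *; rewrite !addKn.
  rewrite ltn_add2l in suvT; rewrite leq_add2l in suvt; rewrite tE in wd.
  have iD : (i < D.+1)%N by apply: leq_ltn_trans suvT; apply: leq_addr.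
  have uD : (u < D.+1)%N by move: suvT; clear; lia.
  have vD : (v < D.+1)%N by move: suvT; clear; lia.
  (* The cocycle identity is reduced to basis vectors one argument at a time, where it is a column
     of [d1]. *)
  pose Phi a b c d := hat1 F (i + u)%N v (a * b) c d - hat1 F i (u + v)%N a (b * c) d +
    hat1 F i u a b (c * d).
  rewrite -/(Phi a b c d).
  have l1 b' c' d' : lin1 (fun a => Phi a b' c' d').
    apply: lin1_add; last exact: ((trilin_hat1 _ _ _).1 _).1.
    apply: lin1_add; last by apply: lin1_opp; apply: ((trilin_hat1 _ _ _).1 _).1.
    exact: (lin1_mulr (f := fun a => hat1 F (i + u)%N v a c' d') b' (((trilin_hat1 F (i + u) v).1 d').1 c')).
  have l2 a' c' d' : lin1 (fun b => Phi a' b c' d').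
    apply: lin1_add; last exact: ((trilin_hat1 _ _ _).1 _).2.
    apply: lin1_add; last first.
      apply: lin1_opp.
      exact: (lin1_mulr (f := fun b => hat1 F i (u + v)%N a' b d') c' (((trilin_hat1 F i (u + v)).1 d').2 a')).
    exact: (lin1_mull (f := fun a => hat1 F (i + u)%N v a c' d') a' (((trilin_hat1 F (i + u) v).1 d').1 c')).
  have l3 a' b' d' : lin1 (fun c => Phi a' b' c d').
    apply: lin1_add; last by apply: lin1_mulr; apply: (trilin_hat1 _ _ _).2.
    apply: lin1_add; first exact: ((trilin_hat1 _ _ _).1 _).2.
    apply: lin1_opp.
    exact: (lin1_mull (f := fun b => hat1 F i (u + v)%N a' b d') b' (((trilin_hat1 F i (u + v)).1 d').2 a')).
  have l4 a' b' c' : lin1 (fun d => Phi a' b' c' d).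
    apply: lin1_add; last by apply: lin1_mull; apply: (trilin_hat1 _ _ _).2.
    by apply: lin1_add; [|apply: lin1_opp]; apply: (trilin_hat1 _ _ _).2.
  apply: (vanish (l1 _ _ _) sa) => p hp; apply: (vanish (l2 _ _ _) ub) => q hq.
  apply: (vanish (l3 _ _ _) vc) => r hr; apply: (vanish (l4 _ _ _) wd) => s' hs.
  have vz : valid2 (Ordinal iD, Ordinal uD, Ordinal vD, p, q, r, s').
    by rewrite /valid2 /= -!addnA u0 v0 suvT suvt hp hq hr hs.
  by have := diff1E sF vz; rewrite Fd /= /Phi -addnA => <-.
pose g0 (x : J0) := if valid0 x then let: (i, p, q) := x in g (n + i)%N (e (n + i) p) (e (m - i) q) else 0.
have sg0 x : ~~ valid0 x -> g0 x = 0 by rewrite /g0 => /negPf ->.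
exists g0 => y; have [vy|ny] := boolP (valid1 y); last first.
  by rewrite sF // big1 // => x _; rewrite diff0_valid // mulr0.
case: y vy => -[[[i u] p] q] r vy; have /and5P[u0 iuD ium hp /andP[hq hr]] := vy.
have im : (i <= m)%N by apply: leq_trans ium; apply: leq_addr.
have gE (j : 'I_D.+1) (p' q' : 'I_C) : valid0 (j, p', q') ->
    g0 (j, p', q') = g (n + j)%N (e (n + j) p') (e (m - j) q') by rewrite /g0 => ->.
rewrite (diff0E sg0 vy).
have -> := @hat0_g g0 g (Ordinal iuD) _ _ bg ium (gE _)
  (grM hG (eG (n + i) p) (eG u q) (esym (addnA _ _ _))) (eG (m - (i + u)) r).
have e4 : G (m - i)%N (e u q * e (m - (i + u)) r).
  by apply: (grM hG (eG u q) (eG _ r)); move: ium; clear; lia.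
rewrite (hat0_g bg im (gE i) (eG (n + i) p) e4) /= addnA -hg ?leq_addr //.
- by rewrite addKn hat1_e // !inord_val.
- by rewrite -addnA ltn_add2l.
- by rewrite -addnA leq_add2l.
- by rewrite -addnA tE.
Qed.

End Presentation.

Lemma pigeonhole_unbounded (V : finType) (f : nat -> V) :
  exists v, unbounded [set n | (0 < n)%N /\ f n = v].
Proof.
apply: contrapT => /forallNP H.
have /boolp.choice[b hb] v : exists m, forall n, (m <= n)%N -> (0 < n)%N -> f n <> v.
  have /existsNP[m hm] := H v; exists m => n mn n0 fn; apply: hm.
  by exists n.
pose n := (\max_v b v).+1.
have := hb (f n) n; apply=> //.
by rewrite (leq_trans (leq_bigmax (f n))).
Qed.

(** * Windows with equal Hilbert functions *)

Section ExtPeriodic.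
Context {k : fieldType} {A : algType k} {G : nat -> set A}.
Hypothesis hG : connected_graded G.
Variables (C D0 : nat).
Hypothesis hC : forall s, has_dim (G s) (dimk (G s)) /\ (dimk (G s) <= C)%N.
Hypothesis hD : forall n m a, (n <= m)%N -> G m a -> lspan [set x | exists i u v,
    [/\ (i < D0)%N, (n + i <= m)%N, G (n + i)%N u, G (m - (n + i))%N v & x = u * v]] a.

Let h n := dimk (G n).

Lemma ex_structure : exists (e : nat -> nat -> A) (co : nat -> nat -> A -> k),
  [/\ forall s p, G s (e s p), forall s p, lin1 (co s p),
   forall s a, G s a -> a = \sum_(p < C) co s p a *: e s p,
   forall s p, (h s <= p)%N -> e s p = 0 /\ forall a, co s p a = 0 &
   forall s p q, co s p (e s q) = ((p == q) && (q < h s)%N)%:R].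
Proof.
have /boolp.choice[ec hec] s : exists ec : (nat -> A) * (nat -> A -> k),
  [/\ forall p, G s (ec.1 p), forall p, lin1 (ec.2 p),
   forall a, G s a -> a = \sum_(p < C) ec.2 p a *: ec.1 p,
   forall p, (h s <= p)%N -> ec.1 p = 0 /\ forall a, ec.2 p a = 0 &
   forall p q, ec.2 p (ec.1 q) = ((p == q) && (q < h s)%N)%:R].
  have [e [co [eV lco [e0 co0] coe coE]]] := ex_coord (hC s).1.
  exists (e, co); split=> //=.
  - by move=> p; case: (eV p) => [//|->]; apply: gr0.
  - by move=> a sa; apply: coE sa; apply: (hC s).2.
  - by move=> p sp; split; [apply: e0|move=> a; apply: co0].
exists (fun s => (ec s).1), (fun s => (ec s).2); split=> s.
- by case: (hec s).
- by case: (hec s).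
- by case: (hec s).
- by case: (hec s).
- by case: (hec s).
Qed.

Lemma periodic_of_shift n n' : (0 < n)%N -> (n < n')%N ->
  (forall m, h (n + m) = h (n' + m)) -> eventually_periodic h.
Proof.
move=> n0 nn' H; exists (n' - n)%N, n; split=> //; first by rewrite subn_gt0.
move=> i ni; have := H (i - n)%N; rewrite subnKC // => ->.
by congr (h _); move: ni nn'; clear; lia.
Qed.

Variable N0 : nat.
Hypothesis E2 : forall t, (N0 <= t)%N -> ext2_from G 1 t.

Let D := maxn N0 D0.

Let hD' n m a : (n <= m)%N -> G m a -> lspan [set x | exists i u v,
    [/\ (i < D.+1)%N, (n + i <= m)%N, G (n + i)%N u, G (m - (n + i))%N v & x = u * v]] a.
Proof.
move=> nm /(hD nm); apply: lspanS => _ [i [u [v [iD im ui vi ->]]]].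
exists i, u, v; split=> //; rewrite ltnS (leq_trans (ltnW iD)) // leq_maxr //.
Qed.

Let pf n : {ffun 'I_D.+1 -> 'I_C.+1} := [ffun i : 'I_D.+1 => inord (h (n + i))].

Let pfE n v : pf n = v -> profile h n = (fun i : 'I_D.+1 => v i : nat).
Proof.
by move=> <-; apply: funext => i; rewrite /profile ffunE inordK // ltnS (hC _).2.
Qed.

Let N0D : (N0 <= D.+1)%N.
Proof. by apply: leq_trans (leq_maxl _ _) (leqnSn _). Qed.

Local Notation J0 := ('I_D.+1 * 'I_C * 'I_C)%type.
Local Notation J1 := ('I_D.+1 * 'I_D.+1 * 'I_C * 'I_C * 'I_C)%type.

(* Over a finite field there are finitely many multiplication tables. *)
Lemma ext2_finite_periodic : finite_set [set: k] -> eventually_periodic h.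
Proof.
move=> /finite_seqP[s sE]; have [e [co [eG lco coE e0 coe]]] := ex_structure.
have ks x : x \in s by have : [set: k] x by []; rewrite sE.
pose tab n : {ffun J1 -> 'I_(size s).+1} := [ffun y => inord (index (structure_const e co n y) s)].
have [v uv] := pigeonhole_unbounded (fun n => (pf n, tab n)).
have [n [_ [n0 nv]]] := uv 0%N; have [n' [nn' [n'0 n'v]]] := uv n.+1.
apply: (periodic_of_shift n0 nn') => m.
have pE : profile h n' = profile h n :> ('I_D.+1 -> nat).
  by rewrite (pfE (congr1 fst n'v)) (pfE (congr1 fst nv)).
have tE : structure_const e co n' = structure_const e co n :> (J1 -> k).
  apply: funext => y; have : tab n' y = tab n y.
    by rewrite -[tab n']/((pf n', tab n').2) n'v -nv.
  rewrite !ffunE => /(congr1 (@nat_of_ord _)); rewrite !inordK ?ltnS ?index_size // => ie.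
  by rewrite -(nth_index 0 (ks (structure_const e co n' y))) ie nth_index.
have R n1 n1_gt0 := dim_rank_diff0 hG eG lco coE (fun s p a hp => (e0 s p hp).2 a) coe hD'
  (n := n1) n1_gt0 E2 N0D (hC _).2 (m := m).
have := R _ n'0; rewrite pE tE -(R _ n0).
by move/addIn => ->.
Qed.

Hypothesis E3 : forall t, (N0 <= t)%N -> ext3_from G 1 t.

(* The structure constants of the windows form a sequence of points of an
   affine space; an infinite irreducible subsequence has constant ranks. *)
Lemma ext_periodic : eventually_periodic h.
Proof.
have [e [co [eG lco coE e0 coe]]] := ex_structure.
(* The elements [X] of [S] stand for the structure constants of the window, and [ev n] evaluates
   them at the window starting in degree [n]. *)
have [S [ev [X [c [nS hX hc]]]]] := ex_noetherian_functions
  (fun (j : 'I_#|{: J1}|) n => structure_const e co n (enum_val j)).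
have [v uv] := pigeonhole_unbounded pf.
have [T [Tv uT irrT]] := ex_irreducible ev nS uv.
have [n [_ Tn]] := uT 0%N; have [n' [nn' Tn']] := uT n.+1.
apply: (periodic_of_shift (Tv _ Tn).1 nn') => m.
pose eta (i : 'I_D.+1) := v i : nat.
pose sgS (y : J1) := X (enum_rank y).
pose kpS u w (q r s : 'I_C) := c (structure_const0 e co u w q r s).
have kpE j : (fun u w (q r s : 'I_C) => ev j (kpS u w q r s)) = structure_const0 e co.
  by apply: funext => u; apply: funext => w; do 3 apply: funext => ?; rewrite /kpS hc.
have sgE j : (fun y => ev j (sgS y)) = structure_const e co j.
  by apply: funext => y; rewrite /sgS hX enum_rankK.
have m0 j : T j -> map_mx (ev j) (fun_mx (diff0 h eta m sgS kpS)) =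
    fun_mx (diff0 h (profile h j) m (structure_const e co j) (structure_const0 e co)).
  move=> Tj; rewrite fun_mx_map (pfE (Tv _ Tj).2) -/eta; congr fun_mx.
  by apply: funext => x; apply: funext => y; rewrite diff0_map kpE sgE.
have m1 j : T j -> map_mx (ev j) (fun_mx (diff1 h eta m sgS kpS)) =
    fun_mx (diff1 h (profile h j) m (structure_const e co j) (structure_const0 e co)).
  move=> Tj; rewrite fun_mx_map (pfE (Tv _ Tj).2) -/eta; congr fun_mx.
  by apply: funext => x; apply: funext => y; rewrite diff1_map kpE sgE.
have sum j : T j -> (\rank (map_mx (ev j) (fun_mx (diff0 h eta m sgS kpS))) +
    \rank (map_mx (ev j) (fun_mx (diff1 h eta m sgS kpS))))%N = #|(valid1 h eta m : pred J1)|.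
  move=> Tj; rewrite m0 // m1 // (rank_diff0_diff1 hG eG lco coE
    (fun s p a hp => (e0 s p hp).2 a) coe m (Tv _ Tj).1 N0D E3).
  by rewrite (pfE (Tv _ Tj).2).
have := rank_constant irrT sum Tn Tn'; rewrite !m0 // => rk.
have R j (Tj : T j) := dim_rank_diff0 hG eG lco coE (fun s p a hp => (e0 s p hp).2 a) coe hD'
  (n := j) (Tv _ Tj).1 E2 N0D (hC _).2 (m := m).
have := R _ Tn; have := R _ Tn'; rewrite rk (pfE (Tv _ Tn).2) (pfE (Tv _ Tn').2) => <- /addIn.
by [].
Qed.

End ExtPeriodic.

(** * Koszul algebras and algebras of finite rate *)

Section TorExt.
Context {k : fieldType} {A : algType k} {G : nat -> set A}.
Hypothesis hG : connected_graded G.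
Local Notation bar_space := (malg (seq A) k).

Lemma bar_word_size e w : bar_word G e w -> size w = size e.
Proof. by elim: e w => [|d e IH] [|a w] //= [_ _ /IH ->]. Qed.

Lemma bar_diff_word2 (a b : A) : bar_diff_word [:: a; b] = word [:: a * b] :> bar_space.
Proof. by rewrite /bar_diff_word /= big_ord1 /= expr0 scale1r. Qed.

Lemma bar_diff_word3 (a b c : A) :
  bar_diff_word [:: a; b; c] = word [:: a * b; c] - word [:: a; b * c] :> bar_space.
Proof.
by rewrite /bar_diff_word /= big_ord_recr big_ord1 /= expr0 expr1 scale1r scaleN1r.
Qed.

Lemma bar_diff_word4 (a b c d : A) : bar_diff_word [:: a; b; c; d] =
  word [:: a * b; c; d] - word [:: a; b * c; d] + word [:: a; b; c * d] :> bar_space.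
Proof.
rewrite /bar_diff_word /= 2!big_ord_recr big_ord1 /= expr0 expr1 expr2.
by rewrite mulNr mul1r opprK !scale1r scaleN1r.
Qed.

(* A cochain killing cycles descends to the image of the differential. *)
Lemma tor_coboundary i j (phi : seq A -> k^o) : ~ Tor_neq0 G i j ->
  (forall u v a b c, phi (u ++ (c *: a + b) :: v) = c * phi (u ++ a :: v) + phi (u ++ b :: v)) ->
  (forall e w, size e = i.+1 -> sumn e = j -> bar_word G e w ->
    linext phi (bar_diff_word w) = 0) ->
  exists psi : {linear bar_space -> k^o}, (forall e u v a b c, size e = i.-1 -> sumn e = j ->
      bar_word G e (u ++ a :: v) -> bar_word G e (u ++ b :: v) -> psi (word (u ++ (c *: a + b) :: v)) =
        c * psi (word (u ++ a :: v)) + psi (word (u ++ b :: v))) /\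
    forall e w, size e = i -> sumn e = j -> bar_word G e w -> psi (bar_diff_word w) = phi w.
Proof.
move=> /contrapT ht lphi dphi.
have wordE w : linext phi (word w) = phi w by apply: linextU.
have dE (x : bar_space) : bar_diff x = linext (@bar_diff_word k A) x by [].
(* The graph of the functional that sends the differential of [x], up to tensor relations, to the
   value of [phi] at [x]. *)
pose U : set (bar_space * k^o) := [set z | exists x r, [/\ bar_chain G i j x,
  tensor_rel G i.-1 j r, z.1 = bar_diff x + r & z.2 = linext phi x]].
have sU : subspace U.
  split=> [|c y z [x [r [hx hr y1 y2]]] [x' [r' [hx' hr' z1 z2]]]].
    exists 0, 0; rewrite !dE !linear0 addr0; split=> //; exact: (subspace0 (subspace_lspan _)).
  exists (c *: x + x'), (c *: r + r'); split.
  - by apply: (subspace_lspan _).2.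
  - by apply: (subspace_lspan _).2.
  - by rewrite /= y1 z1 !dE linearP scalerDr addrACA.
  - by rewrite /= y2 z2 linearP.
have [c [x [r [hx hr /= /esym/eqP e1 ->]]]|psi hpsi] := lin_ext sU.
  (* The functional is well defined: a chain whose differential is a relation is a cycle, hence a
     boundary up to relations, and [phi] kills both. *)
  have /ht[y [z [hy hz ->]]] : bar_cycles G i j x.
    split=> //; move: e1; rewrite addr_eq0 => /eqP ->.
    exact: (subspaceN (subspace_lspan _)).
  rewrite linearD /=.
  have [hb ht'] : (linext phi (bar_diff y) = 0) /\ (linext phi z = 0); last by rewrite hb ht' addr0.
  split.
    apply: (lspan_sub (V := [set y | linext phi (bar_diff y) = 0]) _ _ hy).
      split=> /= [|d v w hv hw]; first by rewrite dE !linear0.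
      by rewrite dE !linearP /= -!dE hv hw scaler0 addr0.
    move=> _ [e [w [se sj hw ->]]] /=; rewrite dE linextU.
    exact: dphi hw.
  apply: (lspan_sub (V := [set y | linext phi y = 0]) _ _ hz).
    split=> /= [|d v w hv hw]; first by rewrite linear0.
    by rewrite linearP /= hv hw scaler0 addr0.
  move=> w' [e [u [v [a [b [d [_ _ _ ->]]]]]]] /=; rewrite !linearB linearZ /= !wordE.
  by rewrite lphi addrAC addrK subrr.
exists psi; split.
  move=> e u v a b c se sj ha hb; apply/eqP; rewrite -subr_eq0 opprD addrA; apply/eqP.
  rewrite -[c * _]/(c *: (_ : k^o)) -linearZ -!linearB; apply: hpsi.
  exists 0, (word (u ++ (c *: a + b) :: v) - c *: word (u ++ a :: v) - word (u ++ b :: v)).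
  rewrite dE !linear0 add0r; split=> //; first exact: (subspace0 (subspace_lspan _)).
  by apply: sub_lspan; exists e, u, v, a, b, c.
move=> e w se sj hw; apply: hpsi; exists (word w), 0; split.
- by apply: sub_lspan; exists e, w.
- exact: (subspace0 (subspace_lspan _)).
- by rewrite addr0 dE linextU.
- by rewrite wordE.
Qed.

(** A word does not record the degrees of its letters, so [phi] sums [f] over all splittings of [j];
    on homogeneous letters a single term survives. *)
Lemma Tor2_ext2 j : (0 < j)%N -> ~ Tor_neq0 G 2 j -> ext2_from G 1 j.
Proof.
move=> j0 ht f bf fc.
pose phi (w : seq A) : k^o := if w is [:: a; b] then
  \sum_(s < j.+1) f s (gproj hG s a) (gproj hG (j - s) b) else 0.
have phiE s u a b : (s + u = j)%N -> G s a -> G u b -> phi [:: a; b] = f s a b.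
  move=> su sa ub; have sj : (s < j.+1)%N by rewrite ltnS -su leq_addr.
  rewrite /phi (bigD1 (Ordinal sj)) //= big1 ?addr0.
    by rewrite -su addKn !gproj_id.
  move=> i ne; rewrite (gproj0 hG (t := s)) ?(lin1_0 ((bf i).1 _)) // => ie.
  by move/eqP: ne; apply; apply: val_inj.
have [||psi [psi0 psiE]] := tor_coboundary (phi := phi) ht.
- move=> u v a b c; case: u => [|u1 [|u2 u]]; case: v => [|v1 [|v2 v]] /=; rewrite ?mulr0 ?addr0 //.
  + rewrite mulr_sumr -big_split; apply: eq_bigr => s _ /=.
    by rewrite linearP ((bf s).1 _).
  + rewrite mulr_sumr -big_split; apply: eq_bigr => s _ /=.
    by rewrite linearP ((bf s).2 _).
  + by case: u; rewrite /= ?mulr0 ?addr0.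
  + by case: u; rewrite /= ?mulr0 ?addr0.
  + by case: u; rewrite /= ?mulr0 ?addr0.
- move=> [|s [|u [|v []]]] // w _ sum hw; move: sum (hw) (bar_word_size hw).
  case: w {hw} => [|a [|b [|c []]]] //=; rewrite addn0 addnA => suv [s0 sa [u0 ub [v0 vc _]]] _.
  rewrite bar_diff_word3 linearB /= /word !linextU.
  rewrite (phiE (s + u)%N v) ?(phiE s (u + v)%N) ?addnA //; [|exact: grM ub vc _|exact: grM sa ub _].
  by rewrite (fc s u v) ?subrr.
exists (fun x => psi (word [:: gproj hG j x])); split.
  move=> c x y; rewrite linearP; apply: (psi0 [:: j] [::]); rewrite //= ?addn0 //.
    by split=> //; apply: gprojG.
  by split=> //; apply: gprojG.
move=> s u a b s0 u0 su sa ub; rewrite -(phiE s u) // -(psiE [:: s; u]) //=; last by rewrite addn0.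
rewrite bar_diff_word2 gproj_id //.
exact: grM sa ub _.
Qed.

Lemma Tor3_ext3 j : ~ Tor_neq0 G 3 j -> ext3_from G 1 j.
Proof.
move=> ht f bf fc.
pose phi (w : seq A) : k^o := if w is [:: a; b; c] then
  \sum_(s < j.+1) \sum_(u < j.+1) f s u (gproj hG s a) (gproj hG u b) (gproj hG (j - (s + u)) c) else 0.
have phiE s u v a b c : (s + u + v = j)%N -> G s a -> G u b -> G v c -> phi [:: a; b; c] = f s u a b c.
  move=> suv sa ub vc; have sj : (s < j.+1)%N by rewrite ltnS -suv -addnA leq_addr.
  have uj : (u < j.+1)%N by rewrite ltnS -suv addnAC leq_addl.
  rewrite /phi (bigD1 (Ordinal sj)) //= [X in _ + X]big1 ?addr0; last first.
    move=> i ne; apply: big1 => q _; rewrite (gproj0 hG (t := s)) //.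
      by rewrite (lin1_0 (((bf _ _).1 _).1 _)).
    by move=> ie; move/eqP: ne; apply; apply: val_inj.
  rewrite (bigD1 (Ordinal uj)) //= [X in _ + X]big1 ?addr0; last first.
    move=> i ne; rewrite (gproj0 hG (s := i) (t := u)) //.
      by rewrite (lin1_0 (((bf _ _).1 _).2 _)).
    by move=> ie; move/eqP: ne; apply; apply: val_inj.
  by rewrite -suv addKn !gproj_id.
have [||psi [psi0 psiE]] := tor_coboundary (phi := phi) ht.
- move=> u v a b c.
  have phi0 w : size w != 3 -> phi w = 0 by case: w => [|? [|? [|? []]]].
  have [|ne] := eqVneq (size u + size v)%N 2; last first.
    by rewrite !phi0 ?mulr0 ?addr0 // size_cat /= addnS eqSS.
  case: u => [|u1 [|u2 [|u3 u]]]; case: v => [|v1 [|v2 [|v3 v]]] //= _.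
  + rewrite mulr_sumr -big_split; apply: eq_bigr => s _ /=.
    rewrite mulr_sumr -big_split; apply: eq_bigr => t _ /=.
    by rewrite linearP (((bf _ _).1 _).1 _).
  + rewrite mulr_sumr -big_split; apply: eq_bigr => s _ /=.
    rewrite mulr_sumr -big_split; apply: eq_bigr => t _ /=.
    by rewrite linearP (((bf _ _).1 _).2 _).
  + rewrite mulr_sumr -big_split; apply: eq_bigr => s _ /=.
    rewrite mulr_sumr -big_split; apply: eq_bigr => t _ /=.
    by rewrite linearP ((bf _ _).2 _).
- move=> [|s [|u [|v [|w []]]]] // z _ sum hz; move: sum (hz) (bar_word_size hz).
  case: z {hz} => [|a [|b [|c [|d []]]]] //=; rewrite addn0 !addnA.
  move=> sum [s0 sa [u0 ub [v0 vc [w0 wd _]]]] _.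
  rewrite bar_diff_word4 linearD linearB /= /word !linextU.
  rewrite (phiE (s + u)%N v w _ _ _ sum (grM hG sa ub erefl) vc wd).
  rewrite (phiE s (u + v)%N w _ _ _ _ sa (grM hG ub vc erefl) wd) ?addnA //.
  rewrite (phiE s u (v + w)%N _ _ _ _ sa ub (grM hG vc wd erefl)) ?addnA //.
  + exact: (fc s u v w).
pose g s a b := if (0 < s < j)%N then psi (word [:: gproj hG s a; gproj hG (j - s) b]) else 0.
exists g; split.
  move=> s; have hw a : (0 < s < j)%N -> bar_word G [:: (j - s)%N] [:: gproj hG (j - s) a].
    by move=> /andP[_ sj]; split; rewrite ?subn_gt0 //; apply: gprojG.
  split=> b c x y; rewrite /g; case: ifP => sj; rewrite ?mulr0 ?addr0 // linearP.
    apply: (psi0 [:: s; (j - s)%N] [::]) => //=; first by rewrite addn0 subnKC // ltnW; case/andP: sj.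
      by split=> //; [case/andP: sj|apply: gprojG|apply: hw].
    by split=> //; [case/andP: sj|apply: gprojG|apply: hw].
  apply: (psi0 [:: s; (j - s)%N] [:: _] [::]) => //=; first by rewrite addn0 subnKC // ltnW; case/andP: sj.
    by split=> //; [case/andP: sj|apply: gprojG|apply: hw].
  by split=> //; [case/andP: sj|apply: gprojG|apply: hw].
move=> s u v a b c s0 u0 v0 suv sa ub vc; rewrite -(phiE s u v) // -(psiE [:: s; u; v]) //=; last by rewrite addn0 addnA.
rewrite /g !ifT; last 2 first.
- by move: s0 u0 v0 suv; clear; lia.
- by move: s0 u0 v0 suv; clear; lia.
rewrite bar_diff_word3 linearB /=.
have -> : (j - (s + u) = v)%N by rewrite -suv addKn.
have -> : (j - s = u + v)%N by rewrite -suv -addnA addKn.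
by rewrite !gproj_id //; [exact: grM ub vc _|exact: grM sa ub _].
Qed.

End TorExt.

Section RateExt.
Context {R : realType} {k : fieldType} {A : algType k} {G : nat -> set A}.
Hypothesis hG : connected_graded G.

Lemma Koszul_finite_rate : Koszul G R -> finite_rate G R.
Proof.
move=> h; exists 1 => i j hij; rewrite mul1r -lee_fin; apply: le_trans (h i).
by apply: ereal_sup_ubound; right; exists j.
Qed.

(** For i <= 3 nonzero Tor_i lives in degrees at most 3 |r|; the absolute value covers a negative
    [r]. *)
Lemma finite_rate_ext : finite_rate G R -> exists N0, forall t, (N0 <= t)%N ->
  ext2_from G 1 t /\ ext3_from G 1 t.
Proof.
move=> [r hr]; pose N0 := (Num.bound (`|r| * 3)).+1; exists N0 => t Nt.
have H i : (i <= 3)%N -> ~ Tor_neq0 G i t.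
  move=> i3 /hr; apply/negP; rewrite -ltNge.
  apply: (@le_lt_trans _ _ (`|r| * 3)).
    apply: (@le_trans _ _ (`|r| * i%:R)); first by rewrite ler_wpM2r ?ler_norm.
    by rewrite ler_wpM2l // ler_nat.
  apply: lt_le_trans (archi_boundP _) _; first by apply: mulr_ge0.
  by rewrite ler_nat; apply: ltnW.
split; last exact: (Tor3_ext3 hG (H _ _)).
by apply: (Tor2_ext2 hG); [apply: leq_trans Nt|apply: H].
Qed.

End RateExt.

(** * Coherent algebras *)

Section GradedKernels.
Context {k : fieldType} {A : algType k} {G : nat -> set A}.
Hypothesis hG : connected_graded G.

(* The matrix entries of degree-preserving maps A(-e) -> A(-d). *)
Definition ghom d e (z : A) : Prop := if (d <= e)%N then G (e - d)%N z else z = 0.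

Definition gcomp d n (x : A) : A := if (d <= n)%N then gproj hG (n - d) x else 0.

Lemma ghom_sub d e : subspace (ghom d e).
Proof.
rewrite /ghom; case: leqP => _; first exact: (gr_sub hG).
exact: subspace_set0.
Qed.

Lemma ghomM d e f x y : ghom d e x -> ghom e f y -> ghom d f (x * y).
Proof.
rewrite /ghom; case: (leqP d e) => [de hx|_ ->]; last first.
  by move=> _; rewrite mul0r; case: ifP => // _; apply: (gr0 hG).
case: (leqP e f) => [ef hy|_ ->]; last first.
  by rewrite mulr0; case: ifP => // _; apply: (gr0 hG).
rewrite (leq_trans de ef); apply: (grM hG hx hy).
by move: de ef; clear; lia.
Qed.

Lemma gcomp_ghom d n x : ghom d n (gcomp d n x).
Proof. by rewrite /ghom /gcomp; case: (d <= n)%N => //; exact: (gprojG hG). Qed.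

Lemma gcomp_id d n x : ghom d n x -> gcomp d n x = x.
Proof. by rewrite /ghom /gcomp; case: (d <= n)%N => [|->] //; exact: (gproj_id hG). Qed.

Lemma gcomp_bigsum d n (I : Type) (r : seq I) (F : I -> A) :
  gcomp d n (\sum_(i <- r) F i) = \sum_(i <- r) gcomp d n (F i).
Proof. by rewrite /gcomp; case: (d <= n)%N; [rewrite linear_sum|rewrite big1]. Qed.

Lemma gcomp0 d n : gcomp d n 0 = 0.
Proof. by rewrite /gcomp linear0 if_same. Qed.

Lemma gproj_mull0 r s x z : (r < s)%N -> G s z -> gproj hG r (z * x) = 0.
Proof.
move=> rs zs; apply: (gr_ind hG (V := [set x | gproj hG r (z * x) = 0])).
  split=> /= [|c u v hu hv]; first by rewrite mulr0 linear0.
  by rewrite mulrDr -scalerAr linearP hu hv scaler0 addr0.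
move=> u y yu /=; apply: (gproj0 _ _ (grM hG zs yu erefl)).
by move=> e; move: rs; rewrite e ltnNge leq_addr.
Qed.

Lemma gcompM d e n z x : ghom d e z -> z * gcomp e n x = gcomp d n (z * x).
Proof.
rewrite /ghom; case: (leqP d e) => [de hz|_ ->]; last by rewrite !mul0r gcomp0.
rewrite /gcomp; case: (leqP e n) => [en|ne].
  rewrite (leq_trans de en) -(gproj_mull hG _ _ hz); congr (gproj _ _ _).
  by move: de en; clear; lia.
rewrite mulr0; case: (leqP d n) => // dn; rewrite (gproj_mull0 _ _ hz) //.
by move: dn ne; clear; lia.
Qed.

Lemma gcomp_decomp d m n x : (forall j, (m <= j)%N -> x = \sum_(i < j) gproj hG i x) ->
  (m + d <= n)%N -> x = \sum_(i < n) gcomp d i x.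
Proof.
move=> hx mn; have dn : (d <= n)%N by apply: leq_trans mn; apply: leq_addl.
rewrite -(subnKC dn) big_split_ord /= big1 ?add0r.
  rewrite [LHS](hx (n - d)%N); last by rewrite leq_subRL // addnC.
  by apply: eq_bigr => i _; rewrite /gcomp leq_addr addKn.
by move=> i _; rewrite /gcomp leqNgt ltn_ord.
Qed.

Lemma col_comb m (b : 'rV[A]_m) (x : 'cV[A]_m) : (b *m x) 0 0 = \sum_l b 0 l * x l 0.
Proof. by rewrite mxE. Qed.

Hypothesis cG : coherent G.

(* The kernel of b is computed from a presentation of its image by another
   family of generators, as in Schanuel's lemma. *)
Lemma row_kernel q d (e : 'I_q -> nat) (b : 'rV[A]_q) : (forall l, ghom d (e l) (b 0 l)) ->
  exists r (h : 'I_r -> nat) (T : 'M[A]_(q, r)), (forall l m, ghom (e l) (h m) (T l m)) /\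
    forall x : 'cV[A]_q, b *m x = 0 <-> exists w, x = T *m w.
Proof.
move=> hb; pose I : set A := [set (b *m x) 0 0 | x in [set: 'cV[A]_q]].
have sum1 (x y : 'rV[A]_1) : x 0 0 = y 0 0 -> x = y.
  by move=> xy; apply/matrixP => i j; rewrite !ord1.
have [p [s [a [S [Ia kera]]]]] : finitely_presented_right_ideal I.
  apply: cG; last by exists q, b.
  - split.
    + by exists 0 => //; rewrite mulmx0 mxE.
    + by move=> _ _ [x _ <-] [y _ <-]; exists (x - y) => //; rewrite mulmxBr !mxE.
    + move=> _ c [x _ <-]; exists (\col_i (x i 0 * c)) => //.
      by rewrite !col_comb mulr_suml; apply: eq_bigr => i _; rewrite mxE mulrA.
  - move=> n f hf [x _ fE] i ni; exists (\col_l gcomp (e l) (d + i) (x l 0)) => //.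
    rewrite col_comb; under eq_bigr do rewrite mxE (gcompM _ _ (hb _)).
    rewrite -gcomp_bigsum -col_comb fE /gcomp leq_addr addKn linear_sum.
    rewrite (bigD1 (Ordinal ni)) //= gproj_id // big1 ?addr0 // => j ne.
    by apply: (gproj0 _ _ (hf j)) => ij; move/eqP: ne; apply; apply: val_inj.
have cE m (c : 'rV[A]_m) l : (c *m (delta_mx l 0 : 'cV_m)) 0 0 = c 0 l.
  by rewrite -colE mxE.
have /boolp.choice[V hV] l : exists v : 'cV[A]_p, (a *m v) 0 0 = b 0 l.
  have : I (b 0 l) by exists (delta_mx l 0) => //; rewrite cE.
  by rewrite Ia => -[v _ <-]; exists v.
have /boolp.choice[U hU] l : exists v : 'cV[A]_q, (b *m v) 0 0 = a 0 l.
  have : I (a 0 l) by rewrite Ia; exists (delta_mx l 0) => //; rewrite cE.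
  by move=> [v _ <-]; exists v.
(* The presentation supplied by coherence may be inhomogeneous and has its own generators [a]; [V']
   and [U'] translate between [a] and [b]. *)
pose V' := \matrix_(i, l) V l i 0; pose U' := \matrix_(i, l) U l i 0.
have aV : a *m V' = b.
  apply/rowP => l; rewrite -hV !mxE; apply: eq_bigr => i _; by rewrite mxE.
have bU : b *m U' = a.
  apply/rowP => l; rewrite -hU !mxE; apply: eq_bigr => i _; by rewrite mxE.
(* The kernel of [b] is generated by the defects of the round trip [U' *m V'] and by the syzygies of
   [a] carried over by [U']. *)
pose T0 := row_mx (1%:M - U' *m V') (U' *m S).
have bT0 : b *m T0 = 0.
  rewrite mul_mx_row mulmxBr mulmx1 !mulmxA bU aV subrr.
  have -> : a *m S = 0; last by rewrite row_mx0.
  apply/matrixP => i j; rewrite [i]ord1; have := cE _ (a *m S) j.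
  by rewrite -mulmxA (proj2 (kera _)) ?mxE //; exists (delta_mx j 0).
have kerb (x : 'cV[A]_q) : b *m x = 0 -> exists w, x = T0 *m w.
  rewrite -{1}aV -mulmxA => /kera[w Vw]; exists (col_mx x w).
  by rewrite mul_row_col mulmxBl mul1mx -!mulmxA Vw subrK.
(* As [b] is homogeneous, the homogeneous components of the columns of [T0] stay in its kernel and
   still generate it. *)
have [m hm] := gproj_bound hG (fun lj : 'I_q * 'I_(q + s) => T0 lj.1 lj.2).
pose N := (m + \max_l e l)%N.
have TE l j : T0 l j = \sum_(n < N) gcomp (e l) n (T0 l j).
  apply: (@gcomp_decomp _ m); last by rewrite leq_add2l leq_bigmax.
  exact: (hm (l, j)).
pose X := ('I_(q + s) * 'I_N)%type.
pose ev (r : 'I_#|{: X}|) : X := enum_val r.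
exists #|{: X}|, (fun r => (ev r).2 : nat),
  (\matrix_(l, r) gcomp (e l) (ev r).2 (T0 l (ev r).1)).
split=> [l r|x]; first by rewrite mxE; apply: gcomp_ghom.
split=> [/kerb[w ->]|[w ->]].
  exists (\col_r w (ev r).1 0); apply/colP => l; rewrite !mxE.
  transitivity (\sum_(jn : X) gcomp (e l) jn.2 (T0 l jn.1) * w jn.1 0); last first.
    rewrite (reindex ev) /=; last exact/onW_bij/enum_val_bij.
    by apply: eq_bigr => r _; rewrite !mxE.
  rewrite -(pair_bigA _ (fun (j : 'I_(q + s)) (n : 'I_N) => gcomp (e l) n (T0 l j) * w j 0)) /=.
  by apply: eq_bigr => j _; rewrite -mulr_suml -TE.
rewrite mulmxA [X in X *m w](_ : _ = 0) ?mul0mx //; apply/rowP => r.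
rewrite !mxE; under eq_bigr do rewrite mxE (gcompM _ _ (hb _)).
rewrite -gcomp_bigsum; have /rowP/(_ (ev r).1) := bT0.
by rewrite !mxE => ->; rewrite gcomp0.
Qed.

(** Induction on the rows: on the kernel of the first row, the image of [T1], the remaining rows act
    through their product with [T1]. *)
Lemma mx_kernel m q (d : 'I_m -> nat) (e : 'I_q -> nat) (S : 'M[A]_(m, q)) :
  (forall i l, ghom (d i) (e l) (S i l)) ->
  exists r (h : 'I_r -> nat) (T : 'M[A]_(q, r)), (forall l m, ghom (e l) (h m) (T l m)) /\
    forall x : 'cV[A]_q, S *m x = 0 <-> exists w, x = T *m w.
Proof.
elim: m q d e S => [|m IH] q d e S hS.
  exists q, e, 1%:M; split=> [l r|x].
    rewrite mxE; have [->|_] := eqVneq l r; last exact: (subspace0 (ghom_sub _ _)).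
    by rewrite /ghom leqnn subnn mulr1n; apply: (gr1 hG).
  by split=> _; [exists x; rewrite mul1mx|apply/matrixP => -[]].
have [|r1 [h1 [T1 [hT1 ker1]]]] := @row_kernel q (d ord0) e (row ord0 S).
  by move=> l; rewrite mxE; apply: hS.
have [|r2 [h2 [T2 [hT2 ker2]]]] := IH r1 (fun i => d (lift ord0 i)) h1 (row' ord0 S *m T1).
  move=> i l; rewrite mxE; apply: subspace_sum; first exact: ghom_sub.
  by move=> j _; rewrite mxE; apply: ghomM (hS _ _) (hT1 _ _).
exists r2, h2, (T1 *m T2); split=> [l r|x].
  rewrite mxE; apply: subspace_sum; first exact: ghom_sub.
  by move=> j _; apply: ghomM (hT1 _ _) (hT2 _ _).
have S0 : S *m x = 0 <-> row ord0 S *m x = 0 /\ row' ord0 S *m x = 0.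
  have -> : row' ord0 S *m x = row' ord0 (S *m x).
    by apply/matrixP => i j; rewrite !mxE; apply: eq_bigr => l _; rewrite mxE.
  rewrite -row_mul; split=> [->|[h0 h']].
    by split; apply/matrixP => i j; rewrite !mxE.
  apply/matrixP => i j; case: (unliftP ord0 i) => [i' ->|->].
    by have /matrixP/(_ i' j) := h'; rewrite !mxE.
  by have /matrixP/(_ ord0 j) := h0; rewrite !mxE.
rewrite S0; split=> [[/ker1[w1 ->]]|[w ->]].
  by rewrite mulmxA => /ker2[w ->]; exists w; rewrite mulmxA.
split; first by apply/ker1; exists (T2 *m w); rewrite mulmxA.
by rewrite !mulmxA -mulmxA; apply/ker2; exists w.
Qed.

Lemma ex_syzygies m q (d : 'I_m -> nat) (e : 'I_q -> nat) (S : 'I_m -> 'I_q -> A) :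
  (forall i l, ghom (d i) (e l) (S i l)) ->
  exists r (h : 'I_r -> nat) (T : 'I_q -> 'I_r -> A),
   [/\ forall l m, ghom (e l) (h m) (T l m), forall i m, \sum_l S i l * T l m = 0 &
    forall n x, (forall l, ghom (e l) n (x l)) -> (forall i, \sum_l S i l * x l = 0) ->
      exists w, (forall m, ghom (h m) n (w m)) /\ forall l, x l = \sum_m T l m * w m].
Proof.
move=> hS; have [|r [h [T [hT kerT]]]] := @mx_kernel m q d e (\matrix_(i, l) S i l).
  by move=> i l; rewrite mxE.
exists r, h, T; split=> // [i j|n x hx Sx].
  have /matrixP/(_ i 0) : (\matrix_(i, l) S i l) *m col j T = 0.
    by apply/kerT; exists (delta_mx j 0); rewrite colE.
  rewrite mxE [RHS]mxE => ST0; rewrite -[RHS]ST0.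
  by apply: eq_bigr => l _; rewrite !mxE.
have /kerT[w wE] : (\matrix_(i, l) S i l) *m (\col_l x l) = 0.
  apply/matrixP => i j; rewrite mxE [RHS]mxE -[RHS](Sx i).
  by apply: eq_bigr => l _; rewrite !mxE.
exists (fun j => gcomp (h j) n (w j 0)); split=> [j|l]; first exact: gcomp_ghom.
rewrite -[LHS](gcomp_id (hx l)); have /colP/(_ l) := wE; rewrite !mxE => ->.
by rewrite gcomp_bigsum; apply: eq_bigr => j _; rewrite (gcompM _ _ (hT _ _)).
Qed.

End GradedKernels.

(** * Cocycles on submodules of free modules *)

Section ModuleCochains.
Context {k : fieldType} {A : algType k} {G : nat -> set A}.
Hypothesis hG : connected_graded G.

Definition rmul m (x : {ffun 'I_m -> A}) (b : A) : {ffun 'I_m -> A} := [ffun i => x i * b].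

Lemma rmulDl m c (x y : {ffun 'I_m -> A}) b : rmul (c *: x + y) b = c *: rmul x b + rmul y b.
Proof. by apply/ffunP => i; rewrite !ffunE mulrDl -scalerAl. Qed.

Lemma rmulDr m (x : {ffun 'I_m -> A}) c a b : rmul x (c *: a + b) = c *: rmul x a + rmul x b.
Proof. by apply/ffunP => i; rewrite !ffunE mulrDr -scalerAr. Qed.

Lemma rmulZ m (x : {ffun 'I_m -> A}) (c : k) : rmul x c%:A = c *: x.
Proof. by apply/ffunP => i; rewrite !ffunE mulr_algr. Qed.

Lemma rmul0 m (x : {ffun 'I_m -> A}) : rmul x 0 = 0.
Proof. by apply/ffunP => i; rewrite !ffunE mulr0. Qed.

(* The columns x l of a graded matrix S generate a submodule of a free module
   whose relations are generated by the columns of T; if all degrees are less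
   than t, a cocycle on this submodule with values in degree t is a
   coboundary. *)
Lemma module_cocycle t m p q (e : 'I_p -> nat) (h : 'I_q -> nat) (x : 'I_p -> {ffun 'I_m -> A})
    (T : 'I_p -> 'I_q -> A) (F : nat -> {ffun 'I_m -> A} -> A -> k) :
  (forall l, (e l < t)%N) -> (forall r, (h r < t)%N) ->
  (forall l r, ghom (G := G) (e l) (h r) (T l r)) -> (forall i r, \sum_l x l i * T l r = 0) ->
  (forall v, (forall l, ghom (G := G) (e l) t (v l)) -> (forall i, \sum_l x l i * v l = 0) ->
    exists w, (forall r, ghom (G := G) (h r) t (w r)) /\ forall l, v l = \sum_r T l r * w r) ->
  (forall s, bilin (F s)) ->
  (forall l u v b c, (0 < u)%N -> (0 < v)%N -> (e l + u + v = t)%N -> G u b -> G v c ->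
    F (e l + u)%N (rmul (x l) b) c = F (e l) (x l) (b * c)) ->
  exists P : {linear {ffun 'I_m -> A} -> k^o}, forall s u w b, (0 < u)%N -> (s + u = t)%N ->
    (forall l, ghom (G := G) (e l) s (w l)) -> G u b ->
    F s (\sum_l rmul (x l) (w l)) b = P (rmul (\sum_l rmul (x l) (w l)) b).
Proof.
move=> et ht hT xT kerS bF cF.
have gt (d : nat) z : (d < t)%N -> ghom (G := G) d t z -> G (t - d)%N z.
  by rewrite /ghom => /ltnW ->.
have key l f z c : (f < t)%N -> ghom (G := G) (e l) f z -> G (t - f)%N c ->
    F (e l) (x l) (z * c) = F f (rmul (x l) z) c.
  move=> ft; rewrite /ghom; case: (ltngtP (e l) f) => [lf zh ch|lf -> _|-> ].
  - rewrite -(cF l (f - e l)%N (t - f)%N) ?subn_gt0 ?subnKC // ltnW //.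
  - by rewrite mul0r rmul0 (lin1_0 ((bF _).2 _)) (lin1_0 ((bF _).1 _)).
  - rewrite subnn (graded_connected hG) => -[a _ <-] ch.
    by rewrite mulr_algl rmulZ (lin1Z _ _ ((bF _).2 _)) (lin1Z _ _ ((bF _).1 _)).
pose U : set ({ffun 'I_m -> A} * k^o) := [set z | exists v : 'I_p -> A,
  [/\ forall l, ghom (G := G) (e l) t (v l), z.1 = \sum_l rmul (x l) (v l) &
   z.2 = \sum_l F (e l) (x l) (v l)]].
have sU : subspace U.
  split=> [|c y z [v [hv y1 y2]] [v' [hv' z1 z2]]].
    exists (fun=> 0); split=> [l| |] /=; first exact: (subspace0 (ghom_sub hG _ _)).
      by rewrite big1 // => l _; rewrite rmul0.
    by rewrite big1 // => l _; rewrite (lin1_0 ((bF _).2 _)).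
  exists (fun l => c *: v l + v' l); split=> [l| |] /=.
  - by apply: (ghom_sub hG _ _).2.
  - rewrite y1 z1 scaler_sumr -big_split; apply: eq_bigr => l _.
    by rewrite rmulDr.
  - rewrite y2 z2 scaler_sumr -big_split; apply: eq_bigr => l _ /=.
    by rewrite (bF _).2.
have [c [v [hv /= /esym v0 ->]]|P hP] := lin_ext sU.
  have [i|w [hw vE]] := kerS v hv.
    have /ffunP/(_ i) := v0; rewrite sum_ffunE ffunE => vi; rewrite -[RHS]vi.
    by apply: eq_bigr => l _; rewrite ffunE.
  (* Writing [v] through the relations moves the entries of [T] into the first argument, where they
     sum to 0. *)
  transitivity (\sum_r \sum_l F (h r) (rmul (x l) (T l r)) (w r)).
    rewrite exchange_big; apply: eq_bigr => l _ /=; rewrite vE.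
    rewrite (lin1_sum _ _ _ ((bF _).2 _)); apply: eq_bigr => r _.
    by apply: key => //; apply: gt (hw r).
  apply: big1 => r _; rewrite -(lin1_sum _ _ _ ((bF _).1 _)).
  rewrite (_ : \sum_l _ = 0) ?(lin1_0 ((bF _).1 _)) //; apply/ffunP => i.
  rewrite sum_ffunE ffunE -[RHS](xT i r); apply: eq_bigr => l _.
  by rewrite ffunE.
exists P => s u w b u0 su hw ub; apply/esym/hP; exists (fun l => w l * b); split=> /= [l| |].
- apply: (ghomM hG (hw l)); rewrite /ghom -su leq_addr addKn //.
- apply/ffunP => i; rewrite ffunE !sum_ffunE mulr_suml; apply: eq_bigr => l _.
  by rewrite !ffunE mulrA.
- rewrite (lin1_sum _ _ _ ((bF _).1 _)); apply: eq_bigr => l _.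
  apply/esym/key; [|exact: hw|]; first by rewrite -su -{1}[s]addn0 ltn_add2l.
  by rewrite -su addKn.
Qed.

End ModuleCochains.

(** * Ext of a coherent algebra from three steps of a resolution *)

Section CoherentExt.
Context {k : fieldType} {A : algType k} {G : nat -> set A}.
Hypothesis hG : connected_graded G.
Variable C : nat.
Hypothesis hC : forall s, has_dim (G s) (dimk (G s)) /\ (dimk (G s) <= C)%N.
Hypothesis cG : coherent G.
Local Notation ghom := (ghom (G := G)).

Lemma ex_augmentation_generators : finitely_generated A -> exists g (y : 'I_g -> A) (d : 'I_g -> nat),
  [/\ forall i, (0 < d i)%N, forall i, G (d i) (y i) &
   forall s a, (0 < s)%N -> G s a -> exists x, (forall i, ghom (d i) s (x i)) /\ a = \sum_i y i * x i].
Proof.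
move=> /(ex_hgen hG)[g [y [d [d0 hy span]]]]; exists g, y, d; split=> // s a s0 /span.
apply: (lspan_sub (V := [set a | exists x, (forall i, ghom (d i) s (x i)) /\ a = \sum_i y i * x i])).
  split=> [|c _ _ [x [hx ->]] [x' [hx' ->]]].
    exists (fun=> 0); split=> [i|]; first exact: (subspace0 (ghom_sub hG _ _)).
    by rewrite big1 // => i _; rewrite mulr0.
  exists (fun i => c *: x i + x' i); split=> [i|]; first exact: (ghom_sub hG _ _).2.
  rewrite scaler_sumr -big_split; apply: eq_bigr => i _.
  by rewrite mulrDr scalerAr.
move=> _ [[|i w] /= sw <-]; first by move: s0; rewrite -sw.
exists (fun j => if j == i then \prod_(j <- w) y j else 0); split=> [j|].
  case: eqP => [->|_]; last exact: (subspace0 (ghom_sub hG _ _)).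
  rewrite /ghom -sw leq_addr addKn; exact: gr_prod.
rewrite big_cons (bigD1 i) //= eqxx [X in _ = _ + X]big1 ?addr0 // => j /negPf ->.
by rewrite mulr0.
Qed.

Section Presentation.
Variables (g p : nat) (y : 'I_g -> A) (d : 'I_g -> nat) (e : 'I_p -> nat) (S : 'I_g -> 'I_p -> A).
Hypothesis d0 : forall i, (0 < d i)%N.
Hypothesis hy : forall i, G (d i) (y i).
Hypothesis span : forall s a, (0 < s)%N -> G s a ->
  exists x, (forall i, ghom (d i) s (x i)) /\ a = \sum_i y i * x i.
Hypothesis hS : forall i l, ghom (d i) (e l) (S i l).
Hypothesis yS : forall l, \sum_i y i * S i l = 0.
Hypothesis kerS : forall n x, (forall i, ghom (d i) n (x i)) -> \sum_i y i * x i = 0 ->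
  exists w, (forall l, ghom (e l) n (w l)) /\ forall i, x i = \sum_l S i l * w l.

Lemma presentation_ext2 t : (forall i, (d i < t)%N) -> (forall l, (e l < t)%N) -> ext2_from G 1 t.
Proof.
move=> dt et f bf fc.
have [||||P hP] := module_cocycle (t := t) hG (e := d) (h := e) (T := S)
    (x := fun i => [ffun _ : 'I_1 => y i]) (F := fun s x b => f s (x ord0) b) dt et hS.
- by move=> i l; under eq_bigr do rewrite ffunE; apply: yS.
- move=> v hv yv; apply: kerS => //; rewrite -[RHS](yv ord0).
  by apply: eq_bigr => i _; rewrite ffunE.
- move=> s; split=> [b c x x'|x]; last exact: (bf _).2.
  by rewrite !ffunE ((bf s).1 b).
- move=> i u v b c u0 v0 sum ub vc; rewrite !ffunE; apply: fc vc => //.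
exists (fun a => P [ffun=> a]); split.
  move=> c a b; rewrite -[c * _]/(c *: (_ : k^o)) -linearP; congr (P _).
  by apply/ffunP => i; rewrite !ffunE.
move=> s u a b s0 u0 su sa ub; have [x [hx aE]] := span s0 sa.
have xE : \sum_i rmul [ffun _ : 'I_1 => y i] (x i) = [ffun=> a].
  apply/ffunP => i; rewrite sum_ffunE ffunE aE; apply: eq_bigr => l _.
  by rewrite !ffunE.
have := hP s u x b u0 su hx ub; rewrite xE ffunE => ->; congr (P _).
by apply/ffunP => i; rewrite !ffunE.
Qed.

Hypothesis e0 : forall l, (0 < e l)%N.
Variables (q : nat) (h : 'I_q -> nat) (T : 'I_p -> 'I_q -> A).
Hypothesis hT : forall l r, ghom (e l) (h r) (T l r).
Hypothesis ST : forall i r, \sum_l S i l * T l r = 0.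
Hypothesis kerT : forall n v, (forall l, ghom (e l) n (v l)) -> (forall i, \sum_l S i l * v l = 0) ->
  exists w, (forall r, ghom (h r) n (w r)) /\ forall l, v l = \sum_r T l r * w r.

Section Cocycle.
Variables (t : nat) (f : nat -> nat -> A -> A -> A -> k).
Hypothesis bf : forall s u, trilin (f s u).
Hypothesis fc : forall s u v w a b c d, (1 <= s)%N -> (0 < u)%N -> (0 < v)%N -> (0 < w)%N ->
    (s + u + v + w = t)%N -> G s a -> G u b -> G v c -> G w d ->
    f (s + u)%N v (a * b) c d - f s (u + v)%N a (b * c) d + f s u a b (c * d) = 0.

Let F s (x : {ffun 'I_g -> A}) b := \sum_(i | (d i < s)%N) f (d i) (s - d i)%N (y i) (x i) b.

Let bF s : bilin (F s).
Proof.
split=> [b c x x'|x].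
  rewrite /F mulr_sumr -big_split; apply: eq_bigr => i _ /=.
  by rewrite !ffunE (((bf _ _).1 _).2 _).
by apply: lin1_bigsum => i; apply: (bf _ _).2.
Qed.

(* F bounds the pullback of f to the free module on the generators y i. *)
Let coboundF s u v (x : {ffun 'I_g -> A}) b c : (0 < s)%N -> (0 < u)%N -> (0 < v)%N ->
  (s + u + v = t)%N -> (forall i, ghom (d i) s (x i)) -> G u b -> G v c ->
  f s u (\sum_i y i * x i) b c = F (s + u)%N (rmul x b) c - F s x (b * c).
Proof.
move=> s0 u0 v0 sum hx ub vc.
rewrite (lin1_sum _ _ _ (((bf _ _).1 _).1 _)).
rewrite /F [X in X - _]big_mkcond [X in _ - X]big_mkcond -sumrB; apply: eq_bigr => i _ /=.
have := hx i; rewrite /ghom ffunE; case: (ltngtP (d i) s) => [ds xs|sd ->|ds].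
- rewrite ltn_addr //; apply/eqP; rewrite -subr_eq0 opprB addrA addrAC; apply/eqP.
  have := fc (d0 i) (_ : 0 < s - d i)%N u0 v0 _ (hy i) xs ub vc.
  rewrite subn_gt0 subnKC ?(ltnW ds) // => /(_ ds sum) fE.
  have -> : (s + u - d i = s - d i + u)%N by move: ds; clear; lia.
  by rewrite -[RHS]fE.
- rewrite mul0r mulr0 (lin1_0 (((bf _ _).1 _).1 _)); case: ifP => _; rewrite ?subr0 //.
  by rewrite (lin1_0 (((bf _ _).1 _).2 _)).
- rewrite -ds subnn (graded_connected hG) => -[a _ <-]; rewrite subr0.
  have -> : (d i < d i + u)%N by rewrite -{1}[d i]addn0 ltn_add2l.
  rewrite addKn mulr_algr mulr_algl.
  by rewrite (lin1Z _ _ (((bf _ _).1 _).1 _)) (lin1Z _ _ (((bf _ _).1 _).2 _)).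
Qed.

(** A dimension shift on cochains: [F] bounds [f] on the free module covering A_+, restricts to a
    cocycle on the relations, and is a coboundary there because the generators [T] of the second
    syzygies have degrees below [t]. *)
Lemma presentation_coboundary : (forall l, (e l < t)%N) -> (forall r, (h r < t)%N) ->
  exists g : nat -> A -> A -> k, (forall s, bilin (g s)) /\
   forall s u v a b c, (1 <= s)%N -> (0 < u)%N -> (0 < v)%N -> (s + u + v = t)%N ->
    G s a -> G u b -> G v c -> f s u a b c = g (s + u)%N (a * b) c - g s a (b * c).
Proof.
move=> et ht; pose x l := [ffun i => S i l].
have yx l : \sum_i y i * x l i = 0.
  by rewrite -[RHS](yS l); apply: eq_bigr => i _; rewrite ffunE.
have [|||P hP] := module_cocycle (t := t) hG (x := x) (F := F) et ht hT _ _ bF.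
- by move=> i r; rewrite -[RHS](ST i r); apply: eq_bigr => l _; rewrite ffunE.
- move=> v hv Sv; apply: kerT => // i; rewrite -[RHS](Sv i).
  by apply: eq_bigr => l _; rewrite ffunE.
- move=> l u v b c u0 v0 sum ub vc; apply/eqP; rewrite -subr_eq0 -(coboundF (v := v)) //.
    by rewrite yx (lin1_0 (((bf _ _).1 _).1 _)).
  by move=> i; rewrite ffunE.
(* Subtracting [P] leaves the coboundary unchanged and makes the cochain vanish on the relations, so
   that it descends to A_+. *)
pose F' s (z : {ffun 'I_g -> A}) b := F s z b - P (rmul z b).
have bF' s : bilin (F' s).
  split=> [b|z]; apply: lin1_add; try exact: (bF s).1; try exact: (bF s).2.
    by apply: lin1_opp => c z z'; rewrite rmulDl linearP.
  by apply: lin1_opp => c b b'; rewrite rmulDr linearP.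
have F'0 s u (z : {ffun 'I_g -> A}) b : (0 < u)%N -> (s + u = t)%N -> (forall i, ghom (d i) s (z i)) ->
    \sum_i y i * z i = 0 -> G u b -> F' s z b = 0.
  move=> u0 su hz yz ub; have [w [hw zE]] := kerS hz yz.
  have -> : z = \sum_l rmul (x l) (w l).
    apply/ffunP => i; rewrite sum_ffunE zE; apply: eq_bigr => l _.
    by rewrite !ffunE.
  by rewrite /F' (hP s u w b) // subrr.
have [c [co [cG' lco coE _ _]]] := ex_structure hG hC.
(* Basis elements are lifted to the free module and the lift is extended linearly through [co]; by
   [F'0] the choice does not affect the values. *)
have /boolp.choice[lift hlift] sj : exists z : {ffun 'I_g -> A}, (0 < sj.1)%N ->
    (forall i, ghom (d i) sj.1 (z i)) /\ c sj.1 sj.2 = \sum_i y i * z i.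
  case: sj => -[|s] j; first by exists 0.
  have [//|z [hz cE]] := span (s := s.+1) _ (cG' s.+1 j).
  exists [ffun i => z i] => _; split=> [i|] /=; first by rewrite ffunE.
  by rewrite cE; apply: eq_bigr => i _; rewrite ffunE.
pose gg s a b := \sum_(j < C) co s j a * F' s (lift (s, nat_of_ord j)) b.
have ggE s u (z : {ffun 'I_g -> A}) b : (0 < s)%N -> (0 < u)%N -> (s + u = t)%N -> (forall i, ghom (d i) s (z i)) ->
    G u b -> F' s z b = gg s (\sum_i y i * z i) b.
  move=> s0 u0 su hz ub; set a := \sum_i _.
  have sa : G s a.
    apply: subspace_sum => [|i _]; first exact: gr_sub.
    have := hz i; rewrite /ghom; case: leqP => [ds zi|_ ->]; last by rewrite mulr0; apply: gr0.
    by apply: (grM hG (hy i) zi); rewrite subnKC.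
  pose z' := \sum_(j < C) co s j a *: lift (s, nat_of_ord j).
  have yz' : \sum_i y i * z' i = a.
    rewrite [RHS](coE s a sa); under eq_bigr do rewrite sum_ffunE mulr_sumr.
    rewrite exchange_big; apply: eq_bigr => j _ /=.
    rewrite (hlift (s, nat_of_ord j) s0).2 scaler_sumr; apply: eq_bigr => i _.
    by rewrite ffunE scalerAr.
  have -> : gg s a b = F' s z' b.
    rewrite (lin1_sum _ _ _ ((bF' s).1 b)); apply: eq_bigr => j _.
    by rewrite (lin1Z _ _ ((bF' s).1 b)).
  apply/eqP; rewrite -subr_eq0 -(lin1B _ _ ((bF' s).1 b)); apply/eqP/(F'0 s u) => //.
    move=> i; rewrite !ffunE; apply: (subspaceB (ghom_sub hG _ _)) => //.
    rewrite sum_ffunE; apply: subspace_sum => [|j _]; first exact: ghom_sub.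
    rewrite ffunE; apply: (subspaceZ _ (ghom_sub hG _ _)).
    exact: (hlift (s, nat_of_ord j) s0).1.
  under eq_bigr do rewrite !ffunE mulrBr.
  rewrite sumrB -/a yz' subrr //.
exists gg; split.
  move=> s; split=> z.
    by apply: lin1_bigsum => j; apply: lin1_scaler.
  by apply: lin1_bigsum => j; apply: lin1_scale; apply: (bF' s).2.
move=> s u v a b c' s0 u0 v0 sum sa ub vc; have [z [hz aE]] := span s0 sa.
pose z' : {ffun 'I_g -> A} := [ffun i => z i].
have hz' i : ghom (d i) s (z' i) by rewrite ffunE.
have aE' : a = \sum_i y i * z' i by rewrite aE; apply: eq_bigr => i _; rewrite ffunE.
have abE : a * b = \sum_i y i * rmul z' b i.
  by rewrite aE' mulr_suml; apply: eq_bigr => i _; rewrite [in RHS]ffunE mulrA.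
have e1 : F' (s + u)%N (rmul z' b) c' = gg (s + u)%N (\sum_i y i * rmul z' b i) c'.
  apply: (ggE _ v) => //; first by rewrite ltn_addr.
  by move=> i; rewrite ffunE; apply: (ghomM hG (hz' i)); rewrite /ghom leq_addr addKn.
have e2 : F' s z' (b * c') = gg s (\sum_i y i * z' i) (b * c').
  by apply: (ggE _ (u + v)%N); rewrite ?addnA ?addn_gt0 ?u0 //; apply: (grM hG ub vc).
rewrite abE -e1 aE' -e2 (coboundF (v := v)) // /F'.
have -> : rmul (rmul z' b) c' = rmul z' (b * c').
  by apply/ffunP => i; rewrite !ffunE mulrA.
by rewrite opprB addrA subrK.
Qed.

End Cocycle.
End Presentation.

Lemma coherent_ext : finitely_generated A -> exists N0, forall t, (N0 <= t)%N ->
  ext2_from G 1 t /\ ext3_from G 1 t.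
Proof.
move=> /ex_augmentation_generators[g [y [d [d0 hy span]]]].
have [|p [e' [S [hS' yS' kerS']]]] := ex_syzygies hG cG (d := fun _ : 'I_1 => 0%N) (e := d)
  (S := fun _ => y).
- by move=> _ i; rewrite /ghom subn0.
(* A relation of degree 0 has only zero entries, as the generators have positive degree. It is moved
   to degree 1, so that all degrees are positive as [coboundF] requires. *)
pose e l := maxn 1 (e' l).
have S0 l : e' l = 0%N -> forall i, S i l = 0.
  by move=> el i; have := hS' i l; rewrite /ghom el leqn0 eqn0Ngt d0.
have hS i l : ghom (d i) (e l) (S i l).
  have [/S0 ->|/eqP] := eqVneq (e' l) 0%N; first exact: (subspace0 (ghom_sub hG _ _)).
  by rewrite /e => el; rewrite (maxn_idPr _) ?lt0n //; apply/eqP.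
have kerS n x : (forall i, ghom (d i) n (x i)) -> \sum_i y i * x i = 0 ->
    exists w, (forall l, ghom (e l) n (w l)) /\ forall i, x i = \sum_l S i l * w l.
  move=> hx yx; have [//|w [hw xE]] := kerS' n x hx.
  exists (fun l => if e' l == 0%N then 0 else w l); split=> [l|i].
    case: eqVneq => el; first exact: (subspace0 (ghom_sub hG _ _)).
    by rewrite /e (maxn_idPr _) ?lt0n.
  rewrite xE; apply: eq_bigr => l _; case: eqVneq => // /S0 ->.
  by rewrite !mul0r.
have [q [h [T [hT ST kerT]]]] := ex_syzygies hG cG hS.
exists (\max_i d i + \max_l e l + \max_r h r).+1 => t Nt.
have dt i : (d i < t)%N.
  by apply: leq_trans Nt; rewrite ltnS -addnA; apply: leq_trans (leq_addr _ _); apply: leq_bigmax.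
have et l : (e l < t)%N.
  apply: leq_trans Nt; rewrite ltnS addnAC; apply: leq_trans (leq_addl _ _).
  exact: (leq_bigmax l).
have ht r : (h r < t)%N.
  by apply: leq_trans Nt; rewrite ltnS; apply: leq_trans (leq_addl _ _); apply: leq_bigmax.
split; first exact: (presentation_ext2 d0 hy span hS (yS' ord0) kerS).
move=> f bf fc.
have e0 l : (0 < e l)%N by rewrite leq_maxl.
exact: (presentation_coboundary d0 hy span hS (yS' ord0) kerS e0 hT ST kerT bf fc).
Qed.

End CoherentExt.

(** * Finitely presented algebras *)

Section FreeAlgebra.
Context {k : fieldType} {A : algType k} {n : nat} (x : 'I_n -> A).
Local Notation FA := (free_algebra k n).

Lemma linextUc (M : lmodType k) (h : fmonom 'I_n -> M) w c : linext h (mkmalgU w c) = c *: h w.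
Proof. by rewrite (@linextEw _ _ _ _ [fset w]%fset) ?msuppU_le // big_seq_fset1 mcoeffUU. Qed.

Lemma free_ind2 (P : FA -> FA -> Prop) :
  (forall v, P 0 v) -> (forall u u' v, P u v -> P u' v -> P (u + u') v) ->
  (forall u, P u 0) -> (forall u v v', P u v -> P u v' -> P u (v + v')) ->
  (forall w w' c c', P (mkmalgU w c) (mkmalgU w' c')) -> forall u v, P u v.
Proof.
move=> P0 PD P0' PD' h u v; rewrite [u]monalgE; elim/big_rec: _ => // w u' _; apply: PD.
by rewrite [v]monalgE; elim/big_rec: _ => // w' v' _; apply: PD'.
Qed.

Lemma nceval_linext u : nceval x u = linext (fun w : fmonom 'I_n => \prod_(i <- w) x i) u.
Proof. by apply: eq_bigr => w _; rewrite mulr_algl. Qed.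

Lemma nceval_is_linear : linear (nceval x).
Proof. by move=> c u v; rewrite !nceval_linext linearP. Qed.

Lemma nceval0 : nceval x 0 = 0.
Proof. by rewrite nceval_linext linear0. Qed.

Lemma ncevalD u v : nceval x (u + v) = nceval x u + nceval x v.
Proof. by rewrite !nceval_linext linearD. Qed.

Lemma ncevalU w c : nceval x (mkmalgU w c) = c *: \prod_(i <- (w : seq 'I_n)) x i.
Proof. by rewrite nceval_linext linextUc. Qed.

Lemma free_mulU w w' (c c' : k) :
  mkmalgU w c * mkmalgU w' c' = mkmalgU (mmul w w') (c * c') :> FA.
Proof. by rewrite malgM_def fgmulUU. Qed.

Lemma ncevalM u v : nceval x (u * v) = nceval x u * nceval x v.
Proof.
move: u v; apply: free_ind2 => [v|u u' v hu hu'|u|u v v' hv hv'|w w' c c'].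
- by rewrite mul0r nceval0 mul0r.
- rewrite [(u + u') * v]mulrDl [LHS]ncevalD [nceval x (u + u')]ncevalD [RHS]mulrDl.
  exact: (f_equal2 +%R hu hu').
- by rewrite mulr0 nceval0 mulr0.
- rewrite [u * (v + v')]mulrDr [LHS]ncevalD [nceval x (v + v')]ncevalD [RHS]mulrDr.
  exact: (f_equal2 +%R hv hv').
- by rewrite free_mulU !ncevalU fmM big_cat -scalerAl -scalerAr scalerA.
Qed.

End FreeAlgebra.

(** * Square-zero extensions and finitely many relations *)

Section FinitelyPresented.
Context {k : fieldType} {A : algType k} {G : nat -> set A}.
Hypothesis hG : connected_graded G.

Lemma lin1_subspace (M : lmodType k) (f : M -> k) : lin1 f -> subspace [set x | f x = 0].
Proof.
move=> lf; split=> /= [|c x y hx hy]; first exact: lin1_0.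
by rewrite lf hx hy mulr0 addr0.
Qed.

Definition deg_le n (a : A) : Prop := forall j, (n < j)%N -> gproj hG j a = 0.

Lemma deg_leM n m a b : deg_le n a -> deg_le m b -> deg_le (n + m) (a * b).
Proof.
move=> ha hb j nmj; have [N hN] := gproj_sum hG a.
rewrite (hN (maxn N j.+1)) ?leq_maxl // mulr_suml linear_sum big1 // => i _ /=.
have [ni|ni] := ltnP n i; first by rewrite ha // mul0r linear0.
have ij : (i <= j)%N by move: ni nmj; clear; lia.
rewrite -{1}(subnKC ij) (gproj_mull hG _ _ (gprojG hG _ _)) hb ?mulr0 //.
by move: ni nmj ij; clear; lia.
Qed.

Lemma deg_le_prod n (x : 'I_n -> A) M (w : seq 'I_n) : (forall i, deg_le M (x i)) ->
  deg_le (M * size w) (\prod_(i <- w) x i).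
Proof.
move=> hx; elim: w => [|i w IH].
  rewrite big_nil => j; rewrite muln0 => j0; apply: (gproj0 _ _ (gr1 hG)).
  by move=> je; rewrite je in j0.
by rewrite big_cons /= mulnS; apply: deg_leM.
Qed.

(** The augmentation enters because the generators and relations in [finitely_presented] need not be
    homogeneous and may have constant terms. *)
Lemma ex_counit : exists eps : A -> k, [/\ lin1 eps, forall c, eps c%:A = c,
  forall s a, (0 < s)%N -> G s a -> eps a = 0 & forall a b, eps (a * b) = eps a * eps b].
Proof.
have inj (c d : k) : c%:A = d%:A :> A -> c = d.
  by move=> /eqP; rewrite -subr_eq0 -scalerBl scaler_eq0 oner_eq0 orbF subr_eq0 => /eqP.
have /boolp.choice[eps heps] a : exists c : k, gproj hG 0 a = c%:A.
  by have := gprojG hG 0 a; rewrite (graded_connected hG) => -[c _ <-]; exists c.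
have leps : lin1 eps.
  by move=> c a b; apply: inj; rewrite -heps linearP !heps scalerDl scalerA.
have epsA c : eps c%:A = c.
  by apply: inj; rewrite -heps gproj_id //; apply: (grZ hG); apply: (gr1 hG).
have eps0 s a : (0 < s)%N -> G s a -> eps a = 0.
  move=> s0 sa; apply: inj; rewrite -heps scale0r; apply: (gproj0 _ _ sa).
  by move=> se; rewrite -se in s0.
exists eps; split=> // a b.
have lin_b b' : lin1 (fun a => eps (a * b') - eps a * eps b').
  by move=> c u v; rewrite mulrDl -scalerAl !leps mulrDl mulrBr opprD addrACA mulrA.
have lin_a a' : lin1 (fun b => eps (a' * b) - eps a' * eps b).
  by move=> c u v; rewrite mulrDr -scalerAr !leps mulrDr mulrBr opprD addrACA mulrCA.
apply/eqP; rewrite -subr_eq0; apply/eqP.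
apply: (gr_ind hG (lin1_subspace (lin_b b))) => s {}a sa /=.
apply: (gr_ind hG (lin1_subspace (lin_a a))) => u {}b ub /=.
case: s sa => [|s] sa; last first.
  by rewrite (eps0 _ _ _ sa) // (eps0 _ _ _ (grM hG sa ub erefl)) // mul0r subrr.
have := sa; rewrite (graded_connected hG) => -[c _ <-].
by rewrite mulr_algl (lin1Z _ _ leps) epsA subrr.
Qed.

Section Extension.
Variables (t : nat) (f : nat -> A -> A -> k).
Hypothesis bf : forall s, bilin (f s).
Hypothesis fc : forall s u v a b c, (1 <= s)%N -> (0 < u)%N -> (0 < v)%N -> (s + u + v = t)%N ->
    G s a -> G u b -> G v c -> f (s + u)%N (a * b) c = f s a (b * c).

(** The graded cochain [f] as a single Hochschild 2-cocycle with values in k, on which A acts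
    through [eps]; the bounds 0 < s < t normalize it. *)
Let F a b := \sum_(s < t.+1 | (0 < s < t)%N) f s (gproj hG s a) (gproj hG (t - s) b).

Let bF : bilin F.
Proof.
split=> b c x y; rewrite /F mulr_sumr -big_split; apply: eq_bigr => s _ /=.
  by rewrite linearP (bf s).1.
by rewrite linearP (bf s).2.
Qed.

Let FE s u a b : G s a -> G u b ->
  F a b = if [&& (0 < s)%N, (0 < u)%N & (s + u == t)%N] then f s a b else 0.
Proof.
move=> sa ub; have off i : i != s -> f i (gproj hG i a) (gproj hG (t - i) b) = 0.
  by move=> /eqP ne; rewrite (gproj0 hG ne sa) (lin1_0 ((bf i).1 _)).
have [/andP[s0 st]|nst] := boolP (0 < s < t)%N; last first.
  rewrite /F big1 => [|i it]; last first.
    by apply: off; apply: contraNneq nst => <-.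
  case: ifP => // /and3P[s0 u0 /eqP su]; case/negP: nst.
  by rewrite s0 -su -{1}[s]addn0 ltn_add2l.
rewrite /F (bigD1 (Ordinal (leqW st : (s < t.+1)%N))) /= ?s0 // big1 ?addr0; last first.
  by move=> i /andP[_ ne]; apply: off.
rewrite (gproj_id hG sa); have [su|su] := eqVneq (s + u)%N t.
  rewrite -su addKn (gproj_id hG ub) ifT //; first by move: st; rewrite -su -{1}[s]addn0 ltn_add2l => ->.
rewrite !andbF (gproj0 _ _ ub) ?(lin1_0 ((bf s).2 _)) // => tsu.
by move: su; rewrite -tsu subnKC ?eqxx // ltnW.
Qed.

Variable eps : A -> k.
Hypothesis leps : lin1 eps.
Hypothesis epsA : forall c, eps c%:A = c.
Hypothesis eps0 : forall s a, (0 < s)%N -> G s a -> eps a = 0.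
Hypothesis epsM : forall a b, eps (a * b) = eps a * eps b.

Let lin1_mulr (h : A -> k) b : lin1 h -> lin1 (fun a => h (a * b)).
Proof. by move=> lh c u v; rewrite mulrDl -scalerAl lh. Qed.

Let lin1_mull (h : A -> k) b : lin1 h -> lin1 (fun a => h (b * a)).
Proof. by move=> lh c u v; rewrite mulrDr -scalerAr lh. Qed.

Let F_cocycle a b c : F (a * b) c + eps c * F a b = F a (b * c) + eps a * F b c.
Proof.
pose D a b c := F (a * b) c + eps c * F a b - (F a (b * c) + eps a * F b c).
have l1 b' c' : lin1 (fun a => D a b' c').
  apply: lin1_add; [apply: lin1_add|apply/lin1_opp/lin1_add].
  - exact: (lin1_mulr (h := F^~ c') _ (bF.1 _)).
  - exact: lin1_scale (bF.1 _).
  - exact: bF.1.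
  - exact: lin1_scaler.
have l2 a' c' : lin1 (fun b => D a' b c').
  apply: lin1_add; [apply: lin1_add|apply/lin1_opp/lin1_add].
  - exact: (lin1_mull (h := F^~ c') _ (bF.1 _)).
  - exact: lin1_scale (bF.2 _).
  - exact: (lin1_mulr (h := F a') _ (bF.2 _)).
  - exact: lin1_scale (bF.1 _).
have l3 a' b' : lin1 (fun c => D a' b' c).
  apply: lin1_add; [apply: lin1_add|apply/lin1_opp/lin1_add].
  - exact: bF.2.
  - exact: lin1_scaler.
  - exact: (lin1_mull (h := F a') _ (bF.2 _)).
  - exact: lin1_scale (bF.2 _).
apply/eqP; rewrite -subr_eq0; apply/eqP; rewrite -/(D a b c).
apply: (gr_ind hG (lin1_subspace (l1 b c))) => s {}a sa /=.
apply: (gr_ind hG (lin1_subspace (l2 a c))) => u {}b ub /=.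
apply: (gr_ind hG (lin1_subspace (l3 a b))) => v {}c vc /=.
apply/eqP; rewrite /D subr_eq0; apply/eqP.
rewrite (FE (grM hG sa ub erefl) vc) (FE sa ub) (FE sa (grM hG ub vc erefl)) (FE ub vc).
case: s sa => [|s] sa; first have := sa.
  rewrite (graded_connected hG) => -[z _ <-]; rewrite /= mulr0 addr0 add0r epsA mulr_algl.
  rewrite add0n; case: ifP => _; rewrite ?mulr0 //.
  by rewrite (lin1Z _ _ ((bf u).1 _)).
rewrite (eps0 _ sa) // mul0r addr0.
case: v vc => [|v] vc; first have := vc.
  rewrite (graded_connected hG) => -[z _ <-]; rewrite /= add0r epsA mulr_algr addn0.
  case: ifP => _; rewrite ?mulr0 //.
  by rewrite (lin1Z _ _ ((bf s.+1).2 _)).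
rewrite (eps0 _ vc) // mul0r addr0 /= addnS /= addnA.
case: u ub => [|u] ub; first have := ub.
  rewrite (graded_connected hG) => -[z _ <-]; rewrite mulr_algr mulr_algl addn0 add0n addnS /=.
  case: ifP => _ //.
  by rewrite (lin1Z _ _ ((bf s.+1).1 _)) (lin1Z _ _ ((bf s.+1).2 _)).
rewrite -addnS; case: eqP => // sum.
exact: (fc (v := v.+1)).
Qed.

Variables (n : nat) (x : 'I_n -> A).
Local Notation FA := (free_algebra k n).
Local Notation ev w := (\prod_(i <- w) x i).

(* The cocycle F defines a square-zero extension of A; phi is the k-component
   of the homomorphism from the free algebra to it that lifts evaluation. *)
Fixpoint phi (w : seq 'I_n) : k^o :=
  if w is i :: w' then F (x i) (ev w') + eps (x i) * phi w' else 0.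

Let Phi := linext (fun w : fmonom 'I_n => phi w).

Let F1l a : F 1 a = 0.
Proof.
by apply: (gr_ind hG (lin1_subspace (bF.2 1))) => s {}a sa /=; rewrite (FE (gr1 hG) sa).
Qed.

Let eps1 : eps 1 = 1. Proof. by rewrite -[X in eps X]scale1r epsA. Qed.

Lemma phi_cat w w' : phi (w ++ w') = F (ev w) (ev w') + eps (ev w) * phi w' + phi w * eps (ev w').
Proof.
elim: w => [|i w IH]; first by rewrite big_nil F1l eps1 mul1r mul0r add0r addr0.
rewrite /= IH big_cat big_cons /= epsM !mulrDr !mulrDl.
have -> : F (x i) (ev w * ev w') = F (x i * ev w) (ev w') + eps (ev w') * F (x i) (ev w) -
    eps (x i) * F (ev w) (ev w') by rewrite F_cocycle addrK.
by ring.
Qed.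

Let PhiE u v : Phi (u * v) =
  F (nceval x u) (nceval x v) + eps (nceval x u) * Phi v + Phi u * eps (nceval x v).
Proof.
have PhiD a b : Phi (a + b) = Phi a + Phi b by rewrite /Phi linearD.
have Phi0 : Phi 0 = 0 by rewrite /Phi linear0.
have Fl a a' b : F (a + a') b = F a b + F a' b by apply: lin1D (bF.1 _).
have Fr a b b' : F a (b + b') = F a b + F a b' by apply: lin1D (bF.2 _).
have epsD a b : eps (a + b) = eps a + eps b by apply: lin1D.
have e00 : eps 0 = 0 by apply: lin1_0.
move: u v; apply: free_ind2 => [v|u u' v hu hu'|u|u v v' hv hv'|w w' c c'].
- by rewrite mul0r nceval0 Phi0 (lin1_0 (bF.1 _)) e00 !mul0r !addr0.
- rewrite [(u + u') * v]mulrDl [LHS]PhiD [nceval x (u + u')]ncevalD Fl epsD [Phi (u + u')]PhiD.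
  apply: etrans (f_equal2 +%R hu hu') _; move: (Phi u) (Phi u') (Phi v) => p1 p2 p3; ring.
- by rewrite mulr0 nceval0 Phi0 (lin1_0 (bF.2 _)) e00 !mulr0 !addr0.
- rewrite [u * (v + v')]mulrDr [LHS]PhiD [nceval x (v + v')]ncevalD Fr epsD [Phi (v + v')]PhiD.
  apply: etrans (f_equal2 +%R hv hv') _; move: (Phi u) (Phi v') (Phi v) => p1 p2 p3; ring.
- rewrite free_mulU /Phi !linextUc !ncevalU fmM phi_cat (lin1Z _ _ (bF.1 _)) (lin1Z _ _ (bF.2 _)).
  rewrite !(lin1Z _ _ leps) -![_ *: _]/(_ * _); move: (phi w) (phi w') => p1 p2; ring.
Qed.

Variable M : nat.
Hypothesis xM : forall i, deg_le M (x i).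

(** [F] sees only total degree [t], which a short product of generators does not reach. *)
Lemma phi_short w : (M * size w < t)%N -> phi w = 0.
Proof.
elim: w => //= i w IH; rewrite mulnS => tw; rewrite {}IH ?mulr0 ?addr0; last first.
  by move: tw; clear; lia.
apply: big1 => s /andP[s0 st]; have [Ms|sM] := ltnP M s.
  by rewrite (xM i) // (lin1_0 ((bf s).1 _)).
rewrite (deg_le_prod (w := w) xM) ?(lin1_0 ((bf s).2 _)) //.
by move: tw sM; clear; lia.
Qed.

(** All monomials of the relations are short, so [Phi] kills the relations and the ideal they
    generate. The lift to the square-zero extension then factors through [A], and the k-component of
    this splitting is [g]. *)
Lemma ext2_of_presentation (r : seq FA) : (forall a, exists u, nceval x u = a) ->
  [set u | nceval x u = 0] = ideal_generated [set u | u \in r] ->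
  (forall u w, u \in r -> w \in msupp u -> (M * size (w : seq 'I_n) < t)%N) ->
  exists g : A -> k, lin1 g /\ forall s u a b, (1 <= s)%N -> (0 < u)%N -> (s + u = t)%N ->
    G s a -> G u b -> f s a b = g (a * b).
Proof.
move=> surj rel hr.
have Phi0 u : nceval x u = 0 -> Phi u = 0.
  move=> u0; have : ideal_generated [set u | u \in r] u by rewrite -rel.
  have nN a : nceval x (- a) = - nceval x a.
    by apply/eqP; rewrite -addr_eq0 -ncevalD addNr nceval0.
  have F0 a : F a 0 = 0 by apply: lin1_0 (bF.2 _).
  have F0' a : F 0 a = 0 by apply: lin1_0 (bF.1 _).
  have e00 : eps 0 = 0 by apply: lin1_0.
  move=> /(_ [set v | nceval x v = 0 /\ Phi v = 0])[].
  - split; first split=> /=.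
    + by rewrite nceval0 /Phi linear0.
    + move=> a b [a0 a1] [b0 b1]; rewrite ncevalD nN a0 b0 subrr; split=> //.
      by rewrite /Phi linearB /= -!/(Phi _) a1 b1 subrr.
    + move=> a b [a0 a1]; rewrite ncevalM PhiE a0 a1 mul0r F0' e00 !mul0r !addr0 //.
  - by move=> a b [a0 a1]; split; [rewrite ncevalM a0 mulr0|rewrite PhiE a0 a1 F0 e00 !mulr0 !addr0].
  - move=> v vr; split.
      have : [set u | nceval x u = 0] v by rewrite rel => I _; apply.
      by [].
    rewrite /Phi /linext big_seq big1 // => w wv.
    by rewrite phi_short ?scaler0 //; apply: hr wv.
  - by [].
have /boolp.choice[sec secE] := surj.
have nsub u v : nceval x u = nceval x v -> Phi u = Phi v.
  move=> uv; apply/eqP; rewrite -subr_eq0 -[_ - _]linearB; apply/eqP/Phi0.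
  by rewrite -scaleN1r addrC nceval_is_linear uv scaleN1r addNr.
exists (fun a => Phi (sec a)); split.
  move=> c a b; rewrite (nsub _ (c *: sec a + sec b)) /Phi ?linearP //.
  by rewrite nceval_is_linear !secE.
move=> s u a b s0 u0 su sa ub; rewrite (nsub _ (sec a * sec b)) ?ncevalM ?secE //.
rewrite PhiE !secE (eps0 s0 sa) (eps0 u0 ub) mul0r mulr0 !addr0 (FE sa ub).
by rewrite s0 u0 su eqxx.
Qed.

End Extension.
Lemma finitely_presented_ext2 : finitely_presented A ->
  exists N0, forall t, (N0 <= t)%N -> ext2_from G 1 t.
Proof.
move=> [n [x [r [surj rel]]]]; have [eps [leps epsA eps0 epsM]] := ex_counit.
have [M hM] := gproj_bound hG x.
have xM i : deg_le M (x i).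
  move=> j Mj; rewrite (hM i M) // linear_sum big1 // => l _ /=.
  apply: (gproj0 _ _ (gprojG hG _ _)) => jl; have := ltn_ord l.
  by rewrite -jl ltnNge ltnW.
exists (M * (\max_(u <- r) \max_(w <- msupp u) size (w : seq 'I_n))).+1 => t Nt f bf fc.
apply: (ext2_of_presentation bf fc leps epsA eps0 epsM xM surj rel) => u w ur wu.
apply: leq_trans Nt; rewrite ltnS leq_mul2l; apply/orP; right.
apply: (@leq_trans (\max_(w <- msupp u) size (w : seq 'I_n))).
  by apply: (leq_bigmax_seq (F := fun w : fmonom 'I_n => size (w : seq 'I_n))).
pose L (u : free_algebra k n) := (\max_(w <- msupp u) size (w : seq 'I_n))%N.
have := leq_bigmax_seq (P := xpredT) (F := L) u ur isT; exact.
Qed.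

End FinitelyPresented.

Theorem corollary1p7 (R : realType) (k : fieldType) (A : algType k)
    (G : nat -> set A) (hG : connected_graded G)
    (hfg : finitely_generated A) (hGK : GKdim R A = 1%:E)
    (hA : (two_sided_noetherian A \/ right_noetherian A) \/
          (prime_ring A \/ semiprime_ring A) \/
          coherent G \/
          (finitely_presented A /\ finite_set [set: k]) \/
          Koszul G R \/
          finite_rate G R) :
  eventually_periodic (fun n : nat => dimk (G n)).
Proof.
have [C hC] : exists C, forall s, has_dim (G s) (dimk (G s)) /\ (dimk (G s) <= C)%N.
  by apply: (bounded_dims (R := R) hG hfg); rewrite hGK.
have [D [_ hD]] := ex_window hG hfg.
have ext_case : (exists N0, forall t, (N0 <= t)%N -> ext2_from G 1 t /\ ext3_from G 1 t) ->
    eventually_periodic (fun n => dimk (G n)).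
  move=> [N0 hN]; apply: (@ext_periodic _ _ _ hG C D hC hD N0) => t /hN[] //.
case: hA => [hN|[hP|[hc|[[hp hk]|hR]]]].
- apply: (noetherian_periodic hG _ hC hD).
  by case: hN => // /right_noetherian_two_sided.
- apply: (semiprime_periodic hG hC hD).
  by case: hP => // /prime_semiprime.
- by apply: ext_case; apply: coherent_ext hG C hC hc hfg.
- have [N0 hN] := finitely_presented_ext2 hG hp.
  exact: (@ext2_finite_periodic _ _ _ hG C D hC hD N0).
- apply: ext_case; apply: (@finite_rate_ext R _ _ _ hG).
  by case: hR => // /Koszul_finite_rate.
Qed.
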